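(* For $u,w\in\mathbb N^n$ and parameters $a,b,c$, $$\sum_{v\in\mathbb N^n}\frac{(a)_v}{(c)_v}\,\mathsf E_{u/v}(a,b)\,\mathsf E_{v/w}(b,c)=\frac{(a)_w(b)_u}{(b)_w(c)_u}\,\mathsf E_{u/w}(a,c).$$
   Context: Notation. Fix $n\ge 1$, a complex $q$ with $|q|<1$, and $t$, with $q,t$ generic (the coefficients of all polynomials below are rational functions of $q,t$). $\mathbb N=\{0,1,2,\dots\}$, $x=(x_1,\dots,x_n)$. A composition is $u=(u_1,\dots,u_n)\in\mathbb N^n$; $|u|=u_1+\cdots+u_n$; $u^+$ is the weakly decreasing rearrangement of $u$; $0=(0,\dots,0)$. $(b)_k=\prod_{i=0}^{k-1}(1-bq^i)$ for $k\in\mathbb N$, and for a composition $u$, $(b)_u=\prod_{i=1}^n(bt^{1-i})_{u^+_i}$. The spectral vector $\langle u\rangle\in\mathbb C^n$ has entries $\langle u\rangle_i=q^{u_i}t^{k_i}$, where $k_i=\#\{j:u_j<u_i\}+\#\{j>i:u_j=u_i\}$; so $\langle 0\rangle=(t^{n-1},\dots,t,1)$. The diagram of $u$ is the set of $s=(i,j)$ with $1\le i\le n$, $1\le j\le u_i$; for such $s$, $a(s)=u_i-j$ and $l(s)=\#\{k>i: j\le u_k\le u_i\}+\#\{k<i: j\le u_k+1\le u_i\}$. Put $n(u)=\sum_{s\in u}l(s)$, $n'(u)=\sum_i\binom{u_i}{2}$, $c'_u=\prod_{s\in u}(1-q^{a(s)+1}t^{l(s)})$. The interpolation Macdonald polynomial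 $M_u(x)$ is the unique polynomial of degree $|u|$ in $x_1,\dots,x_n$ such that $M_u(\langle v\rangle)=0$ for all $v\in\mathbb N^n$ with $|v|\le|u|$, $v\ne u$, and such that the coefficient of $x^u=x_1^{u_1}\cdots x_n^{u_n}$ is $q^{-n'(u)}$. Its normalised version is $\mathsf M_u(x)=q^{n'(u)}t^{n(u)}M_u(x)/c'_u$. Let $\mathsf E_u(x)=\lim_{z\to0}z^{|u|}\mathsf M_u(x/z)$ be the top-degree homogeneous component of $\mathsf M_u$ (a normalised nonsymmetric Macdonald polynomial: $\mathsf E_u=t^{n(u)}E_u/c'_u$, with $E_u$ the nonsymmetric Macdonald polynomial in which $x^u$ has coefficient 1). Connection coefficients: define $c_{uv}(a,b)$ by $\mathsf M_u(ax)=\sum_v c_{uv}(a,b)\mathsf M_v(bx)$, and $\mathsf E_{u/v}(a,b)=\dfrac{\mathsf E_v(\langle 0\rangle/a)}{\mathsf E_u(\langle 0\rangle/b)}\,c_{uv}(a,b)$. It vanishes if $|v|>|u|$, so the sum over $v$ is finite. The parameters $a,b,c$ are generic (the identity is one of rational functions in them). *)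

(* Defs.v *)
From mathcomp Require Import all_boot all_order all_algebra.
From mathcomp Require Import reals.
From mathcomp Require Import complex.
From mathcomp Require Import mpoly.

Set Implicit Arguments.
Unset Strict Implicit.
Unset Printing Implicit Defensive.

Import Order.TTheory GRing.Theory Num.Theory.
Local Open Scope ring_scope.

Section InterpolationMacdonald.

Variables (K : fieldType) (n : nat) (q t : K).
Implicit Types (u v : 'X_{1..n}) (a b : K).

(* Non-resonance: q and t are nonzero and multiplicatively independent, so
   that the factors 1 - q^k t^l with (k, l) != (0, 0) are invertible. *)
Definition generic_qt : Prop :=
  [/\ q != 0, t != 0 & forall k l : int, q ^ k * t ^ l = 1 -> k = 0 /\ l = 0].

Definition qpoch b (k : nat) : K := \prod_(i < k) (1 - b * q ^+ i).

(* The indices i < n start from 0, so t^(1-i) becomes t ^- i. *)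
Definition qpochc b u : K :=
  \prod_(i < n) qpoch (b * t ^- i) (nth 0%N (sort geq u) i).

Definition spectral u (i : 'I_n) : K :=
  q ^+ u i * t ^+ (#|[set j : 'I_n | (u j < u i)%N]|
                   + #|[set j : 'I_n | (i < j)%N && (u j == u i)]|).

Definition arm u (i : 'I_n) (j : nat) : nat := u i - j.

Definition leg u (i : 'I_n) (j : nat) : nat :=
  #|[set k : 'I_n | (i < k)%N && (j <= u k <= u i)%N]|
  + #|[set k : 'I_n | (k < i)%N && (j <= (u k).+1 <= u i)%N]|.

Definition nleg u : nat :=
  \sum_(i < n) \sum_(1 <= j < (u i).+1) leg u i j.

Definition nbin u : nat := \sum_(i < n) 'C(u i, 2).

Definition cprime u : K :=
  \prod_(i < n) \prod_(1 <= j < (u i).+1)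
    (1 - q ^+ (arm u i j).+1 * t ^+ leg u i j).

Definition is_interpolation_macdonald u (p : {mpoly K[n]}) : Prop :=
  [/\ msize p = (mdeg u).+1,
      forall v, (mdeg v <= mdeg u)%N -> v != u -> p.@[spectral v] = 0
    & p@_u = q ^- nbin u].

Definition dilate a (p : {mpoly K[n]}) : {mpoly K[n]} :=
  p \mPo [tuple a *: 'X_i | i < n].

Section Connection.

Variable M : 'X_{1..n} -> {mpoly K[n]}.

Definition normM u : {mpoly K[n]} :=
  (q ^+ nbin u * t ^+ nleg u / cprime u) *: M u.

(* This is the limit of z^|u| normM_u (x / z) as z tends to 0, since normM u
   has degree |u|. *)
Definition normE u : {mpoly K[n]} := pihomog mdeg (mdeg u) (normM u).

(* The expansion is a finite linear combination; the bound d on the degrees in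
   it is not prescribed. *)
Definition is_connection a b (C : 'X_{1..n} -> 'X_{1..n} -> K) : Prop :=
  forall u, exists d : nat,
    (forall v, (d <= mdeg v)%N -> C u v = 0) /\
    dilate a (normM u) =
      \sum_(v : 'X_{1..n < d}) C u v *: dilate b (normM v).

Definition skewE (C : K -> K -> 'X_{1..n} -> 'X_{1..n} -> K) a b u v : K :=
  (normE v).@[fun i => spectral 0%MM i / a]
  / (normE u).@[fun i => spectral 0%MM i / b] * C a b u v.

End Connection.

End InterpolationMacdonald.

(* Main.v *)
(** Let E_u be the top component of M_u.  The M_u(cx) are eigenfunctions, with eigenvalues
    1/<u>_i, of operators Y_i + c^-1 Z_i in which Y_i is homogeneous of degree
    0 and diagonal on the E_u, while the Z_i lower the degree by one and
    commute with each other.  In the basis E_u, each entry of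
    F(p) = prod_i (Y_i + c^-1 Z_i - p) is a polynomial in p with enough known
    zeros to be determined by its leading coefficient, which is an entry of
    T = prod_i (1 + c^-1 Z_i); so F(p) is T between two diagonal operators.
    Products of the F(q^i p) give operators that are diagonal on the M_u(cx)
    with eigenvalues (q^k b)_u / (b)_u up to powers, and since the T for
    different c commute, these operators satisfy a star-triangle relation for
    the three bases M_u(ax), M_u(bx), M_u(cx) when a = q^k b and c = q^l b.
    Its matrix entries are the identity for these a and c, and both sides are
    rational functions of a and c. *)

Require Import Defs.
From mathcomp Require Import all_boot all_order all_algebra.
From mathcomp Require Import reals.
From mathcomp Require Import complex.
From mathcomp Require Import perm mpoly.
From mathcomp Require Import zify ring.

Set Implicit Arguments.
Unset Strict Implicit.
Unset Printing Implicit Defensive.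

Import Order.TTheory GRing.Theory Num.Theory.
Local Open Scope ring_scope.

(** The rows of a composition are labelled by the power of t that its parts carry in the spectral
    vector, not by position, so that adjacent swaps leave row lengths alone. At p = 1/<u>_i the
    operator F(p) sends E_u to a combination of E_v in which no row is longer and the row of i is
    strictly shorter. An entry of F(p) lowering the degree by k has degree at most n - k in p, while
    u and v share at least n - k rows; hence a nonzero entry forces exactly n - k common rows, and
    all its zeros are known.

    The diagonal factors that result are products over cells. For p = b t^(1-n) they amount to
    (qb)_u on the output side and 1/(b)_u on the input side, so the product over b, qb, q^2 b, ...
    telescopes. A factor q^(-|u|) remains; on E_u it is the dilation by 1/q, and moving it to the
    right past a T replaces c^-1 by q c^-1. Both sides of the star-triangle relation then contain
    the same commuting T's.

    Multiplicative independence of q and t makes a polynomial determined by its values at the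
    spectral vectors of degree at most its own; most operator identities are checked there or on the
    eigenbases this provides. *)

(** * Compositions: ranks, adjacent swaps and the affine step *)

Section Compositions.

Variable m : nat.
Implicit Types (u v w : 'X_{1..m.+1}) (i : 'I_m.+1) (j : nat).

(** Merges the two counts in [spectral] into one strict total order, so that the powers of [t] in a
    spectral vector are a permutation of 0, ..., m. *)
Definition below u (j i : 'I_m.+1) : bool := (u j < u i)%N || ((i < j)%N && (u j == u i)).

Definition krank u i : nat := #|[set j | below u j i]|.

Lemma spectralE (K : fieldType) (q t : K) u i :
  spectral q t u i = q ^+ u i * t ^+ krank u i.
Proof.
rewrite /spectral /krank; congr (_ * t ^+ _).
rewrite -cardsUI -[RHS]addn0; congr (_ + _)%N; last first.
  apply/eqP; rewrite cards_eq0; apply/eqP/setP=> j; rewrite !inE.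
  by case: ltngtP; rewrite ?andbF.
by apply: eq_card => j; rewrite !inE.
Qed.

Lemma below_irr u i : below u i i = false.
Proof. by rewrite /below; lia. Qed.

Lemma below_trans u (i j k : 'I_m.+1) : below u i j -> below u j k -> below u i k.
Proof. rewrite /below; lia. Qed.

Lemma below_total u (i j : 'I_m.+1) : i != j -> below u i j || below u j i.
Proof. rewrite /below -val_eqE /=; lia. Qed.

Lemma krank_lt u (j i : 'I_m.+1) : below u j i -> (krank u j < krank u i)%N.
Proof.
move=> ji; apply: proper_card; apply/properP; split.
  by apply/subsetP=> k; rewrite !inE => /below_trans; apply.
by exists j; rewrite !inE // below_irr.
Qed.

Lemma krank_inj u : injective (krank u).
Proof.
move=> i j eq_ij; apply/eqP/negPn/negP => /(below_total u).
by case/orP=> /krank_lt; rewrite eq_ij ltnn.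
Qed.

Lemma krank_ltn u i : (krank u i < m.+1)%N.
Proof.
rewrite /krank -[X in (_ < X)%N](card_ord m.+1) -cardsT; apply: proper_card.
apply/properP; split; first by apply/subsetP=> j; rewrite !inE.
by exists i; rewrite !inE // below_irr.
Qed.

Definition krank_ord u i : 'I_m.+1 := Ordinal (krank_ltn u i).

Lemma krank_ord_inj u : injective (krank_ord u).
Proof. by move=> i j /(congr1 val) /krank_inj. Qed.

(* The part of u whose spectral value carries the power t^e. *)
Definition rho u (e : 'I_m.+1) : nat := u (invF (@krank_ord_inj u) e).

Lemma rho_krank u i : rho u (krank_ord u i) = u i.
Proof. by rewrite /rho (invF_f (@krank_ord_inj u)). Qed.

Lemma rho_surj u e : exists i, e = krank_ord u i.
Proof. by exists (invF (@krank_ord_inj u) e); rewrite f_invF. Qed.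

Lemma krank_reindex (R : Type) (idx : R) (op : Monoid.com_law idx) u
    (F : nat -> nat -> R) :
  \big[op/idx]_(i < m.+1) F (u i) (krank u i)
  = \big[op/idx]_(e < m.+1) F (rho u e) e.
Proof.
rewrite [RHS](reindex_inj (@krank_ord_inj u)); apply: eq_bigr => i _.
by rewrite rho_krank.
Qed.

Lemma krank_transfer u v (s : 'I_m.+1 -> 'I_m.+1) :
  injective s -> (forall i i', below v i' i = below u (s i') (s i)) ->
  forall i, krank v i = krank u (s i).
Proof.
move=> s_inj H i; rewrite /krank -[RHS](card_preimset _ s_inj).
by apply: eq_card => j; rewrite !inE H.
Qed.

Lemma krank_eq_rho u v (s : 'I_m.+1 -> 'I_m.+1) :
  (forall i, krank v i = krank u (s i)) ->
  forall i, rho v (krank_ord u (s i)) = v i.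
Proof.
move=> H i; rewrite -(rho_krank v i); congr (rho v _).
by apply: val_inj; rewrite /= H.
Qed.

Definition swp (j : nat) : 'I_m.+1 -> 'I_m.+1 := tperm (inord j) (inord j.+1).

Definition sw (j : nat) u := [multinom u (swp j i) | i < m.+1].

Lemma swE j u i : sw j u i = u (swp j i).
Proof. exact: mnmE. Qed.

Lemma swpK j : involutive (swp j).
Proof. exact: tpermK. Qed.

Lemma swp_inj j : injective (swp j).
Proof. exact: perm_inj. Qed.

Lemma swp_l j : swp j (inord j) = inord j.+1.
Proof. by rewrite /swp tpermL. Qed.

Lemma swp_r j : swp j (inord j.+1) = inord j.
Proof. by rewrite /swp tpermR. Qed.

Lemma swp_o j i : (j < m)%N -> (i != j :> nat) -> (i != j.+1 :> nat) ->
  swp j i = i.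
Proof.
move=> jm H1 H2; rewrite /swp tpermD // -val_eqE /= inordK; lia.
Qed.

Lemma swpE j i : (j < m)%N ->
  (swp j i : nat) = (if i == j :> nat then j.+1 else
                     if i == j.+1 :> nat then j else i)%N.
Proof.
move=> jm; case: eqP => [E|/eqP N1].
  have -> : i = inord j by apply: val_inj; rewrite /= inordK //; lia.
  by rewrite swp_l inordK.
case: eqP => [E|/eqP N2].
  have -> : i = inord j.+1 by apply: val_inj; rewrite /= inordK //; lia.
  by rewrite swp_r inordK //; lia.
by rewrite swp_o.
Qed.

Lemma swK j : involutive (sw j).
Proof. by move=> u; apply/mnmP=> i; rewrite !swE swpK. Qed.

Lemma mdeg_sw j u : mdeg (sw j u) = mdeg u.
Proof.
rewrite !mdegE (reindex_inj (@swp_inj j)) /=.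
by apply: eq_bigr => i _; rewrite swE swpK.
Qed.

Lemma sw_id j u : u (inord j) = u (inord j.+1) -> sw j u = u.
Proof.
move=> E; apply/mnmP=> i; rewrite swE /swp.
by case: tpermP => // ->.
Qed.

Lemma krank_sw j u : (j < m)%N -> u (inord j) != u (inord j.+1) ->
  forall i, krank (sw j u) i = krank u (swp j i).
Proof.
move=> jm neq; apply: (krank_transfer (@swp_inj j)) => i i'.
rewrite /below !swE; congr (_ || _).
have [E|] := eqVneq (u (swp j i')) (u (swp j i)); rewrite ?andbF // !andbT.
have H : forall x : 'I_m.+1, x = j :> nat -> x = inord j :> 'I_m.+1.
  by move=> x xj; apply: val_inj; rewrite /= inordK //; lia.
have H' : forall x : 'I_m.+1, x = j.+1 :> nat -> x = inord j.+1 :> 'I_m.+1.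
  by move=> x xj; apply: val_inj; rewrite /= inordK //; lia.
have F (x y : 'I_m.+1) : (x == j :> nat) -> (y == j.+1 :> nat) ->
    u (swp j y) != u (swp j x).
  by move=> /eqP /H -> /eqP /H' ->; rewrite swp_l swp_r.
rewrite !swpE //.
have := F i i'; have := F i' i; rewrite E eqxx => F1 F2.
by repeat (case: ifP => ?); lia.
Qed.

Lemma rho_sw j u : (j < m)%N -> rho (sw j u) =1 rho u.
Proof.
move=> jm e.
have [/sw_id -> //|neq] := eqVneq (u (inord j)) (u (inord j.+1)).
have [i ->] := rho_surj u e; rewrite rho_krank.
by rewrite -[i in LHS](swpK j) (krank_eq_rho (krank_sw jm neq)) swE swpK.
Qed.

Lemma krank_eq_next j u : (j < m)%N -> u (inord j) = u (inord j.+1) ->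
  krank u (inord j) = (krank u (inord j.+1)).+1.
Proof.
move=> jm E; rewrite /krank.
have -> : [set k | below u k (inord j)] =
    inord j.+1 |: [set k | below u k (inord j.+1)].
  apply/setP=> k; rewrite !inE /below E -val_eqE /= !inordK; try lia.
  have [Ek|Nk] := eqVneq (k : nat) j.+1; last lia.
  have -> : k = inord j.+1 by apply: val_inj; rewrite /= inordK //; lia.
  by rewrite eqxx inordK; lia.
by rewrite cardsU1 inE below_irr.
Qed.

Definition crot (k : nat) i : 'I_m.+1 :=
  if (i < k)%N then inord (i.+1 %% k) else i.

Lemma crotE k i : (k <= m.+1)%N ->
  (crot k i : nat) =
    (if i < k then if i.+1 == k then 0 else i.+1 else i)%N.
Proof.
move=> km; rewrite /crot; case: ltnP => // ik.
have [E|N] := eqVneq i.+1 k; first by rewrite E modnn inordK.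
by rewrite modn_small ?inordK; lia.
Qed.

Lemma crot_inj k : (k <= m.+1)%N -> injective (crot k).
Proof.
move=> km i j /(congr1 (@nat_of_ord _)); rewrite !crotE // => H.
by apply: val_inj => /=; move: H; repeat case: ifP; lia.
Qed.

(** For [k = m.+1] this is the affine step from (u_1, ..., u_n) to (u_2, ..., u_n, u_1 + 1). Smaller
    [k] serve the induction on the number of variables in [unisolvent_tail]. *)
Definition Phik (k : nat) u :=
  [multinom (u (crot k i) + (i.+1 == k :> nat))%N | i < m.+1].

Lemma PhikE k u i : Phik k u i = (u (crot k i) + (i.+1 == k :> nat))%N.
Proof. exact: mnmE. Qed.

Lemma mdeg_Phik k u : (0 < k <= m.+1)%N -> mdeg (Phik k u) = (mdeg u).+1.
Proof.
case: k => // k km; rewrite !mdegE.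
rewrite (eq_bigr (fun i => u (crot k.+1 i) + (i == inord k :> 'I_m.+1))%N).
  rewrite big_split /= [X in (_ + X)%N](bigD1 (inord k)) //= eqxx.
  rewrite [X in (_ + (_ + X))%N]big1 => [|i /negbTE -> //].
  by rewrite [in RHS](reindex_inj (@crot_inj k.+1 _)) // addn1.
move=> i _; rewrite PhikE; congr (_ + (nat_of_bool _))%N.
by rewrite -val_eqE /= inordK ?eqSS //; lia.
Qed.

(** The moved entry keeps its rank: parts tied with it lay to its right, hence below, and are now
    strictly smaller; parts exceeding it by one now tie with it but lie to its left, hence still
    above. The zero tail is below it before and after. *)
Lemma krank_Phik k u : (0 < k <= m.+1)%N ->
  (forall i, (k <= i)%N -> u i = 0%N) ->
  forall i, krank (Phik k u) i = krank u (crot k i).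
Proof.
move=> /andP[k0 km] supp; apply: (krank_transfer (crot_inj km)) => i j.
rewrite /below !PhikE.
have Ri := crotE i km; have Rj := crotE j km.
have [ik|ik] := ltnP i k; have [jk|jk] := ltnP j k;
  rewrite ?ik ?jk in Ri Rj.
- have [E|N] := eqVneq i j; first by rewrite E; lia.
  by rewrite -val_eqE /= in N; move: Ri Rj; repeat case: ifP; lia.
- have -> : crot k j = j by apply: val_inj; rewrite /= Rj ltnNge jk.
  by rewrite (supp j jk); move: Ri; repeat case: ifP; lia.
- have -> : crot k i = i by apply: val_inj; rewrite /= Ri ltnNge ik.
  by rewrite (supp i ik); move: Rj; repeat case: ifP; lia.
- have -> : crot k i = i by apply: val_inj; rewrite /= Ri ltnNge ik.
  have -> : crot k j = j by apply: val_inj; rewrite /= Rj ltnNge jk.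
  by rewrite (supp i ik) (supp j jk); lia.
Qed.

Definition Phi u := Phik m.+1 u.

Definition unPhik (k : nat) u :=
  [multinom (u (inord (if i < k then if i == 0 :> nat then k.-1 else i.-1
                       else i)) - ((i == 0 :> nat) : nat))%N | i < m.+1].

Lemma unPhikK k u : (0 < k <= m.+1)%N -> (0 < u (inord k.-1))%N ->
  Phik k (unPhik k u) = u.
Proof.
move=> /andP[k0 km] u0; apply/mnmP=> i; rewrite PhikE mnmE crotE //.
have [ik|ik] := ltnP i k; last first.
  rewrite ltnNge ik /= inord_val; lia.
have [E|N] := eqVneq i.+1 k.
  rewrite k0 eqxx.
  have -> : i = inord k.-1 by apply: val_inj; rewrite /= inordK //; lia.
  by lia.
rewrite ifT /=; last lia.
by rewrite subn0 inord_val addn0.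
Qed.

Lemma mdeg_Phi u : mdeg (Phi u) = (mdeg u).+1.
Proof. by apply: mdeg_Phik; rewrite leqnn. Qed.

Lemma krank_Phi u i : krank (Phi u) i = krank u (crot m.+1 i).
Proof. by apply: krank_Phik => [|j]; rewrite ?leqnn // leqNgt ltn_ord. Qed.

Lemma crot_max : crot m.+1 ord_max = ord0.
Proof. by apply: val_inj; rewrite /= crotE //= ltnS leqnn eqxx. Qed.

Lemma rho_Phi u e : rho (Phi u) e = (rho u e + (e == krank_ord u ord0))%N.
Proof.
have [i0 ->] := rho_surj u e; have := @crot_inj m.+1 (leqnn _) => ri.
rewrite rho_krank -[i0](f_invF ri); set i := invF ri i0.
rewrite (krank_eq_rho (krank_Phi u)) PhikE; congr (_ + (nat_of_bool _))%N.
rewrite (inj_eq (@krank_ord_inj u)) -crot_max (inj_eq ri) -val_eqE /=; lia.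
Qed.

Lemma krank_max0 u : u ord_max = 0%N -> krank u ord_max = 0%N.
Proof.
move=> u0; apply/eqP; rewrite cards_eq0; apply/eqP/setP=> j; rewrite !inE /below u0 /=.
by rewrite ltnNge -ltnS ltn_ord.
Qed.

Lemma krank_tail (k : nat) u i : (forall i, (k <= i)%N -> u i = 0%N) -> (k <= i)%N ->
  krank u i = (m - i)%N.
Proof.
move=> supp ki; rewrite /krank.
have -> : [set j | below u j i] = [set j : 'I_m.+1 | (i < j)%N].
  apply/setP=> j; rewrite !inE /below (supp i ki).
  have [ij|] := ltnP i j; last by rewrite ltn0.
  by rewrite (supp j) ?eqxx ?orbT //; lia.
rewrite -(card_imset _ (@rev_ord_inj m.+1)).
have -> : [set rev_ord x | x in [set j : 'I_m.+1 | (i < j)%N]] =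
    [set j : 'I_m.+1 | (j < m - i)%N].
  apply/setP=> j; rewrite !inE; apply/imsetP/idP => [[x]|H].
    by rewrite inE => ix -> /=; have := ltn_ord x; lia.
  by exists (rev_ord j); rewrite ?rev_ordK // inE /=; lia.
have mi : (m - i <= m.+1)%N by lia.
rewrite -[RHS]card_ord -cardsT -(@card_imset _ _ (widen_ord mi)); last first.
  by move=> x y /(congr1 val) /= /val_inj.
apply: eq_card => j; rewrite !inE; apply/idP/imsetP => [H|[x _ ->]]; last exact: (ltn_ord x).
by exists (Ordinal H); rewrite ?inE //; apply: val_inj.
Qed.

(** Bubble sort: swaps reduce to the case where the entries satisfying [Q] form a final segment. The
    measure is the sum of the distances of these entries from the last place. *)
Lemma sort_ind (Q : pred nat) (P : 'X_{1..m.+1} -> Prop) :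
  (forall u, (forall i i', (i < i')%N -> Q (u i) -> Q (u i')) -> P u) ->
  (forall u j, (j < m)%N -> Q (u (inord j)) -> ~~ Q (u (inord j.+1)) ->
     P (sw j u) -> P u) ->
  forall u, P u.
Proof.
move=> P0 PS u.
pose wt u := (\sum_(i < m.+1 | Q (u i)) (m - i))%N.
have [N] := ubnP (wt u); elim: N u => // N IH u /ltnSE leN.
have [H|] := boolP [forall j : 'I_m, Q (u (inord j)) ==> Q (u (inord j.+1))].
  apply: P0 => i j ij Qi.
  have {ij}[k E] : exists k, (j = i + k :> nat)%N by exists (j - i)%N; lia.
  elim: k j E => [|k IHk] j E.
    by have -> : j = i by apply: val_inj; rewrite /= E addn0.
  have Hk : (i + k < m)%N by have := ltn_ord j; lia.
  have := forallP H (Ordinal Hk) => /implyP /=.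
  have -> : inord (i + k).+1 = j by apply: val_inj; rewrite /= inordK //; lia.
  by apply; apply: IHk; rewrite inordK //; lia.
rewrite negb_forall => /existsP[[j jm]] /=; rewrite negb_imply => /andP[Q1 Q2].
apply: (PS u j jm Q1 Q2); apply: IH; apply: leq_trans leN.
rewrite /wt (reindex_inj (@swp_inj j)) /=.
rewrite (eq_bigl (fun i : 'I_m.+1 => Q (u i))); last by move=> i; rewrite swE swpK.
rewrite (bigD1 (inord j)) //= [X in (_ < X)%N](bigD1 (inord j)) //=.
rewrite swp_l !inordK; try lia.
rewrite -addSn leq_add //; first by have := jm; lia.
apply: leq_sum => i /andP[Qi Ni]; rewrite swpE //.
have N1 : (i != j :> nat).
  by apply: contraNneq Ni => <-; rewrite inord_val.
have N2 : (i != j.+1 :> nat).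
  by apply: contraTneq Qi => E; rewrite -(inord_val i) E.
by rewrite (negbTE N1) (negbTE N2).
Qed.

End Compositions.

(** * Polynomials: vanishing, degree bounds and divisibility *)

Section Polynomials.

Variables (K : fieldType) (n : nat).
Implicit Types (f g h : {mpoly K[n]}).

Lemma poly_eq0_inj (a : nat -> K) (P : {poly K}) :
  injective a -> (forall k, P.[a k] = 0) -> P = 0.
Proof.
move=> inj_a P0; apply/eqP/negPn/negP => nzP.
have := max_poly_roots nzP (rs := mkseq a (size P)).
rewrite (mkseq_uniq _ inj_a) size_mkseq ltnn => H; suff: false by [].
by apply: H => //; apply/allP=> x /mapP[k _ ->]; apply/rootP.
Qed.

Lemma digits_inj (B : nat) (e e' : 'I_n -> nat) :
  (forall i, e i < B)%N -> (forall i, e' i < B)%N ->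
  (\sum_(i < n) e i * B ^ i = \sum_(i < n) e' i * B ^ i)%N -> e =1 e'.
Proof.
elim: n e e' => [|k IH] e e' He He'; first by move=> _ [].
rewrite !big_ord_recl !expn0 !muln1.
have F (a : 'I_k.+1 -> nat) : (\sum_(i < k) a (lift ord0 i) * B ^ bump 0 i =
    (\sum_(i < k) a (lift ord0 i) * B ^ i) * B)%N.
  by rewrite big_distrl; apply: eq_bigr => i _; rewrite /bump leq0n add1n expnSr mulnA.
rewrite !F => E.
have E0 : e ord0 = e' ord0.
  have := congr1 (modn^~ B) E.
  by rewrite /= ![(_ ord0 + _)%N]addnC !modnMDl !modn_small.
move/eqP: E; rewrite E0 eqn_add2l eqn_pmul2r; last exact: leq_ltn_trans (He ord0).
move=> /eqP E i; case: (unliftP ord0 i) => [j ->|-> //].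
by apply: (IH (fun i => e (lift ord0 i)) (fun i => e' (lift ord0 i))).
Qed.

(** Kronecker substitution: x_i = (q^k)^(B^i), with B above every exponent, separates the monomials
    and leaves a univariate polynomial with infinitely many zeros. Points with a zero coordinate can
    thus be avoided, which matters where operators have denominators. *)
Lemma mpoly_eq0_eval (q : K) : q != 0 -> injective (fun k => q ^+ k) ->
  forall f, (forall x, (forall i, x i != 0) -> f.@[x] = 0) -> f = 0.
Proof.
move=> q0 q_inj f f0; apply/mpolyP=> e; rewrite mcoeff0.
have [/mpolyP -> |nzf] := eqVneq f 0; first by rewrite mcoeff0.
have [ef|] := boolP (e \in msupp f); last exact: memN_msupp_eq0.
pose B := msize f; pose code (e : 'X_{1..n}) := (\sum_(i < n) e i * B ^ i)%N.
have eB (e1 : 'X_{1..n}) i : e1 \in msupp f -> (e1 i < B)%N.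
  move/msize_mdeg_lt; apply: leq_ltn_trans.
  by rewrite mdegE (bigD1 i) //= leq_addr.
pose P : {poly K} := \sum_(e <- msupp f) f@_e *: 'X^(code e).
have P0 : P = 0.
  apply: (poly_eq0_inj q_inj) => k.
  rewrite -[RHS](f0 (fun i => (q ^+ k) ^+ (B ^ i))); last first.
    by move=> i; rewrite !expf_neq0.
  rewrite mevalE horner_sum; apply: eq_bigr => e1 _.
  rewrite hornerZ hornerXn; congr (_ * _).
  rewrite -prodrXr; apply: eq_bigr => i _.
  by rewrite -[RHS]exprM mulnC.
have := congr1 (fun p : {poly K} => p`_(code e)) P0.
rewrite coef0 coef_sum (bigD1_seq e) //= ?msupp_uniq //.
rewrite coefZ coefXn eqxx mulr1 big_seq_cond big1 ?addr0 //.
move=> e1 /andP[e1f ne]; rewrite coefZ coefXn.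
case: eqP => [/(digits_inj (fun i => eB e i ef) (fun i => eB e1 i e1f)) E|_].
  by case/negP: ne; apply/eqP/esym/mnmP.
by rewrite mulr0.
Qed.

Lemma msize_lin d (c : K) f g :
  (msize f <= d -> msize g <= d -> msize (c *: f + g) <= d)%N.
Proof.
move=> Hf Hg; apply: leq_trans (msizeD_le _ _) _; rewrite geq_max Hg andbT.
exact: leq_trans (msizeZ_le _ _) Hf.
Qed.

Lemma msize_sub d f g :
  (msize f <= d -> msize g <= d -> msize (f - g) <= d)%N.
Proof.
move=> Hf Hg; apply: leq_trans (msizeD_le _ _) _.
by rewrite geq_max Hf msizeN.
Qed.

Lemma leq_pred_add (a b x y : nat) :
  (a <= x.+1 -> b <= y.+1 -> (a + b).-1 <= (x + y).+1)%N.
Proof. lia. Qed.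

Lemma msize_mul d e f g :
  (msize f <= d.+1 -> msize g <= e.+1 -> msize (f * g) <= (d + e).+1)%N.
Proof.
have [->|f0] := eqVneq f 0; first by rewrite mul0r msize0.
have [->|g0] := eqVneq g 0; first by rewrite mulr0 msize0.
by rewrite msizeM // => Hf Hg; exact: leq_pred_add.
Qed.

Lemma msize_linform (i : 'I_n) (g : {mpoly K[n]}) :
  (msize g <= 2 -> msize ('X_i - g) <= 2)%N.
Proof. by move=> g2; rewrite msize_sub // msizeX mdeg1. Qed.

Lemma msize_comp (k : nat) (lq : n.-tuple {mpoly K[k]}) f :
  (forall i, msize (tnth lq i) <= 2)%N -> (msize (f \mPo lq) <= msize f)%N.
Proof.
move=> Hlq; rewrite comp_mpolyE; apply: leq_trans (msize_sum _ _ _) _.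
rewrite big_seq; apply/bigmax_leqP_seq => e _ ef.
apply: leq_trans (msizeZ_le _ _) _; apply: leq_trans (msize_mdeg_lt ef).
rewrite mdegE; elim/big_ind2: _ => [|a x b y|i _]; first by rewrite msize1.
  have [->|a0] := eqVneq a 0; first by rewrite mul0r msize0.
  have [->|b0] := eqVneq b 0; first by rewrite mulr0 msize0.
  by rewrite msizeM // => Ha Hb; exact: leq_pred_add.
elim: (e i) => [|l IH]; first by rewrite expr0 msize1.
rewrite exprS; have [->|a0] := eqVneq (tnth lq i) 0; first by rewrite mul0r msize0.
have [->|b0] := eqVneq (tnth lq i ^+ l) 0; first by rewrite mulr0 msize0.
by rewrite msizeM //; exact: (@leq_pred_add _ _ 1 l).
Qed.

Lemma comp_eval (k : nat) (g : 'I_n -> {mpoly K[k]}) f x :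
  (f \mPo [tuple g i | i < n]).@[x] = f.@[fun i => (g i).@[x]].
Proof.
by rewrite comp_mpoly_meval; apply: meval_eq => i; rewrite tnth_mktuple.
Qed.

Lemma comp_mktupleX (k : nat) (g : 'I_n -> {mpoly K[k]}) i :
  'X_i \mPo [tuple g i | i < n] = g i.
Proof. by rewrite /comp_mpoly mmapX mmap1U tnth_mktuple. Qed.

(** The property passes to products by f1 f2 - g1 g2 = (f1 - g1) f2 + g1 (f2 - g2). It yields
    division by a hyperplane equation, the divided differences, and the quotient defining [opZ0]. *)
Lemma dvd_sub_comp (G : {mpoly K[n]}) (g : 'I_n -> {mpoly K[n]}) :
  (forall i, exists h, 'X_i - g i = G * h) ->
  forall f, exists h, f - (f \mPo [tuple g i | i < n]) = G * h.
Proof.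
move=> HG; pose D f := exists h, f - (f \mPo [tuple g i | i < n]) = G * h.
have DM f1 f2 : D f1 -> D f2 -> D (f1 * f2).
  move=> [h1 E1] [h2 E2]; exists (h1 * f2 + (f1 \mPo [tuple g i | i < n]) * h2).
  rewrite mulrDr mulrA -E1 mulrCA -E2 rmorphM /=; ring.
have DX i : D 'X_i by have [h E] := HG i; exists h; rewrite comp_mktupleX.
have D1 : D 1 by exists 0; rewrite rmorph1 subrr mulr0.
elim/mpolyind => [|c e f _ _ [h E]]; first by exists 0; rewrite rmorph0 subrr mulr0.
have [h' E'] : D 'X_[e].
  rewrite mpolyXE_id; elim/big_ind: _ => [||i _] //.
  by elim: (e i) => [|l IH]; rewrite ?expr0 // exprS; apply: DM.
exists (c *: h' + h).
rewrite linearD linearZ /= mulrDr -scalerAr -E' -E scalerBr.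
by rewrite opprD addrACA.
Qed.

End Polynomials.

(** * Spectral vectors determine polynomials *)

Section Unisolvence.

Variables (K : fieldType) (m : nat) (q t : K).
Hypothesis gen : generic_qt q t.
Implicit Types (u v w : 'X_{1..m.+1}) (i : 'I_m.+1) (f : {mpoly K[m.+1]}).

Notation sp := (spectral q t).

Lemma gen_q0 : q != 0. Proof. by case: gen. Qed.
Lemma gen_t0 : t != 0. Proof. by case: gen. Qed.

Lemma gen_eq (a b c d : nat) :
  q ^+ a * t ^+ b = q ^+ c * t ^+ d -> a = c /\ b = d.
Proof.
have [q0 t0 H] := gen; move=> E.
have : q ^ (a%:Z - c%:Z) * t ^ (b%:Z - d%:Z) = 1.
  rewrite !expfzDr // -!exprnN -!exprnP mulrACA E -invfM.
  by rewrite divff // mulf_neq0 // expf_neq0.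
by move/H => []; lia.
Qed.

Lemma gen_q_inj : injective (fun k => q ^+ k).
Proof. by move=> k l E; have [] := @gen_eq k 0 l 0; rewrite /= ?E. Qed.

Lemma sp_neq0 u i : sp u i != 0.
Proof. by rewrite spectralE mulf_neq0 // expf_neq0 ?gen_q0 ?gen_t0. Qed.

Lemma sp_inj u : injective (sp u).
Proof. by move=> i i'; rewrite !spectralE => /gen_eq[_ /krank_inj]. Qed.

Lemma sp_eq_t u i i' :
  sp u i = t * sp u i' -> u i = u i' /\ krank u i = (krank u i').+1.
Proof. by rewrite !spectralE mulrCA -exprS => /gen_eq. Qed.

Lemma sp_tail (k : nat) u i :
  (forall i, (k <= i)%N -> u i = 0%N) -> (k <= i)%N -> sp u i = t ^+ (m - i).
Proof.
by move=> supp ki; rewrite spectralE (krank_tail supp ki) supp // mul1r.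
Qed.

Lemma sp_Phik (k : nat) u i : (0 < k <= m.+1)%N ->
  (forall i, (k <= i)%N -> u i = 0%N) ->
  sp (Phik k u) i = q ^+ (i.+1 == k :> nat) * sp u (crot k i).
Proof.
move=> km supp; rewrite !spectralE krank_Phik // PhikE addnC exprD.
by rewrite mulrA.
Qed.

(** Induction on the number of free coordinates, then on the degree. On the hyperplane where the
    last free coordinate takes the value of a zero part, f vanishes by the case of fewer
    coordinates. Dividing by its equation leaves h of smaller degree, which vanishes at the points
    of [Phik k v]; a rotation with a q-shift carries these back to the points of v. *)
Lemma unisolvent_tail (k d : nat) f : (k <= m.+1)%N -> (msize f <= d)%N ->
  (forall v, (mdeg v < d)%N -> (forall i, (k <= i)%N -> v i = 0%N) ->
     f.@[sp v] = 0) ->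
  forall x, (forall i, (k <= i)%N -> x i = t ^+ (m - i)) -> f.@[x] = 0.
Proof.
elim: k d f => [|k IHk] d f km.
  case: d => [|d] fd f0 x xE.
    by move: fd; rewrite leqn0 msize_poly_eq0 => /eqP ->; rewrite meval0.
  rewrite -(f0 0%MM) ?mdeg0 //; last by move=> i _; rewrite mnm0E.
  apply: meval_eq => i; rewrite xE // (@sp_tail 0) // => j _; exact: mnm0E.
elim: d f => [|d IHd] f fd f0 x xE.
  by move: fd; rewrite leqn0 msize_poly_eq0 => /eqP ->; rewrite meval0.
pose i0 : 'I_m.+1 := inord k; pose c := t ^+ (m - k).
have i0E : i0 = k :> nat by rewrite inordK.
pose s i : {mpoly K[m.+1]} := if i == i0 then c%:MP else 'X_i.
have [h Eh] : exists h, f - (f \mPo [tuple s i | i < m.+1]) = ('X_i0 - c%:MP) * h.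
  apply: dvd_sub_comp => i; rewrite /s; case: eqP => [->|_].
    by exists 1; rewrite mulr1.
  by exists 0; rewrite subrr mulr0.
have fE y : (forall i, (k.+1 <= i)%N -> y i = t ^+ (m - i)) ->
    f.@[y] = (y i0 - c) * h.@[y].
  move=> yE; have := congr1 (meval y) Eh.
  rewrite mevalB mevalM mevalB mevalXU mevalC => <-.
  rewrite comp_eval.
  rewrite (_ : f.@[fun i => (s i).@[y]] = 0) ?subr0 //.
  apply: (IHk d.+1) => //; first exact: ltnW.
    move=> v vd supp; apply: f0 => // i ki; apply: supp; lia.
  move=> i ki; rewrite /s; case: eqP => [->|/eqP ne]; first by rewrite mevalC i0E.
  rewrite mevalXU yE // ltn_neqAle ki andbT -i0E eq_sym; exact: ne.
have hd : (msize h <= d)%N.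
  have [->|h0] := eqVneq h 0; first by rewrite msize0.
  have nzX : 'X_i0 - c%:MP != 0 :> {mpoly K[m.+1]}.
    apply/eqP => /(congr1 (mcoeff U_(i0)%MM)).
    rewrite mcoeffB mcoeffX eqxx mcoeffC mnm1_eq0 mulr0 subr0 mcoeff0.
    by apply/eqP; exact: oner_neq0.
  have szX : msize ('X_i0 - c%:MP : {mpoly K[m.+1]}) = 2.
    apply/eqP; rewrite eqn_leq msize_linform ?msizeC; last by case: (c != 0).
    rewrite ltnNge; apply/negP=> /msize1_polyC E.
    have := congr1 (mcoeff U_(i0)%MM) E.
    rewrite mcoeffB mcoeffX eqxx !mcoeffC mnm1_eq0 !mulr0 subr0.
    by apply/eqP; exact: oner_neq0.
  have : (msize (('X_i0 - c%:MP) * h) <= d.+1)%N.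
    rewrite -Eh msize_sub //; apply: leq_trans (msize_comp _ _) fd => i.
    rewrite tnth_mktuple /s; case: eqP => _; last by rewrite msizeX mdeg1.
    by rewrite msizeC; case: (c != 0).
  by rewrite msizeM // szX.
pose g i : {mpoly K[m.+1]} := q ^+ (i.+1 == k.+1 :> nat) *: 'X_(crot k.+1 i).
have gE y : (h \mPo [tuple g i | i < m.+1]).@[y] =
    h.@[fun i => q ^+ (i.+1 == k.+1 :> nat) * y (crot k.+1 i)].
  by rewrite comp_eval; apply: meval_eq => i; rewrite mevalZ mevalXU.
have crot_id i : (k.+1 <= i)%N -> crot k.+1 i = i.
  by move=> ki; apply: val_inj; rewrite /= crotE // ltnNge ki.
have h0 y : (forall i, (k.+1 <= i)%N -> y i = t ^+ (m - i)) ->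
    (h \mPo [tuple g i | i < m.+1]).@[y] = 0.
  apply: IHd.
    apply: leq_trans (msize_comp _ _) hd => i.
    by rewrite tnth_mktuple; apply: leq_trans (msizeZ_le _ _) _; rewrite msizeX mdeg1.
  move=> v vd supp; rewrite gE.
  have supp' i : (k.+1 <= i)%N -> Phik k.+1 v i = 0%N.
    move=> ki; rewrite PhikE crot_id // supp // add0n eqSS.
    by case: eqP => // E; move: ki; rewrite E ltnn.
  have E : f.@[sp (Phik k.+1 v)] = 0 by rewrite f0 // mdeg_Phik.
  rewrite fE in E; last by move=> i; exact: sp_tail.
  (* The linear factor cannot vanish: place k of [Phik k.+1 v] is positive, so its spectral value
     carries a positive power of [q], and the constant carries none. *)
  move/eqP: E; rewrite mulf_eq0 subr_eq0 => /orP[/eqP E|/eqP <-].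
    have : q ^+ Phik k.+1 v i0 * t ^+ krank (Phik k.+1 v) i0 = q ^+ 0 * t ^+ (m - k).
      by rewrite -spectralE E mul1r.
    by move/gen_eq => []; rewrite PhikE i0E eqxx addn1.
  by apply: meval_eq => i; rewrite sp_Phik.
rewrite fE // (_ : h.@[x] = 0) ?mulr0 //.
(* The substitution [g] is invertible, so the vanishing of its pullback gives that of [h] at every
   admissible point. *)
have ri := @crot_inj m k.+1 km.
rewrite -[RHS](h0 (fun i => (q ^+ ((invF ri i).+1 == k.+1 :> nat))^-1 * x (invF ri i))).
  rewrite gE; apply: meval_eq => i; rewrite invF_f mulrA divff ?mul1r //.
  by rewrite expf_neq0 // gen_q0.
move=> i ki; have E : invF ri i = i by apply: (@crot_inj m k.+1 km); rewrite f_invF crot_id.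
rewrite E xE // eqSS; case: eqP => [Ei|_]; last by rewrite invr1 mul1r.
by move: ki; rewrite Ei ltnn.
Qed.

Lemma unisolvent (d : nat) f : (msize f <= d)%N ->
  (forall v, (mdeg v < d)%N -> f.@[sp v] = 0) -> f = 0.
Proof.
move=> fd f0; apply: (mpoly_eq0_eval gen_q0 gen_q_inj) => x _.
apply: (@unisolvent_tail m.+1 d) => // [v vd _|i]; first exact: f0.
by rewrite leqNgt ltn_ord.
Qed.

Lemma spectral_ext f g : (forall v, f.@[sp v] = g.@[sp v]) -> f = g.
Proof.
move=> E; apply/eqP; rewrite -subr_eq0; apply/eqP.
apply: (unisolvent (leqnn _)) => v _; rewrite mevalB E subrr; reflexivity.
Qed.

End Unisolvence.

(** * Linearity of operators on polynomials *)

Section Linear.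

Variables (K : fieldType) (n : nat).
Implicit Types (A B : {mpoly K[n]} -> {mpoly K[n]}) (f g : {mpoly K[n]}).

Definition lin A := forall c f g, A (c *: f + g) = c *: A f + A g.

Lemma lin0 A : lin A -> A 0 = 0.
Proof.
move=> lA; have := lA 1 0 0; rewrite !scale1r addr0 => E.
by apply: (addIr (A 0)); rewrite add0r -E.
Qed.

Lemma linZ A c f : lin A -> A (c *: f) = c *: A f.
Proof. by move=> lA; rewrite -[c *: f]addr0 lA lin0 // addr0. Qed.

Lemma linD A f g : lin A -> A (f + g) = A f + A g.
Proof. by move=> lA; have := lA 1 f g; rewrite !scale1r. Qed.

Lemma linB A f g : lin A -> A (f - g) = A f - A g.
Proof. by move=> lA; rewrite -scaleN1r linD // linZ // scaleN1r. Qed.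

Lemma lin_sum A (I : Type) (r : seq I) (P : pred I) (F : I -> {mpoly K[n]}) :
  lin A -> A (\sum_(i <- r | P i) F i) = \sum_(i <- r | P i) A (F i).
Proof.
move=> lA; elim/big_rec2: _ => [|i f g _ <-]; first exact: lin0.
exact: linD.
Qed.

Lemma lin_id : lin id. Proof. by []. Qed.

Lemma lin_comp A B : lin A -> lin B -> lin (A \o B).
Proof. by move=> lA lB c f g /=; rewrite lB lA. Qed.

Lemma lin_scale A c : lin A -> lin (fun f => c *: A f).
Proof.
by move=> lA a f g; rewrite lA scalerDr !scalerA mulrC.
Qed.

Lemma lin_add A B : lin A -> lin B -> lin (fun f => A f + B f).
Proof. by move=> lA lB c f g; rewrite lA lB scalerDr addrACA. Qed.

Lemma lin_comp_mpoly (lq : n.-tuple {mpoly K[n]}) :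
  lin (fun f => f \mPo lq).
Proof. by move=> c f g; rewrite linearP. Qed.

End Linear.

(** * Hecke operators, Cherednik operators and degree-lowering operators *)

Section Operators.

Variables (K : fieldType) (m : nat) (q t : K).
Implicit Types (u v w : 'X_{1..m.+1}) (i : 'I_m.+1) (j k : nat).
Implicit Types (f g h : {mpoly K[m.+1]}) (x : 'I_m.+1 -> K).

Notation sp := (spectral q t).
Notation P := {mpoly K[m.+1]}.

Definition opS j f : P := f \mPo [tuple 'X_(swp j i) | i < m.+1].

Lemma opS_eval j f x : (opS j f).@[x] = f.@[fun i => x (swp j i)].
Proof. by rewrite comp_eval; apply: meval_eq => i; rewrite mevalXU. Qed.

Lemma divdiff_ex j f :
  exists h, ('X_(inord j) - 'X_(inord j.+1)) * h = f - opS j f.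
Proof.
have [|h E] := @dvd_sub_comp _ _ ('X_(inord j) - 'X_(inord j.+1))
    (fun i => 'X_(swp j i)) _ f; last by exists h.
move=> i; rewrite /swp; case: tpermP => [->|->|_ _].
- by exists 1; rewrite mulr1.
- by exists (-1); rewrite mulrN1 opprB.
- by exists 0; rewrite mulr0 subrr.
Qed.

(* The operators are projections of opaque witnesses: unfolding them during
   unification would be prohibitively expensive. *)
Fact divdiff_sig j f :
  {h : P | ('X_(inord j) - 'X_(inord j.+1)) * h = f - opS j f}.
Proof.
have /sigW[h /eqP E] : exists h : P,
    ('X_(inord j) - 'X_(inord j.+1)) * h == f - opS j f.
  by have [h E] := divdiff_ex j f; exists h; apply/eqP.
by exists h.
Qed.

Definition divdiff j f := sval (divdiff_sig j f).

Lemma divdiffE j f :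
  ('X_(inord j) - 'X_(inord j.+1)) * divdiff j f = f - opS j f.
Proof. exact: svalP (divdiff_sig j f). Qed.

Fact opN_sig j f :
  {g : P | g = - (('X_(inord j) - t *: 'X_(inord j.+1)) * divdiff j f)}.
Proof. by eexists. Qed.

(** This is T_j - t for the Demazure-Lusztig operator T_j. In this form its value at a spectral
    point is [kap] times a difference, and [kap] vanishes when the two parts agree, that is, when
    the exchanged vector is not spectral. *)
Definition opN j f := sval (opN_sig j f).

Lemma opNE j f :
  opN j f = - (('X_(inord j) - t *: 'X_(inord j.+1)) * divdiff j f).
Proof. exact: svalP (opN_sig j f). Qed.

Definition kapx (a b : K) : K := (a - t * b) / (a - b).

Lemma opN_eval j f x : x (inord j) != x (inord j.+1) ->
  (opN j f).@[x] = kapx (x (inord j)) (x (inord j.+1))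
                   * (f.@[fun i => x (swp j i)] - f.@[x]).
Proof.
move=> ne; have := congr1 (meval x) (divdiffE j f).
rewrite opNE mevalN !mevalM !mevalB mevalZ !mevalXU opS_eval => E.
rewrite -[in RHS]opprB -E /kapx mulrN -mulrA mulKf //.
by rewrite subr_eq0.
Qed.

Lemma mpolyXB_neq0 j : (j < m)%N ->
  'X_(inord j) - 'X_(inord j.+1) != 0 :> P.
Proof.
move=> jm; apply/eqP => /(congr1 (mcoeff U_(inord j)%MM)).
rewrite mcoeffB !mcoeffX eqxx mcoeff0 eq_mnm1 -val_eqE /= !inordK; try lia.
by rewrite (_ : j.+1 == j = false) ?subr0; [apply/eqP; exact: oner_neq0 | lia].
Qed.

Lemma msize_opN j f : (j < m)%N -> (msize (opN j f) <= msize f)%N.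
Proof.
move=> jm; rewrite opNE msizeN; have [->|d0] := eqVneq (divdiff j f) 0.
  by rewrite mulr0 msize0.
have nz := mpolyXB_neq0 jm.
have le : (msize (('X_(inord j) - 'X_(inord j.+1)) * divdiff j f) <= msize f)%N.
  rewrite divdiffE msize_sub // msize_comp // => i.
  by rewrite tnth_mktuple msizeX mdeg1.
apply: leq_trans le.
have -> : msize (('X_(inord j) - 'X_(inord j.+1)) * divdiff j f)
    = (1 + (msize (divdiff j f)).-1).+1.
  rewrite msizeM // -[X in (_ + X).-1](prednK (_ : 0 < _)%N); last first.
    by rewrite lt0n msize_poly_eq0.
  rewrite (_ : msize ('X_(inord j) - 'X_(inord j.+1) : P) = 2) //.
  apply/eqP; rewrite eqn_leq msize_linform ?msizeX ?mdeg1 //.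
  rewrite ltnNge; apply/negP => /msize1_polyC E; move/eqP: nz; apply.
  by rewrite E mcoeffB !mcoeffX !mnm1_eq0 subrr mpolyC0.
apply: msize_mul.
  apply: msize_linform; apply: leq_trans (msizeZ_le _ _) _.
  by rewrite msizeX mdeg1.
exact: leqSpred.
Qed.

Fact opH_sig j f : {g : P | g = t *: f + opN j f}. Proof. by eexists. Qed.
Definition opH j f := sval (opH_sig j f).
Lemma opHE j f : opH j f = t *: f + opN j f.
Proof. exact: svalP (opH_sig j f). Qed.

Fact opJ_sig j f : {g : P | g = f + opN j f}. Proof. by eexists. Qed.
(** Equals t times the inverse of [opH]: where [opN] is 0 or -(1 + t), [opH] is t or -1 and [opJ] is
    1 or -t. *)
Definition opJ j f := sval (opJ_sig j f).
Lemma opJE j f : opJ j f = f + opN j f.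
Proof. exact: svalP (opJ_sig j f). Qed.

(** The resulting substitution undoes on spectral vectors what [Phi] does on compositions, whence
    the factor [q^-1]. *)
Definition pi_sub i : P :=
  if i == ord0 then q^-1 *: 'X_ord_max else 'X_(inord i.-1).

Fact opPi_sig f : {g : P | g = f \mPo [tuple pi_sub i | i < m.+1]}.
Proof. by eexists. Qed.
Definition opPi f := sval (opPi_sig f).
Lemma opPiE f : opPi f = f \mPo [tuple pi_sub i | i < m.+1].
Proof. exact: svalP (opPi_sig f). Qed.

Lemma opPi_eval f x : (opPi f).@[x] =
  f.@[fun i => if i == ord0 then q^-1 * x ord_max else x (inord i.-1)].
Proof.
rewrite opPiE comp_eval; apply: meval_eq => i; rewrite /pi_sub.
by case: eqP => _; rewrite ?mevalZ mevalXU.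
Qed.

Lemma lin_opPi : lin opPi.
Proof. by move=> c f g; rewrite !opPiE linearP. Qed.

Lemma msize_opPi f : (msize (opPi f) <= msize f)%N.
Proof.
rewrite opPiE; apply: msize_comp => i; rewrite tnth_mktuple /pi_sub; case: eqP => _.
  by apply: leq_trans (msizeZ_le _ _) _; rewrite msizeX mdeg1.
by rewrite msizeX mdeg1.
Qed.

Fixpoint opC k f : P := if k is k'.+1 then opC k' (opH k' f) else f.

Fact opY0_sig f : {g : P | g = t ^- m *: opPi (opC m f)}.
Proof. by eexists. Qed.
(** The Cherednik operator of the last variable. The power of [t] makes it fix values on the
    hyperplane where that variable is 0, so that [opZ0] stays polynomial. *)
Definition opY0 f := sval (opY0_sig f).
Lemma opY0E f : opY0 f = t ^- m *: opPi (opC m f).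
Proof. exact: svalP (opY0_sig f). Qed.

(** The recursion A_j = t^-1 J_j A_{j+1} J_j, running down from the last index over [d] steps; one
    recursion serves both Y and Z. *)
Fixpoint opK (A : P -> P) d f : P :=
  if d is d'.+1 then t^-1 *: opJ (m - d'.+1) (opK A d' (opJ (m - d'.+1) f))
  else A f.

Lemma opK_step A j f : (j < m)%N ->
  opK A (m - j) f = t^-1 *: opJ j (opK A (m - j.+1) (opJ j f)).
Proof.
move=> jm; have -> : (m - j = (m - j.+1).+1)%N by lia.
by rewrite /= (_ : (m - (m - j.+1).+1 = j)%N) //; lia.
Qed.

Lemma dil_eval (c : K) f x : (dilate c f).@[x] = f.@[fun i => c * x i].
Proof. by rewrite comp_eval; apply: meval_eq => i; rewrite mevalZ mevalXU. Qed.

Lemma lin_dil (c : K) : lin (@dilate K m.+1 c).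
Proof. exact: lin_comp_mpoly. Qed.

Lemma msize_dil (c : K) f : (msize (dilate c f) <= msize f)%N.
Proof.
apply: msize_comp => i; rewrite tnth_mktuple.
by apply: leq_trans (msizeZ_le _ _) _; rewrite msizeX mdeg1.
Qed.

Hypothesis gen : generic_qt q t.

Let t0 : t != 0 := gen_t0 gen.

Let q0 : q != 0 := gen_q0 gen.

Definition kap j v : K := kapx (sp v (inord j)) (sp v (inord j.+1)).

Lemma sp_sw j v i : (j < m)%N -> v (inord j) != v (inord j.+1) ->
  sp (sw j v) i = sp v (swp j i).
Proof. by move=> jm ne; rewrite !spectralE swE krank_sw. Qed.

Lemma sp_step j v : (j < m)%N -> v (inord j) = v (inord j.+1) ->
  sp v (inord j) = t * sp v (inord j.+1).
Proof. by move=> jm E; rewrite !spectralE E krank_eq_next // exprS mulrCA. Qed.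

Lemma sp_adj_neq j v : (j < m)%N -> sp v (inord j) != sp v (inord j.+1).
Proof.
move=> jm; rewrite (inj_eq (@sp_inj _ _ _ _ gen v)) -val_eqE /= !inordK; lia.
Qed.

Lemma kap_eq0 j v : (j < m)%N -> v (inord j) = v (inord j.+1) -> kap j v = 0.
Proof. by move=> jm E; rewrite /kap /kapx (sp_step jm E) subrr mul0r. Qed.

Lemma kap_neq0 j v : (j < m)%N -> v (inord j) != v (inord j.+1) -> kap j v != 0.
Proof.
move=> jm ne; rewrite /kap /kapx mulf_neq0 ?invr_eq0 ?subr_eq0 ?sp_adj_neq //.
by apply: contraNneq ne => /(sp_eq_t gen)[->].
Qed.

Lemma kap_sw j v : (j < m)%N -> v (inord j) != v (inord j.+1) ->
  kap j (sw j v) = kapx (sp v (inord j.+1)) (sp v (inord j)).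
Proof. by move=> jm ne; rewrite /kap !sp_sw // swp_l swp_r. Qed.

Lemma kap_sw_sum j v : (j < m)%N -> v (inord j) != v (inord j.+1) ->
  kap j (sw j v) + kap j v = 1 + t.
Proof.
move=> jm ne; rewrite kap_sw // /kap /kapx; have := sp_adj_neq v jm.
set a := sp v _; set b := sp v _; move=> ab.
by field; rewrite !subr_eq0 ab eq_sym ab.
Qed.

Lemma opN_sp j f v : (j < m)%N ->
  (opN j f).@[sp v] = kap j v * (f.@[sp (sw j v)] - f.@[sp v]).
Proof.
move=> jm; rewrite opN_eval ?sp_adj_neq //.
have [E|ne] := eqVneq (v (inord j)) (v (inord j.+1)).
  by rewrite -/(kap j v) kap_eq0 // !mul0r.
congr (_ * (_ - _)); apply: meval_eq => i; exact/esym/sp_sw.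
Qed.

Lemma lin_opN j : (j < m)%N -> lin (opN j).
Proof.
move=> jm c f g; apply: (spectral_ext gen) => v.
rewrite [RHS]mevalD [X in _ = X + _]mevalZ.
rewrite [X in _ = _ * X + _](opN_sp _ _ jm) [X in _ = _ + X](opN_sp _ _ jm).
rewrite [LHS](opN_sp _ _ jm).
rewrite [X in _ * (X - _) = _]mevalD [X in _ * (_ - X) = _]mevalD !mevalZ.
by ring.
Qed.

Lemma opNN j f : (j < m)%N -> opN j (opN j f) = - (1 + t) *: opN j f.
Proof.
move=> jm; apply: (spectral_ext gen) => v; rewrite [RHS]mevalZ.
rewrite [LHS](opN_sp (opN j f) v jm) 2!(opN_sp f _ jm) swK.
have [E|ne] := eqVneq (v (inord j)) (v (inord j.+1)).
  by rewrite kap_eq0 // !mul0r mulr0.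
rewrite -(kap_sw_sum jm ne); ring.
Qed.

Lemma lin_opH j : (j < m)%N -> lin (opH j).
Proof. by move=> jm c f g; rewrite !opHE (lin_add (lin_scale t (@lin_id _ _)) (lin_opN jm)). Qed.

Lemma lin_opJ j : (j < m)%N -> lin (opJ j).
Proof. by move=> jm c f g; rewrite !opJE (lin_add (@lin_id _ _) (lin_opN jm)). Qed.

Lemma opHJ j f : (j < m)%N -> opH j (opJ j f) = t *: f.
Proof.
move=> jm; rewrite opHE opJE (linD _ _ (lin_opN jm)) opNN //.
rewrite scalerDr -addrA -[RHS]addr0; congr (_ + _).
rewrite -[X in _ + (X + _)]scale1r -!scalerDl addrA [t + 1]addrC subrr.
by rewrite scale0r.
Qed.

Lemma opJH j f : (j < m)%N -> opJ j (opH j f) = t *: f.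
Proof.
move=> jm; rewrite -(opHJ f jm) !opHE !opJE !(linD _ _ (lin_opN jm)).
by rewrite (linZ _ _ (lin_opN jm)) scalerDr !addrA (addrAC (t *: f)).
Qed.

Lemma lin_opC k : (k <= m)%N -> lin (opC k).
Proof.
elim: k => [|k IH] km; first exact: lin_id.
exact: (lin_comp (IH (ltnW km)) (lin_opH km)).
Qed.

Lemma lin_opY0 : lin opY0.
Proof.
move=> c f g; rewrite !opY0E.
exact: (lin_scale _ (lin_comp lin_opPi (lin_opC (leqnn m)))).
Qed.

Lemma lin_opK A d : lin A -> (d <= m)%N -> lin (opK A d).
Proof.
move=> lA; elim: d => [|d IH] dm //=.
have jm : (m - d.+1 < m)%N by lia.
apply: lin_scale; apply: (lin_comp (lin_opJ jm)).
exact: (lin_comp (IH (ltnW dm)) (lin_opJ jm)).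
Qed.

Lemma msize_opH j f : (j < m)%N -> (msize (opH j f) <= msize f)%N.
Proof.
by move=> jm; rewrite opHE; exact: (msize_lin t (leqnn _) (msize_opN f jm)).
Qed.

Lemma msize_opJ j f : (j < m)%N -> (msize (opJ j f) <= msize f)%N.
Proof.
by move=> jm; rewrite opJE -[f in f + _]scale1r msize_lin // msize_opN.
Qed.

Lemma msize_opC k f : (k <= m)%N -> (msize (opC k f) <= msize f)%N.
Proof.
elim: k f => [|k IH] f km //=.
exact: leq_trans (IH _ (ltnW km)) (msize_opH f km).
Qed.

Lemma msize_opY0 f : (msize (opY0 f) <= msize f)%N.
Proof.
rewrite opY0E; apply: leq_trans (msizeZ_le _ _) _.
apply: leq_trans (msize_opPi _) _; exact: msize_opC.
Qed.

(** Since [kapx 0 b = t] for b nonzero, each [opH] met here is t times an exchange, and the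
    exchanges carry the zero from the first place to place [k]. *)
Lemma opC_eval0 k f x : (k <= m)%N -> x ord0 = 0 ->
  (forall i, (0 < i <= k)%N -> x i != 0) ->
  (opC k f).@[x] = t ^+ k *
    f.@[fun i => if (i < k)%N then x (inord i.+1) else
                 if i == k :> nat then 0 else x i].
Proof.
elim: k f => [|k IH] f km x0 xn0.
  rewrite mul1r; apply: meval_eq => i /=; case: eqP => // E.
  by rewrite -x0; congr x; apply: val_inj.
rewrite /= IH ?(ltnW km) //; last by move=> i ik; apply: xn0; lia.
set y := fun i => _; rewrite exprSr -mulrA; congr (_ * _).
have ya : y (inord k) = 0 by rewrite /y inordK ?ltnn ?eqxx //; lia.
have yb : y (inord k.+1) = x (inord k.+1).
  by rewrite /y inordK // !ifN //; lia.
have nz : x (inord k.+1) != 0 by apply: xn0; rewrite inordK //; lia.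
rewrite opHE mevalD mevalZ opN_eval ya yb; last by rewrite eq_sym.
rewrite /kapx !sub0r invrN mulrNN mulfK // -mulrDr addrC subrK.
congr (_ * _); apply: meval_eq => i; rewrite /y swpE //.
have [E|N1] := eqVneq (i : nat) k.
  rewrite E ltnSn ltnNge leqnSn gtn_eqF //=.
  by congr x; apply: val_inj; rewrite /= swpE // E eqxx inordK.
have [E|N2] := eqVneq (i : nat) k.+1.
  by rewrite ltnn eqxx ifN //; lia.
have -> : swp k i = i by rewrite swp_o.
by rewrite ltnS [(i <= k)%N]leq_eqVlt !(negbTE N1).
Qed.

(** Where the last variable is 0, the m exchanges in [opC] undo the rotation of [opPi] and their
    factor t^m cancels [t ^- m]; so f and [opY0 f] agree there. *)
Lemma opZ0_ex f : exists h, 'X_ord_max * h == f - opY0 f.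
Proof.
pose s i : P := if i == ord_max then 0 else 'X_i.
have [h E] : exists h, (f - opY0 f) - ((f - opY0 f) \mPo [tuple s i | i < m.+1])
    = 'X_ord_max * h.
  apply: dvd_sub_comp => i; rewrite /s; case: eqP => [->|_].
    by exists 1; rewrite subr0 mulr1.
  by exists 0; rewrite subrr mulr0.
exists h; rewrite -E (_ : (_ \mPo _) = 0) ?subr0 //.
apply: (mpoly_eq0_eval q0 (gen_q_inj gen)) => x x0.
rewrite comp_eval; set y := fun i => _.
have yE i : y i = if i == ord_max then 0 else x i.
  by rewrite /y /s; case: eqP => _; rewrite ?meval0 ?mevalXU.
rewrite mevalB opY0E mevalZ opPi_eval opC_eval0 //; first last.
- move=> i /andP[i0 _]; rewrite ifN; last by rewrite -val_eqE /= -lt0n.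
  rewrite yE -val_eqE /= inordK; last by have := ltn_ord i; lia.
  by rewrite ifN ?x0 //; have := ltn_ord i; lia.
- by rewrite eqxx yE eqxx mulr0.
rewrite mulKf ?expf_neq0 //; apply/eqP; rewrite subr_eq0; apply/eqP.
apply: meval_eq => i; have im := ltn_ord i.
have [Em|Nm] := eqVneq (i : nat) m.
  by rewrite Em ltnn yE -val_eqE /= Em eqxx.
rewrite ifT; last lia.
have E1 : (inord i.+1 : 'I_m.+1) = i.+1 :> nat by rewrite inordK //; lia.
by rewrite -val_eqE /= E1 /= inord_val.
Qed.

Fact opZ0_sig f : {h : P | 'X_ord_max * h = f - opY0 f}.
Proof. by have /sigW[h /eqP E] := opZ0_ex f; exists h. Qed.

Definition opZ0 f := sval (opZ0_sig f).

Lemma opZ0E f : 'X_ord_max * opZ0 f = f - opY0 f.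
Proof. exact: svalP (opZ0_sig f). Qed.

Lemma mpolyX_neq0 i : 'X_i != 0 :> P.
Proof. by rewrite -msize_poly_eq0 msizeX. Qed.

Lemma lin_opZ0 : lin opZ0.
Proof.
move=> c f g; apply: (mulfI (mpolyX_neq0 ord_max)).
by rewrite mulrDr -scalerAr !opZ0E lin_opY0 scalerBr opprD addrACA.
Qed.

Lemma msize_opZ0 f : (msize (opZ0 f) <= msize f)%N.
Proof.
have [->|nz] := eqVneq (opZ0 f) 0; first by rewrite msize0.
have : (msize ('X_ord_max * opZ0 f) <= msize f)%N.
  by rewrite opZ0E msize_sub // msize_opY0.
rewrite msizeM ?mpolyX_neq0 // msizeX mdeg1; exact: ltnW.
Qed.

Definition opY j := opK opY0 (m - j).
Definition opZ j := opK opZ0 (m - j).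

Lemma lin_opY j : lin (opY j).
Proof. by apply: lin_opK (leq_subr _ _); exact: lin_opY0. Qed.

Lemma lin_opZ j : lin (opZ j).
Proof. by apply: lin_opK (leq_subr _ _); exact: lin_opZ0. Qed.

Fact opX_sig (s : K) j f : {g : P | g = opY j f + s *: opZ j f}.
Proof. by eexists. Qed.
(** Inhomogeneous Cherednik operators. Dilation by c turns [s] into [s / c], so [s = c^-1] belongs
    to the basis M_u(cx). *)
Definition opX (s : K) j f := sval (opX_sig s j f).
Lemma opXE s j f : opX s j f = opY j f + s *: opZ j f.
Proof. exact: svalP (opX_sig s j f). Qed.

Lemma lin_opX s j : lin (opX s j).
Proof.
by move=> c f g; rewrite !opXE (lin_add (lin_opY j) (lin_scale s (lin_opZ j))).
Qed.

Lemma opX_step s j f : (j < m)%N ->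
  opX s j f = t^-1 *: opJ j (opX s j.+1 (opJ j f)).
Proof.
move=> jm; rewrite !opXE /opY /opZ 2!(opK_step _ _ jm) (linD _ _ (lin_opJ jm)).
by rewrite (linZ _ _ (lin_opJ jm)) scalerDr !scalerA mulrC.
Qed.

Lemma msize_opX s j f : (msize (opX s j f) <= msize f)%N.
Proof.
rewrite opXE addrC; apply: msize_lin.
  rewrite /opZ; have := leq_subr j m; elim: (m - j)%N f => [|d IH] f dm /=.
    exact: msize_opZ0.
  have jm : (m - d.+1 < m)%N by lia.
  apply: leq_trans (msizeZ_le _ _) _; apply: leq_trans (msize_opJ _ jm) _.
  exact: leq_trans (IH _ (ltnW dm)) (msize_opJ _ jm).
rewrite /opY; have := leq_subr j m; elim: (m - j)%N f => [|d IH] f dm /=.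
  exact: msize_opY0.
have jm : (m - d.+1 < m)%N by lia.
apply: leq_trans (msizeZ_le _ _) _; apply: leq_trans (msize_opJ _ jm) _.
exact: leq_trans (IH _ (ltnW dm)) (msize_opJ _ jm).
Qed.

Lemma dil_opN c j f : (j < m)%N -> c != 0 ->
  dilate c (opN j f) = opN j (dilate c f).
Proof.
move=> jm c0; apply: (spectral_ext gen) => v; rewrite dil_eval.
have ne := sp_adj_neq v jm.
rewrite !opN_eval //; last by rewrite (inj_eq (mulfI c0)).
rewrite !dil_eval; congr (_ * _); rewrite /kapx.
by rewrite [t * _]mulrCA -!mulrBr -mulf_div divff // mul1r.
Qed.

Lemma dil_opJ c j f : (j < m)%N -> c != 0 ->
  dilate c (opJ j f) = opJ j (dilate c f).
Proof. by move=> jm c0; rewrite !opJE (linD _ _ (lin_dil c)) dil_opN. Qed.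

Lemma dil_opH c j f : (j < m)%N -> c != 0 ->
  dilate c (opH j f) = opH j (dilate c f).
Proof. by move=> jm c0; rewrite !opHE lin_dil dil_opN. Qed.

Lemma dil_opPi c f : dilate c (opPi f) = opPi (dilate c f).
Proof.
apply: (spectral_ext gen) => v; rewrite dil_eval !opPi_eval dil_eval.
by apply: meval_eq => i; case: eqP => _ //; rewrite mulrCA.
Qed.

Lemma dil_opC c k f : (k <= m)%N -> c != 0 ->
  dilate c (opC k f) = opC k (dilate c f).
Proof.
move=> km c0; elim: k f km => [|k IH] f km //=.
by rewrite IH ?(ltnW km) // dil_opH.
Qed.

Lemma dil_opY0 c f : c != 0 -> dilate c (opY0 f) = opY0 (dilate c f).
Proof.
by move=> c0; rewrite !opY0E (linZ _ _ (lin_dil c)) dil_opPi dil_opC.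
Qed.

Lemma dil_opZ0 c f : c != 0 -> dilate c (opZ0 f) = c^-1 *: opZ0 (dilate c f).
Proof.
move=> c0; apply: (mulfI (mpolyX_neq0 ord_max)).
rewrite -scalerAr opZ0E -dil_opY0 // -(linB _ _ (lin_dil c)).
rewrite -opZ0E /dilate rmorphM /= comp_mktupleX -scalerAl scalerA.
by rewrite mulVf // scale1r.
Qed.

Lemma dil_opK A a c d f : lin A ->
  (forall f, dilate c (A f) = a *: A (dilate c f)) -> (d <= m)%N -> c != 0 ->
  dilate c (opK A d f) = a *: opK A d (dilate c f).
Proof.
move=> lA HA dm c0; elim: d f dm => [|d IH] f dm /=; first exact: HA.
have jm : (m - d.+1 < m)%N by lia.
rewrite (linZ _ _ (lin_dil c)) dil_opJ // IH ?(ltnW dm) // dil_opJ //.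
by rewrite (linZ _ _ (lin_opJ jm)) !scalerA mulrC.
Qed.

Lemma dil_opY c j f : c != 0 -> dilate c (opY j f) = opY j (dilate c f).
Proof.
move=> c0; rewrite /opY (@dil_opK _ 1) ?scale1r ?leq_subr //.
  exact: lin_opY0.
by move=> g; rewrite scale1r dil_opY0.
Qed.

Lemma dil_opZ c j f : c != 0 -> dilate c (opZ j f) = c^-1 *: opZ j (dilate c f).
Proof.
move=> c0; apply: dil_opK; rewrite ?leq_subr //; first exact: lin_opZ0.
by move=> g; exact: dil_opZ0.
Qed.

Lemma dil_opX c s j f : c != 0 ->
  dilate c (opX s j f) = opX (s / c) j (dilate c f).
Proof.
move=> c0; rewrite !opXE (linD _ _ (lin_dil c)) (linZ _ _ (lin_dil c)).
by rewrite dil_opY // dil_opZ // scalerA.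
Qed.

End Operators.

(** * Homogeneous components *)

Section Grading.

Variables (K : fieldType) (n : nat).
Implicit Types (f g : {mpoly K[n]}) (A : {mpoly K[n]} -> {mpoly K[n]}).

Notation pr d := (pihomog mdeg d).

Lemma mcoeff_dil (c : K) f e : (dilate c f)@_e = c ^+ mdeg e * f@_e.
Proof.
rewrite /dilate comp_mpolyEX raddf_sum /=.
rewrite [in RHS](mpolyE f) raddf_sum /= mulr_sumr; apply: eq_bigr => e' _.
rewrite !mcoeffZ comp_mpolyX.
under eq_bigr => i _ do rewrite tnth_mktuple exprZn.
rewrite scaler_prod -mpolyXE_id mcoeffZ mcoeffX.
have [->|_] := eqVneq e' e; last by rewrite !mulr0.
by rewrite prodrXr -mdegE mulrCA.
Qed.

Lemma dil_dil (a b : K) f : dilate a (dilate b f) = dilate (a * b) f.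
Proof. by apply/mpolyP=> e; rewrite !mcoeff_dil exprMn mulrA. Qed.

Lemma dil_1 f : dilate 1 f = f.
Proof. by apply/mpolyP=> e; rewrite mcoeff_dil expr1n mul1r. Qed.

Lemma mcoeff_pr d f e : (pr d f)@_e = if mdeg e == d then f@_e else 0.
Proof.
rewrite pihomogE raddf_sum /=; have [E|ne] := eqVneq (mdeg e) d.
  rewrite [in RHS](mpolyE f) raddf_sum /= [RHS](bigID (fun e' => mdeg e' == d)) /=.
  rewrite [X in _ = _ + X]big1 ?addr0 // => e' ne; rewrite mcoeffZ mcoeffX.
  by rewrite (_ : (e' == e) = false) ?mulr0 //; apply: contraNF ne => /eqP ->; rewrite E.
rewrite big1 // => e' E; rewrite mcoeffZ mcoeffX.
by rewrite (_ : (e' == e) = false) ?mulr0 //; apply: contraNF ne => /eqP <-.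
Qed.

Lemma pr_size d f : (msize f <= d)%N -> pr d f = 0.
Proof.
move=> fd; apply/mpolyP=> e; rewrite mcoeff_pr mcoeff0; case: eqP => // E.
by apply: memN_msupp_eq0; apply: msize_mdeg_ge; rewrite E.
Qed.

Lemma msize_pr d f : (msize (pr d f) <= d.+1)%N.
Proof.
rewrite msizeE; apply/bigmax_leqP_seq => e; rewrite mcoeff_msupp mcoeff_pr.
by case: (mdeg e =P d) => [->|]; rewrite ?eqxx // ltnS leqnn.
Qed.

Lemma pr_pr d d' f : pr d (pr d' f) = if d == d' then pr d f else 0.
Proof.
apply/mpolyP=> e; rewrite mcoeff_pr; have [->|ne] := eqVneq d d'.
  by rewrite mcoeff_pr; case: eqP.
by rewrite mcoeff0 mcoeff_pr; case: eqP => // ->; rewrite (negbTE ne).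
Qed.

Lemma dil_pr (c : K) d f : dilate c (pr d f) = c ^+ d *: pr d f.
Proof.
apply/mpolyP=> e; rewrite mcoeff_dil mcoeffZ mcoeff_pr.
by case: eqP => [->|_] //; rewrite !mulr0.
Qed.

Lemma lin_pr d : lin (fun f => pr d f).
Proof. by move=> c f g; rewrite linearP. Qed.

(** Homogeneity of [A] is tested by the single dilation by [q]: its powers are distinct, so
    comparing coefficients fixes the degree of the image. Two exponents [a] and [b] express a shift
    either way without subtraction. *)
Lemma graded (q : K) A (a b d i : nat) f :
  injective (fun k => q ^+ k) -> lin A ->
  (forall f, q ^+ a *: dilate q (A f) = q ^+ b *: A (dilate q f)) ->
  (a + d = b + i)%N -> pr d (A f) = A (pr i f).
Proof.
move=> q_inj lA HA adbi.
have H k g e : (A (pr k g))@_e != 0 -> (a + mdeg e = b + k)%N.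
  move=> nz; have := congr1 (mcoeff e) (HA (pr k g)).
  rewrite dil_pr (linZ _ _ lA) !mcoeffZ mcoeff_dil !mulrA -!exprD.
  by move/(mulIf nz) => /q_inj.
pose D := maxn (msize f) i.+1.
have fD : (msize f <= D)%N by exact: leq_maxl.
have iD : (i < D)%N by exact: leq_maxr.
rewrite [in LHS](pihomog_partitionE fD) (lin_sum _ _ _ lA).
rewrite (lin_sum _ _ _ (lin_pr d)) (bigD1 (Ordinal iD)) //= big1 ?addr0.
  apply/mpolyP=> e; rewrite mcoeff_pr; case: eqP => // ne.
  by apply/esym/eqP/negPn/negP => /H; lia.
move=> k nk; apply/mpolyP=> e; rewrite mcoeff_pr mcoeff0; case: eqP => // E.
apply/eqP/negPn/negP => /H; move: nk; rewrite -val_eqE /=; lia.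
Qed.

End Grading.

(** * Compositions listed by degree *)

Section DegreeLevels.

Variables (n : nat).

Definition level (d : nat) : seq 'X_{1..n} :=
  [seq v <- [seq val x | x : 'X_{1..n < d.+1}] | mdeg v == d].

Lemma mem_bounded (d : nat) (v : 'X_{1..n}) :
  (v \in [seq val x | x : 'X_{1..n < d}]) = (mdeg v < d)%N.
Proof.
apply/mapP/idP => [[x _ ->]|H]; first exact: bmdeg.
by exists (BMultinom H); rewrite ?mem_enum.
Qed.

Lemma uniq_bounded (d : nat) : uniq [seq val x | x : 'X_{1..n < d}].
Proof. by rewrite map_inj_uniq ?enum_uniq //; exact: val_inj. Qed.

Lemma mem_level (d : nat) v : (v \in level d) = (mdeg v == d).
Proof. by rewrite mem_filter mem_bounded; case: eqP => // ->; rewrite ltnS leqnn. Qed.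

Lemma uniq_level (d : nat) : uniq (level d).
Proof. by rewrite filter_uniq // uniq_bounded. Qed.

Fixpoint upto (d : nat) : seq 'X_{1..n} :=
  if d is d'.+1 then upto d' ++ level d' else [::].

Lemma mem_upto d v : (v \in upto d) = (mdeg v < d)%N.
Proof.
elim: d => [|d IH] //=.
by rewrite mem_cat IH mem_level ltnS [in RHS]leq_eqVlt orbC.
Qed.

Lemma uniq_upto d : uniq (upto d).
Proof.
elim: d => [|d IH] //=; rewrite cat_uniq IH uniq_level andbT /=.
by apply/hasPn => v; rewrite mem_level mem_upto => /eqP ->; rewrite ltnn.
Qed.

Lemma big_upto (R : Type) (idx : R) (op : Monoid.com_law idx) d (F : 'X_{1..n} -> R) :
  \big[op/idx]_(v : 'X_{1..n < d}) F v = \big[op/idx]_(v <- upto d) F v.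
Proof.
transitivity (\big[op/idx]_(v <- [seq val x | x : 'X_{1..n < d}]) F v).
  by rewrite big_map big_enum.
apply: perm_big; apply: uniq_perm; rewrite ?uniq_upto ?uniq_bounded //.
by move=> v; rewrite mem_upto mem_bounded.
Qed.

End DegreeLevels.

(** Leaves a nonzero scalar for each u free, so that the normalised polynomials qualify without
    computing with their normalisation. *)
Definition interp_family (K : fieldType) (m : nat) (q t : K)
    (N : 'X_{1..m.+1} -> {mpoly K[m.+1]}) : Prop :=
  [/\ forall u, (msize (N u) <= (mdeg u).+1)%N,
      forall u v, (mdeg v <= mdeg u)%N -> v != u -> (N u).@[spectral q t v] = 0
    & forall u, N u != 0].

(** * Interpolation polynomials as joint eigenfunctions *)

Section Family.

Variables (K : fieldType) (m : nat) (q t : K).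
Hypothesis gen : generic_qt q t.
Implicit Types (u v w : 'X_{1..m.+1}) (i : 'I_m.+1) (j k : nat).
Implicit Types (f g h : {mpoly K[m.+1]}).

Notation sp := (spectral q t).
Notation P := {mpoly K[m.+1]}.

Let q0 : q != 0 := gen_q0 gen.

Let t0 : t != 0 := gen_t0 gen.

Variable N : 'X_{1..m.+1} -> P.
Hypothesis fam : interp_family q t N.

Let N_size u : (msize (N u) <= (mdeg u).+1)%N. Proof. by case: fam. Qed.
Let N_vanish u v : (mdeg v <= mdeg u)%N -> v != u -> (N u).@[sp v] = 0.
Proof. by case: fam => _ H _; exact: H. Qed.
Let N_neq0 u : N u != 0. Proof. by case: fam. Qed.

Lemma level_ext d f g : (msize f <= d.+1)%N -> (msize g <= d.+1)%N ->
  (forall v, (mdeg v <= d)%N -> f.@[sp v] = g.@[sp v]) -> f = g.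
Proof.
move=> fd gd E; apply/eqP; rewrite -subr_eq0; apply/eqP.
apply: (unisolvent gen (msize_sub fd gd)) => v vd.
by rewrite mevalB E // subrr.
Qed.

Definition diagN u := (N u).@[sp u].

Lemma diagN_neq0 u : diagN u != 0.
Proof.
apply/eqP => E; move/eqP: (N_neq0 u); apply.
apply: (level_ext (N_size u)); first by rewrite msize0.
move=> v vd; rewrite meval0; have [->//|ne] := eqVneq v u.
exact: N_vanish.
Qed.

Lemma N_eval u v : (mdeg v <= mdeg u)%N ->
  (N u).@[sp v] = if v == u then diagN u else 0.
Proof. by move=> vu; case: eqP => [->//|/eqP]; exact: N_vanish. Qed.

Lemma eval_lin2 (a b : K) f g (x : 'I_m.+1 -> K) :
  (a *: f + b *: g).@[x] = a * f.@[x] + b * g.@[x].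
Proof. by rewrite mevalD 2!mevalZ. Qed.

Definition swc j u : K := kap q t j (sw j u) * diagN u / diagN (sw j u).

Lemma opN_N j u : (j < m)%N ->
  opN t j (N u) = - kap q t j u *: N u + swc j u *: N (sw j u).
Proof.
move=> jm; apply: (@level_ext (mdeg u)).
- exact: leq_trans (msize_opN _ _ jm) (N_size u).
- apply: msize_lin => //; apply: leq_trans (msizeZ_le _ _) _.
  by rewrite -(mdeg_sw j u).
move=> v vu; rewrite eval_lin2 (opN_sp gen (N u) v jm).
rewrite (N_eval vu) (@N_eval u (sw j v)) ?mdeg_sw //.
rewrite (@N_eval (sw j u) v) ?mdeg_sw //.
rewrite (inv_eq (@swK _ j)).
have [->|ne] := eqVneq v u; have [E|ne'] := eqVneq _ (sw j u).
- by rewrite /swc -E subrr mulr0 mulfK ?diagN_neq0 // mulNr addNr.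
- by rewrite mulr0 addr0 sub0r mulrN mulNr.
- by rewrite E subr0 mulr0 add0r /swc divfK // diagN_neq0.
- by rewrite subrr !mulr0 addr0.
Qed.

Lemma opC_vanish k f d : (k <= m)%N ->
  (forall v, mdeg v = d -> f.@[sp v] = 0) ->
  forall v, mdeg v = d -> (opC t k f).@[sp v] = 0.
Proof.
elim: k f => [|k IH] f km f0 v vd //=; first exact: f0.
apply: IH vd; first exact: ltnW.
move=> w wd; rewrite opHE mevalD mevalZ (opN_sp gen f w km) (f0 w wd).
by rewrite (f0 (sw k w)) ?mdeg_sw // subrr !mulr0 addr0.
Qed.

Lemma opPi_sp f w : (opPi q f).@[sp (Phi w)] = f.@[sp w].
Proof.
rewrite opPi_eval; apply: meval_eq => i.
have H i' : sp (Phi w) i' = q ^+ (i'.+1 == m.+1 :> nat) * sp w (crot m.+1 i').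
  by apply: sp_Phik => [|i'']; rewrite ?leqnn // leqNgt ltn_ord.
have [->|ne] := eqVneq i ord0.
  by rewrite H /= eqxx expr1 mulKf // crot_max.
rewrite H; have i0 : (0 < i)%N by rewrite lt0n.
have E : (inord i.-1 : 'I_m.+1) = i.-1 :> nat.
  by rewrite inordK //; have := ltn_ord i; lia.
rewrite E prednK // ltn_eqF ?ltn_ord // mul1r; congr (sp w _).
apply: val_inj; rewrite /= crotE // E; have := ltn_ord i.
by rewrite prednK // => im; rewrite ifT ?ifN //; lia.
Qed.

Lemma Phi_cases v : v ord_max = 0%N \/ exists w, v = Phi w.
Proof.
have [v0|v0] := posnP (v ord_max); [by left | right].
have E : inord m.+1.-1 = ord_max :> 'I_m.+1.
  by apply: val_inj; rewrite /= inordK.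
by exists (unPhik m.+1 v); rewrite /Phi unPhikK ?leqnn // E.
Qed.

Lemma sp_max0 v : v ord_max = 0%N -> sp v ord_max = 1.
Proof. by move=> v0; rewrite spectralE v0 (krank_max0 v0) mulr1. Qed.

(** With x the last variable, x (Y + Z) f = f + (x - 1) Y f. At <v> the last term vanishes: either v
    ends in 0 and x = 1, or v = [Phi w] and Y f is there a combination of values of f in degree |v|
    - 1. *)
Lemma opX1_max f v : (forall w, (mdeg w < mdeg v)%N -> f.@[sp w] = 0) ->
  (opX gen 1 m f).@[sp v] = (sp v ord_max)^-1 * f.@[sp v].
Proof.
move=> f0; have s0 := sp_neq0 gen v ord_max.
apply: (mulfI s0); rewrite mulVKf //.
rewrite opXE scale1r /opY /opZ subnn /= mevalD mulrDr.
have := congr1 (meval (sp v)) (opZ0E gen f).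
rewrite mevalM mevalXU mevalB => ->; rewrite addrCA -[RHS]addr0; congr (_ + _).
rewrite -mulN1r -mulrDl.
have [v0|[w E]] := Phi_cases v; first by rewrite sp_max0 // subrr mul0r.
rewrite E opY0E mevalZ opPi_sp (@opC_vanish m f (mdeg w)) ?mulr0 //.
by move=> w' ww; apply: f0; rewrite E mdeg_Phi ww.
Qed.

Lemma opJ_N j u : (j < m)%N ->
  opJ t j (N u) = (1 - kap q t j u) *: N u + swc j u *: N (sw j u).
Proof. by move=> jm; rewrite opJE opN_N // addrA scalerBl scale1r scaleNr. Qed.

Lemma inord_max : inord m = ord_max :> 'I_m.+1.
Proof. by apply: val_inj; rewrite /= inordK. Qed.

(** Downward induction on j. At j = m both sides have the same values up to degree |u|; below, the
    recursion acts on the span of [N u] and [N (sw j u)]. *)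
Lemma opX_N j u : (j <= m)%N ->
  opX gen 1 j (N u) = (sp u (inord j))^-1 *: N u.
Proof.
move=> jm; rewrite -(subKn jm); move: (m - j)%N (leq_subr j m) u => d {jm j}.
elim: d => [|d IH] dm u.
  rewrite subn0; apply: (@level_ext (mdeg u)).
  - exact: leq_trans (msize_opX _ _ _ _) (N_size u).
  - exact: leq_trans (msizeZ_le _ _) (N_size u).
  move=> v vu; rewrite opX1_max; last first.
    move=> w wv; rewrite N_vanish //; first exact: leq_trans (ltnW wv) vu.
    by apply: contraTneq vu => <-; rewrite -ltnNge.
  rewrite mevalZ (N_eval vu) inord_max; case: eqP => [->//|_].
  by rewrite !mulr0.
set j := (m - d.+1)%N; have jm : (j < m)%N by rewrite /j; lia.
have E : (m - d = j.+1)%N by rewrite /j; lia.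
rewrite E in IH; have {}IH := IH (ltnW dm).
rewrite opX_step // opJ_N // (linD _ _ (lin_opX gen _ _)).
rewrite 2!(linZ _ _ (lin_opX gen _ _)) 2!IH.
(* For equal parts [opJ] fixes [N u], and the remaining [t^-1] is the ratio of the two
   eigenvalues. *)
have [eq_u|ne] := eqVneq (u (inord j)) (u (inord j.+1)).
  have k0 := kap_eq0 q t jm eq_u.
  have r0 : swc j u = 0 by rewrite /swc (sw_id eq_u) k0 !mul0r.
  rewrite r0 scale0r addr0 k0 subr0 scale1r (linZ _ _ (lin_opJ gen jm)).
  rewrite opJ_N // r0 scale0r addr0 k0 subr0 scale1r scalerA -invfM.
  by rewrite -(sp_step _ _ jm eq_u).
rewrite (linD _ _ (lin_opJ gen jm)) 4!(linZ _ _ (lin_opJ gen jm)).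
rewrite (opJ_N u jm) (opJ_N (sw j u) jm) swK.
have ab := sp_adj_neq gen u jm.
have -> : kap q t j (sw j u) = 1 + t - kap q t j u.
  by rewrite -(kap_sw_sum gen jm ne) addrK.
rewrite (sp_sw q t _ jm ne) swp_r.
(* Only this product enters the eigenvalue, and in it the unknown diagonal values cancel. *)
have rr : swc j u * swc j (sw j u) = kap q t j (sw j u) * kap q t j u.
  rewrite /swc swK; have := diagN_neq0 u; have := diagN_neq0 (sw j u).
  set a := diagN _; set b := diagN _ => a0 b0; by field; rewrite a0 b0.
have kE : kap q t j u = (sp u (inord j) - t * sp u (inord j.+1)) /
   (sp u (inord j) - sp u (inord j.+1)) by [].
rewrite (kap_sw q t jm ne) /kapx in rr.
move: rr kE (sp_neq0 gen u (inord j)) (sp_neq0 gen u (inord j.+1)) ab t0.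
move: (kap q t j u) (swc j u) (swc j (sw j u)) (sp u (inord j)) (sp u (inord j.+1)).
move=> kp r r' a b rr kE a0 b0 ab tn0.
have ab' : a - b != 0 by rewrite subr_eq0.
have ba' : b - a != 0 by rewrite subr_eq0 eq_sym.
apply/mpolyP=> e; rewrite mcoeffZ mcoeffD 4!mcoeffZ 2!mcoeffD 5!mcoeffZ.
move: (mcoeff e (N u)) (mcoeff e (N (sw j u))) => n1 n2.
transitivity (t^-1 * (((1 - kp) ^+ 2 / b + r * r' / a) * n1
                      + ((1 - kp) / b + (kp - t) / a) * r * n2)); first by ring.
by rewrite rr kE; field; rewrite ab' ba' a0 b0 tn0.
Qed.

(** Newton interpolation, one degree at a time: a combination of the [N v] matching f below degree
    [msize f] is f, by unisolvence. *)
Lemma N_ind (Q : P -> Prop) :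
  (forall c f g, Q f -> Q g -> Q (c *: f + g)) -> Q 0 -> (forall u, Q (N u)) ->
  forall f, Q f.
Proof.
move=> Qlin Q00 QN f; pose d := msize f.
have H e : (e <= d)%N -> exists h, [/\ Q h, (msize h <= d)%N &
    forall v, (mdeg v < e)%N -> h.@[sp v] = f.@[sp v]].
  elim: e => [|e IH] ed; first by exists 0; rewrite msize0.
  have [h [Qh hd hE]] := IH (ltnW ed).
  pose a v := (f.@[sp v] - h.@[sp v]) / diagN v.
  have QS r : (forall v, v \in r -> mdeg v = e) -> Q (\sum_(v <- r) a v *: N v) /\
      (msize (\sum_(v <- r) a v *: N v) <= d)%N.
    elim: r => [|v r IHr] Hr; first by rewrite big_nil msize0.
    have [|Q1 s1] := IHr; first by move=> w wr; apply: Hr; rewrite inE wr orbT.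
    rewrite big_cons; split; first exact: Qlin.
    apply: msize_lin => //; apply: leq_trans (N_size v) _.
    by rewrite (Hr v) ?inE ?eqxx.
  have [|Q1 s1] := QS (level m.+1 e).
    by move=> v; rewrite mem_level => /eqP.
  exists (1 *: h + \sum_(v <- level m.+1 e) a v *: N v); split.
  - exact: Qlin.
  - exact: msize_lin.
  move=> v; rewrite ltnS leq_eqVlt mevalD mevalZ mul1r raddf_sum /= => /orP[/eqP ve|ve].
    rewrite (bigD1_seq v) ?mem_level ?ve ?uniq_level //= big_seq_cond big1.
      by rewrite addr0 mevalZ /a divfK ?diagN_neq0 // addrC subrK.
    move=> w; rewrite mem_level => /andP[/eqP we wv].
    by rewrite mevalZ N_vanish ?mulr0 ?we ?ve // eq_sym.
  rewrite hE // big_seq big1 ?addr0 // => w; rewrite mem_level => /eqP we.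
  rewrite mevalZ N_vanish ?mulr0 ?we //; first exact: ltnW.
  by apply: contraTneq ve => ->; rewrite we ltnn.
have [h [Qh hd hE]] := H d (leqnn d).
suff -> : f = h by [].
apply/eqP; rewrite -subr_eq0; apply/eqP; apply: (unisolvent gen (d := d)).
  exact: msize_sub.
by move=> v vd; rewrite mevalB hE // subrr.
Qed.

Definition D (c : K) u : P := dilate c (N u).

Lemma D_ind (c : K) (Q : P -> Prop) : c != 0 ->
  (forall a f g, Q f -> Q g -> Q (a *: f + g)) -> Q 0 -> (forall u, Q (D c u)) ->
  forall f, Q f.
Proof.
move=> c0 Qlin Q00 QD f; rewrite -[f]dil_1 -(divff c0) -dil_dil.
move: (dilate c^-1 f) => {}f; elim/N_ind: f => [a f g Hf Hg||u].
- by rewrite lin_dil; exact: Qlin.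
- by rewrite (lin0 (lin_dil c)).
- exact: QD.
Qed.

Lemma lin_ext (c : K) (A B : P -> P) : c != 0 -> lin A -> lin B ->
  (forall u, A (D c u) = B (D c u)) -> A =1 B.
Proof.
move=> c0 lA lB H; apply: (D_ind c0) => [a f g Ef Eg||//].
  by rewrite lA lB Ef Eg.
by rewrite lin0 // lin0.
Qed.

Lemma opX_D (c : K) j u : c != 0 -> (j <= m)%N ->
  opX gen c^-1 j (D c u) = (sp u (inord j))^-1 *: D c u.
Proof.
move=> c0 jm; rewrite -[c^-1]mul1r /D -dil_opX // opX_N //.
by rewrite (linZ _ _ (lin_dil c)).
Qed.

Lemma opN_D (c : K) j u : c != 0 -> (j < m)%N ->
  opN t j (D c u) = - kap q t j u *: D c u + swc j u *: D c (sw j u).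
Proof.
move=> c0 jm; rewrite /D -(dil_opN gen _ jm c0) opN_N // lin_dil.
by rewrite (linZ _ _ (lin_dil c)).
Qed.

Lemma opX_comm (c : K) j k f : c != 0 -> (j <= m)%N -> (k <= m)%N ->
  opX gen c^-1 j (opX gen c^-1 k f) = opX gen c^-1 k (opX gen c^-1 j f).
Proof.
move=> c0 jm km; have lX l := @lin_opX K m q t gen c^-1 l.
apply: (lin_ext c0 (lin_comp (lX j) (lX k)) (lin_comp (lX k) (lX j))) => u /=.
by rewrite !opX_D // (linZ _ _ (lX j)) (linZ _ _ (lX k)) !opX_D // !scalerA mulrC.
Qed.

Lemma opX_opN_comm (c : K) j k f : c != 0 -> (j <= m)%N -> (k < m)%N ->
  j != k -> j != k.+1 ->
  opX gen c^-1 j (opN t k f) = opN t k (opX gen c^-1 j f).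
Proof.
move=> c0 jm km jk jk1; have lX := @lin_opX K m q t gen c^-1 j; have lN := lin_opN gen km.
apply: (lin_ext c0 (lin_comp lX lN) (lin_comp lN lX)) => u /=.
have H : sp (sw k u) (inord j) = sp u (inord j).
  have [/sw_id -> //|ne] := eqVneq (u (inord k)) (u (inord k.+1)).
  by rewrite sp_sw // swp_o // inordK.
rewrite opN_D // lX (linZ _ _ lX) 3?opX_D // (linZ _ _ lN) opN_D // H.
rewrite scalerDr !scalerA.
by congr (_ *: _ + _ *: _); rewrite mulrC.
Qed.

End Family.

(** * Expansions in the interpolation basis and in its top components *)

Section Basis.

Variables (K : fieldType) (m : nat) (q t : K).
Hypothesis gen : generic_qt q t.
Implicit Types (u v w : 'X_{1..m.+1}) (i : 'I_m.+1) (j k d : nat).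
Implicit Types (f g h : {mpoly K[m.+1]}).

Notation sp := (spectral q t).
Notation P := {mpoly K[m.+1]}.
Notation pr d := (pihomog mdeg d).

Let q0 : q != 0 := gen_q0 gen.

Variable N : 'X_{1..m.+1} -> P.
Hypothesis fam : interp_family q t N.

Let N_size u : (msize (N u) <= (mdeg u).+1)%N. Proof. by case: fam. Qed.
Let N_vanish u v : (mdeg v <= mdeg u)%N -> v != u -> (N u).@[sp v] = 0.
Proof. by case: fam => _ H _; exact: H. Qed.

Notation dg := (diagN q t N).

(** Each stage corrects the values in one degree and spoils nothing: for |v| = d', [N v] vanishes at
    the other points of degree at most d'. So the coefficient of [N v] is a residual divided by a
    diagonal value, which is [cN]. *)
Fixpoint interp d f : P :=
  if d is d'.+1 then
    interp d' f +
    \sum_(v <- level m.+1 d') ((f - interp d' f).@[sp v] / dg v) *: N v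
  else 0.

Definition cN f v : K := (f - interp (mdeg v) f).@[sp v] / dg v.

Lemma interpE d f : interp d f = \sum_(v <- upto m.+1 d) cN f v *: N v.
Proof.
elim: d => [|d IH] /=; first by rewrite big_nil.
rewrite big_cat -IH /=; congr (_ + _); rewrite big_seq [RHS]big_seq.
by apply: eq_bigr => v; rewrite mem_level /cN => /eqP ->.
Qed.

Lemma lin_interp d : lin (interp d).
Proof.
elim: d => [|d IH] c f g /=; first by rewrite scaler0 addr0.
rewrite IH scalerDr addrACA; congr (_ + _).
rewrite scaler_sumr -big_split; apply: eq_bigr => v _ /=.
rewrite scalerA -scalerDl; congr (_ *: _).
rewrite !mevalB !mevalD !mevalZ; ring.
Qed.

Lemma cN_lin c f g v : cN (c *: f + g) v = c * cN f v + cN g v.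
Proof. by rewrite /cN lin_interp !mevalB !mevalD !mevalZ; ring. Qed.

Lemma msize_interp d f : (msize (interp d f) <= d)%N.
Proof.
rewrite interpE; apply: leq_trans (msize_sum _ _ _) _.
rewrite big_seq; apply/bigmax_leqP_seq => v _; rewrite mem_upto => vd.
by apply: leq_trans (msizeZ_le _ _) _; apply: leq_trans (N_size v) vd.
Qed.

Lemma interp_eval d f v : (mdeg v < d)%N -> (interp d f).@[sp v] = f.@[sp v].
Proof.
elim: d => [|d IH] //=; rewrite ltnS leq_eqVlt mevalD raddf_sum /=.
case/orP=> [/eqP vd|vd]; last first.
  rewrite IH // big_seq big1 ?addr0 // => w; rewrite mem_level => /eqP wd.
  rewrite mevalZ N_vanish ?mulr0 ?wd //; first exact: ltnW.
  by apply: contraTneq vd => ->; rewrite wd ltnn.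
rewrite (bigD1_seq v) ?mem_level ?vd ?uniq_level //= big_seq_cond big1.
  by rewrite addr0 mevalZ divfK ?(diagN_neq0 gen fam) // mevalB addrC subrK.
move=> w; rewrite mem_level => /andP[/eqP we wv].
by rewrite mevalZ N_vanish ?mulr0 ?we ?vd // eq_sym.
Qed.

Lemma interp_id d f : (msize f <= d)%N -> interp d f = f.
Proof.
move=> fd; apply/eqP; rewrite -subr_eq0; apply/eqP.
apply: (unisolvent gen (d := d)); first by rewrite msize_sub ?msize_interp.
by move=> v vd; rewrite mevalB interp_eval // subrr.
Qed.

Lemma cN_small f v : (msize f <= mdeg v)%N -> cN f v = 0.
Proof. by move=> fv; rewrite /cN interp_id // subrr meval0 mul0r. Qed.

Lemma interp_N d u : (d <= mdeg u)%N -> interp d (N u) = 0.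
Proof.
elim: d => [|d IH] //= du; rewrite IH ?(ltnW du) // add0r big_seq big1 // => v.
rewrite mem_level => /eqP vd; rewrite subr0 N_vanish ?mul0r ?scale0r //.
  by rewrite vd ltnW.
by apply: contraTneq du => <-; rewrite vd ltnn.
Qed.

Lemma cN_N u v : cN (N u) v = (v == u)%:R.
Proof.
have [vu|uv] := leqP (mdeg v) (mdeg u); last first.
  rewrite cN_small; last exact: leq_trans (N_size u) uv.
  by case: eqP uv => // ->; rewrite ltnn.
rewrite /cN interp_N // subr0; have [->|ne] := eqVneq v u.
  by rewrite divff // (diagN_neq0 gen fam).
by rewrite N_vanish // mul0r.
Qed.

Definition Etop u : P := pr (mdeg u) (N u).

(** The coefficient of [Etop v] in f. It can be read off [N]-expansions because [N v] and [Etop v]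
    differ by terms of lower degree. *)
Definition cE f v : K := cN (pr (mdeg v) f) v.

Lemma cE_lin c f g v : cE (c *: f + g) v = c * cE f v + cE g v.
Proof. by rewrite /cE linearP cN_lin. Qed.

Lemma cE0 v : cE 0 v = 0.
Proof. by rewrite /cE raddf0 cN_small ?msize0. Qed.

Lemma cED f g v : cE (f + g) v = cE f v + cE g v.
Proof. by rewrite -[f]scale1r cE_lin mul1r scale1r. Qed.

Lemma cEZ c f v : cE (c *: f) v = c * cE f v.
Proof. by rewrite -[c *: f]addr0 cE_lin cE0 addr0. Qed.

Lemma cE_sum (I : Type) (r : seq I) (F : I -> P) v :
  cE (\sum_(i <- r) F i) v = \sum_(i <- r) cE (F i) v.
Proof. by elim/big_rec2: _ => [|i a b _ <-]; rewrite ?cE0 // cED. Qed.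

Lemma msize_le_coef d f : (forall e, (d <= mdeg e)%N -> f@_e = 0) ->
  (msize f <= d)%N.
Proof.
move=> H; rewrite msizeE; apply/bigmax_leqP_seq => e; rewrite mcoeff_msupp => nz _.
by rewrite ltnNge; apply: contra nz => /H ->.
Qed.

Lemma msize_top u : (msize (N u - Etop u) <= mdeg u)%N.
Proof.
apply: msize_le_coef => e; rewrite mcoeffB mcoeff_pr leq_eqVlt => /orP[/eqP <-|ue].
  by rewrite eqxx subrr.
rewrite gtn_eqF // subr0; apply: memN_msupp_eq0; apply: msize_mdeg_ge.
exact: leq_trans (N_size u) ue.
Qed.

Lemma cE_E u v : cE (Etop u) v = (v == u)%:R.
Proof.
rewrite /cE pr_pr; have [E|ne] := eqVneq (mdeg v) (mdeg u); last first.
  by rewrite cN_small ?msize0 //; case: (v =P u) ne => // ->; rewrite eqxx.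
rewrite E -/(Etop u).
have -> : Etop u = (-1) *: (N u - Etop u) + N u by rewrite scaleN1r opprB subrK.
by rewrite cN_lin cN_N cN_small ?mulr0 ?add0r // E msize_top.
Qed.

Lemma sum_level_E d f : \sum_(v <- level m.+1 d) cE f v *: Etop v = pr d f.
Proof.
have := interp_id (msize_pr d f); rewrite interpE /= big_cat /= => E.
have := congr1 (fun g => pr d g) E; rewrite pr_pr eqxx linearD /= !linear_sum /=.
move=> <-; rewrite [X in _ = X + _]big_seq [X in _ = X + _]big1 ?add0r => [|v]; last first.
  rewrite mem_upto => vd.
  by rewrite linearZ /= (pr_size (leq_trans (N_size v) vd)) scaler0.
rewrite big_seq [RHS]big_seq; apply: eq_bigr => v; rewrite mem_level => /eqP vd.
by rewrite linearZ /= /cE /Etop vd.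
Qed.

Lemma E_rec d f : (msize f <= d)%N ->
  f = \sum_(v <- upto m.+1 d) cE f v *: Etop v.
Proof.
move=> fd; rewrite [LHS](pihomog_partitionE fd); elim: d {fd} => [|d IH] /=.
  by rewrite big_ord0 big_nil.
by rewrite big_ord_recr /= IH big_cat sum_level_E.
Qed.

Lemma cE_ext f g : (forall v, cE f v = cE g v) -> f = g.
Proof.
move=> E; rewrite (E_rec (leq_maxl (msize f) (msize g))).
rewrite [RHS](E_rec (leq_maxr (msize f) (msize g))).
by apply: eq_bigr => v _; rewrite E.
Qed.

Lemma linE_ext (A B : P -> P) : lin A -> lin B ->
  (forall u, A (Etop u) = B (Etop u)) -> A =1 B.
Proof.
move=> lA lB H f; rewrite (E_rec (leqnn (msize f))) !lin_sum //.
by apply: eq_bigr => v _; rewrite !linZ // H.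
Qed.

Definition hop (phi : 'X_{1..m.+1} -> K) f : P :=
  \sum_(v <- upto m.+1 (msize f)) (phi v * cE f v) *: Etop v.

Lemma cE_hop phi f v : cE (hop phi f) v = phi v * cE f v.
Proof.
rewrite cE_sum; have [fv|vf] := leqP (msize f) (mdeg v).
  have -> : cE f v = 0 by rewrite /cE pr_size // cN_small ?msize0.
  rewrite mulr0 big_seq big1 // => w.
  rewrite mem_upto cEZ cE_E; case: eqP => [<- vf|_]; last by rewrite mulr0.
  by move: (leq_trans vf fv); rewrite ltnn.
rewrite (bigD1_seq v) ?mem_upto ?uniq_upto //= cEZ cE_E eqxx mulr1.
rewrite big1 ?addr0 // => w wv; rewrite cEZ cE_E eq_sym (negbTE wv).
by rewrite mulr0.
Qed.

Lemma lin_hop phi : lin (hop phi).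
Proof.
move=> c f g; apply: cE_ext => v; rewrite cE_lin !cE_hop cE_lin; ring.
Qed.

Lemma hop_E phi u : hop phi (Etop u) = phi u *: Etop u.
Proof.
apply: cE_ext => v; rewrite cE_hop cEZ cE_E.
by case: eqP => [->//|_]; rewrite !mulr0.
Qed.

Lemma dil_E c u : dilate c (Etop u) = c ^+ mdeg u *: Etop u.
Proof. exact: dil_pr. Qed.

Lemma opN_E j u : (j < m)%N ->
  opN t j (Etop u) = - kap q t j u *: Etop u + swc q t N j u *: Etop (sw j u).
Proof.
move=> jm; rewrite /Etop -(@graded _ _ q (opN t j) 0 0 (mdeg u)) //.
- rewrite (opN_N gen fam) // linearP /= linearZ /=.
  by rewrite [in RHS]mdeg_sw.
- exact: gen_q_inj gen.
- exact: (lin_opN gen jm).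
by move=> f; rewrite !scale1r (dil_opN gen).
Qed.

Lemma graded_opY j d f : pr d (opY q t j f) = opY q t j (pr d f).
Proof.
apply: (@graded _ _ q _ 0 0) => //; first exact: gen_q_inj gen.
  exact: (lin_opY gen).
by move=> g; rewrite !scale1r (dil_opY gen).
Qed.

Lemma graded_opZ j d f : pr d (opZ gen j f) = opZ gen j (pr d.+1 f).
Proof.
apply: (@graded _ _ q _ 1 0) => //; first exact: gen_q_inj gen.
  exact: (lin_opZ gen).
by move=> g; rewrite scale1r (dil_opZ gen) // scalerA expr1 divff // scale1r.
Qed.

(** The top-degree part of [opX_N]; the Z term lowers the degree and drops out. *)
Lemma opY_E j u : (j <= m)%N ->
  opY q t j (Etop u) = (sp u (inord j))^-1 *: Etop u.
Proof.
move=> jm; have := congr1 (fun f => pr (mdeg u) f) (opX_N gen fam u jm).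
rewrite linearZ /= opXE scale1r linearD /= graded_opY graded_opZ.
by rewrite (@pr_size _ _ (mdeg u).+1) ?N_size // (lin0 (lin_opZ gen _)) addr0.
Qed.

Lemma E_Phi u : exists2 c, c != 0 &
  'X_ord_max * opPi q (Etop u) = c *: Etop (Phi u).
Proof.
have s1 : sp (Phi u) ord_max - 1 != 0.
  rewrite subr_eq0 spectralE; apply/eqP => E1.
  have [] := @gen_eq _ q t gen (Phi u ord_max) (krank (Phi u) ord_max) 0 0.
    by rewrite E1 mulr1.
  by rewrite PhikE eqxx addn1.
exists ((sp (Phi u) ord_max - 1) * dg u / dg (Phi u)).
  by rewrite !mulf_neq0 ?invr_eq0 ?(diagN_neq0 gen fam).
(* The inhomogeneous raising relation: the factor ['X_ord_max - 1] supplies the zeros at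
   compositions ending in 0, [opPi] those at the others. The lemma is its top component. *)
have E : ('X_ord_max - 1) * opPi q (N u) =
    ((sp (Phi u) ord_max - 1) * dg u / dg (Phi u)) *: N (Phi u).
  apply: (@level_ext _ _ _ _ gen (mdeg u).+1).
  - have X2 : (msize ('X_ord_max - 1 : P) <= 2)%N.
      by apply: msize_linform; rewrite msize1.
    apply: leq_trans (msize_mul X2 _) _; last by rewrite add1n.
    exact: leq_trans (msize_opPi q _) (N_size u).
  - by apply: leq_trans (msizeZ_le _ _) _; rewrite -(mdeg_Phi u).
  move=> v vu; rewrite mevalM mevalB mevalXU meval1 mevalZ.
  have [v0|[w Ew]] := Phi_cases v.
    rewrite (sp_max0 _ _ v0) subrr mul0r N_vanish ?mulr0 ?mdeg_Phi //.
    by apply: contra_eq_neq v0 => ->; rewrite PhikE eqxx addn1.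
  rewrite Ew (opPi_sp gen) (N_eval fam); last first.
    by move: vu; rewrite Ew mdeg_Phi.
  rewrite (N_eval fam); last by move: vu; rewrite Ew !mdeg_Phi.
  have Pinj : injective (@Phi m).
    move=> a b /mnmP H; apply/mnmP=> i.
    have ri := @crot_inj m m.+1 (leqnn _).
    have := H (invF ri i); rewrite !PhikE !f_invF; lia.
  rewrite (inj_eq Pinj); case: eqP => [->|_]; last by rewrite !mulr0.
  by rewrite divfK // (diagN_neq0 gen fam).
have G d f : pr d.+1 ('X_ord_max * f) = 'X_ord_max * pr d f.
  apply: (@graded _ _ q (fun f => 'X_ord_max * f) 0 1) => //.
  - exact: gen_q_inj gen.
  - by move=> c g h; rewrite mulrDr scalerAr.
  - move=> g; rewrite /dilate rmorphM /= comp_mktupleX scale1r.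
    by rewrite scalerAl expr1.
have := congr1 (fun f => pr (mdeg u).+1 f) E.
rewrite mulrBl mul1r linearB linearZ /= G -mdeg_Phi -/(Etop (Phi u)) mdeg_Phi => <-.
rewrite [X in _ - X]pr_size ?subr0; last exact: leq_trans (msize_opPi q _) (N_size u).
rewrite /Etop -(@graded _ _ q (opPi q) 0 0 (mdeg u)) //.
- exact: gen_q_inj gen.
- exact: lin_opPi.
- by move=> f; rewrite !scale1r (dil_opPi gen).
Qed.

Lemma opZ_max_E0 u : u ord_max = 0%N -> opZ gen m (Etop u) = 0.
Proof.
move=> u0; apply: (mulfI (mpolyX_neq0 K ord_max)).
have := opY_E u (leqnn m); rewrite inord_max /opY /opZ subnn /= => H.
by rewrite (opZ0E gen) H (sp_max0 _ _ u0) invr1 scale1r subrr mulr0.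
Qed.

Lemma opZ_max_EPhi w : exists c,
  opZ gen m (Etop (Phi w)) = c *: opPi q (Etop w).
Proof.
have [c c0 E] := E_Phi w; exists ((1 - (sp (Phi w) ord_max)^-1) / c).
apply: (mulfI (mpolyX_neq0 K ord_max)).
have := opY_E (Phi w) (leqnn m); rewrite inord_max /opY /opZ subnn /= => H.
rewrite (opZ0E gen) H -scalerAr E scalerA divfK //.
by rewrite scalerBl scale1r.
Qed.

(** Expand the commutation of the operators [opX gen c^-1] in powers of c^-1. The Y's commute, so
    one factor c^-1 cancels, and the two values c = 1 and c = q separate the remaining two
    orders. *)
Lemma opZ_comm j k f : (j <= m)%N -> (k <= m)%N ->
  opZ gen j (opZ gen k f) = opZ gen k (opZ gen j f).
Proof.
move=> jm km.
have lY l := @lin_opY K m q t gen l; have lZ l := @lin_opZ K m q t gen l.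
have YY : opY q t j (opY q t k f) = opY q t k (opY q t j f).
  apply: (linE_ext (lin_comp (lY j) (lY k)) (lin_comp (lY k) (lY j))) => u /=.
  by rewrite !opY_E // (linZ _ _ (lY j)) (linZ _ _ (lY k)) !opY_E // !scalerA mulrC.
pose X1 a b := opY q t a (opZ gen b f) + opZ gen a (opY q t b f).
pose X2 a b := opZ gen a (opZ gen b f).
have H (c : K) : c != 0 -> X1 j k - X1 k j = - c^-1 *: (X2 j k - X2 k j).
  move=> c0; have := opX_comm gen fam f c0 jm km.
  have ex a b : opX gen c^-1 a (opX gen c^-1 b f) =
      opY q t a (opY q t b f) + c^-1 *: (X1 a b + c^-1 *: X2 a b).
    rewrite !opXE (linD _ _ (lY a)) (linZ _ _ (lY a)) (linD _ _ (lZ a)) (linZ _ _ (lZ a)).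
    by rewrite -addrA /X1 /X2 -scalerDr addrA.
  rewrite !ex YY => /addrI /(scalerI _) E.
  have {}E := E (invr_neq0 c0).
  rewrite (canRL (addrK _) E) scaleNr scalerBr opprB.
  by rewrite -[X1 k j + _ - _]addrA addrAC subrr add0r.
have q1 : q != 1.
  by apply/eqP => E; have := gen_q_inj gen; move/(_ 0 1); rewrite E !expr1n => /(_ erefl).
have := H 1 (oner_neq0 _); rewrite (H q q0) invr1 => E.
have {}E : (1 - q^-1) *: (X2 j k - X2 k j) = 0.
  by rewrite scalerBl -scaleNr E scaleN1r scale1r subrr.
move/eqP: E; rewrite scaler_eq0 !subr_eq0 => /orP[|/eqP //].
by rewrite eq_sym invr_eq1 (negbTE q1).
Qed.

End Basis.

(** * How the operators shorten rows *)

Section Rows.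

Variables (K : fieldType) (m : nat) (q t : K).
Hypothesis gen : generic_qt q t.
Implicit Types (u v w : 'X_{1..m.+1}) (i : 'I_m.+1) (j k d : nat).
Implicit Types (f g h : {mpoly K[m.+1]}) (Q : 'X_{1..m.+1} -> Prop).

Notation sp := (spectral q t).
Notation P := {mpoly K[m.+1]}.

Let t0 : t != 0 := gen_t0 gen.

Let q0 : q != 0 := gen_q0 gen.

Variable N : 'X_{1..m.+1} -> P.
Hypothesis fam : interp_family q t N.

Notation E := (Etop N).
Notation coE := (cE q t N).

Definition inSp Q f := forall v, coE f v != 0 -> Q v.

Lemma inSp0 Q : inSp Q 0.
Proof. by move=> v; rewrite (cE0 gen) ?eqxx. Qed.

Lemma inSp_lin Q c f g : inSp Q f -> inSp Q g -> inSp Q (c *: f + g).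
Proof.
move=> Hf Hg v; rewrite cE_lin; have [E0|nz] := eqVneq (coE f v) 0.
  by rewrite E0 mulr0 add0r; exact: Hg.
by move=> _; exact: Hf.
Qed.

Lemma inSpZ Q c f : inSp Q f -> inSp Q (c *: f).
Proof. by move=> Hf; rewrite -[c *: f]addr0; apply: inSp_lin => //; exact: inSp0. Qed.

Lemma inSpD Q f g : inSp Q f -> inSp Q g -> inSp Q (f + g).
Proof. by rewrite -[f]scale1r => ??; apply: inSp_lin => //; rewrite -[f]scale1r. Qed.

Lemma inSp_E Q u : Q u -> inSp Q (E u).
Proof.
move=> Qu v; rewrite (cE_E gen fam); case: (v =P u) => [->//|_].
by rewrite eqxx.
Qed.

Lemma inSp_mono Q Q' f : (forall v, Q v -> Q' v) -> inSp Q f -> inSp Q' f.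
Proof. by move=> H Hf v /Hf /H. Qed.

Lemma cE_op (A : P -> P) f v : lin A ->
  coE (A f) v = \sum_(u <- upto m.+1 (msize f)) coE f u * coE (A (E u)) v.
Proof.
move=> lA; rewrite {1}(E_rec gen fam (leqnn (msize f))) (lin_sum _ _ _ lA) (cE_sum gen fam).
by apply: eq_bigr => u _; rewrite (linZ _ _ lA) (cEZ gen fam).
Qed.

Lemma inSp_op (A : P -> P) Q Q' f : lin A ->
  (forall u, Q u -> inSp Q' (A (E u))) -> inSp Q f -> inSp Q' (A f).
Proof.
move=> lA HA Hf v; rewrite (cE_op _ _ lA) => nz.
have /hasP[u _ nzu] : has (fun u => coE f u * coE (A (E u)) v != 0)
    (upto m.+1 (msize f)).
  apply: contraNT nz => /hasPn H; rewrite big_seq big1 // => u /H.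
  by rewrite negbK => /eqP.
move: nzu; rewrite mulf_eq0 negb_or => /andP[fu Au].
exact: (HA u (Hf u fu)).
Qed.

(* The operators opN mix E u with E (sw j u), and opZ maps E (Phi w) into the
   span of the E v for v a rearrangement of w. *)
Definition row_closed Q :=
  (forall j v, (j < m)%N -> Q v -> Q (sw j v)) /\ (forall w, Q (Phi w) -> Q w).

Lemma inSp_opN Q j f : row_closed Q -> (j < m)%N -> inSp Q f -> inSp Q (opN t j f).
Proof.
move=> [Qsw _] jm; apply: inSp_op; first exact: (lin_opN gen jm).
move=> u Qu; rewrite (opN_E gen fam) //; apply: inSp_lin.
  exact: inSp_E.
by apply: inSpZ; apply: inSp_E; exact: Qsw.
Qed.

Lemma inSp_opH Q j f : row_closed Q -> (j < m)%N -> inSp Q f -> inSp Q (opH t j f).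
Proof. by move=> HQ jm Hf; rewrite opHE; apply: inSp_lin => //; exact: inSp_opN. Qed.

Lemma inSp_opJ Q j f : row_closed Q -> (j < m)%N -> inSp Q f -> inSp Q (opJ t j f).
Proof. by move=> HQ jm Hf; rewrite opJE; apply: inSpD => //; exact: inSp_opN. Qed.

Lemma inSp_opY Q j f : (j <= m)%N -> inSp Q f -> inSp Q (opY q t j f).
Proof.
move=> jm; apply: inSp_op; first exact: (lin_opY gen).
by move=> u Qu; rewrite (opY_E gen fam) //; apply: inSpZ; exact: inSp_E.
Qed.

(** The word H_{k-1} ... H_0, in the order opposite to [opC]; with [opJd] in the same order, [opC]
    inverts [opJd] up to t^k. *)
Fixpoint opHd k f : P := if k is k'.+1 then opH t k' (opHd k' f) else f.
Fixpoint opJd k f : P := if k is k'.+1 then opJ t k' (opJd k' f) else f.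

Lemma lin_opHd k : (k <= m)%N -> lin (opHd k).
Proof.
elim: k => [|k IH] km; first exact: lin_id.
exact: (lin_comp (lin_opH gen km) (IH (ltnW km))).
Qed.

Lemma inSp_opHd Q k f : row_closed Q -> (k <= m)%N -> inSp Q f -> inSp Q (opHd k f).
Proof.
move=> HQ; elim: k => [|k IH] km Hf //=.
by apply: inSp_opH => //; exact: IH (ltnW km) Hf.
Qed.

Lemma opHd_opY k f : (k <= m)%N ->
  opHd k (opY q t 0 f) = opY q t k (opJd k f).
Proof.
elim: k => [|k IH] km //=; rewrite IH ?(ltnW km) // {1}/opY opK_step //.
by rewrite (linZ _ _ (lin_opH gen km)) (opHJ gen) // scalerA mulVf // scale1r.
Qed.

Lemma opC_opJd k f : (k <= m)%N -> opC t k (opJd k f) = t ^+ k *: f.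
Proof.
elim: k f => [|k IH] f km /=; first by rewrite scale1r.
rewrite (opHJ gen) // (linZ _ _ (lin_opC gen (ltnW km))) IH ?(ltnW km) //.
by rewrite scalerA exprS.
Qed.

(** By [opHd_opY], Pi = H_{m-1} ... H_0 Y_0 as operators, and [E w] is an eigenvector of Y_0. This
    expresses Pi through operators whose action on rows is already controlled. *)
Lemma opPi_E w :
  opPi q (E w) = (sp w ord0)^-1 *: opHd m (E w).
Proof.
have -> : ord0 = inord 0 :> 'I_m.+1 by apply: val_inj; rewrite /= inordK.
rewrite -(linZ _ _ (lin_opHd (leqnn m))) -(opY_E gen fam) // opHd_opY //.
rewrite /opY subnn /= opY0E opC_opJd // (linZ _ _ (lin_opPi q (m := m))) scalerA.
by rewrite mulVf ?scale1r // expf_neq0.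
Qed.

Lemma inSp_opZ Q j f : row_closed Q -> (j <= m)%N -> inSp Q f ->
  inSp Q (opZ gen j f).
Proof.
move=> HQ jm; rewrite -(subKn jm); move: (m - j)%N (leq_subr j m) f => d {jm j}.
elim: d => [|d IH] dm f Hf.
  rewrite subn0; apply: inSp_op Hf; first exact: (lin_opZ gen).
  move=> u Qu; have [u0|[w uw]] := Phi_cases u.
    by rewrite (opZ_max_E0 gen fam) //; exact: inSp0.
  move: Qu; rewrite uw => Qu; have [c ->] := opZ_max_EPhi gen fam w.
  apply: inSpZ; rewrite opPi_E; apply: inSpZ; apply: inSp_opHd => //.
  by apply: inSp_E; case: HQ => _; apply.
have jm : (m - d.+1 < m)%N by lia.
rewrite /opZ opK_step // (_ : (m - d.+1).+1 = m - d)%N; last lia.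
apply: inSpZ; apply: inSp_opJ => //; apply: IH; first exact: ltnW.
exact: inSp_opJ.
Qed.

Lemma inSp_opX Q s j f : row_closed Q -> (j <= m)%N -> inSp Q f ->
  inSp Q (opX gen s j f).
Proof.
move=> HQ jm Hf; rewrite opXE; apply: inSpD; first exact: inSp_opY.
by apply: inSpZ; exact: inSp_opZ.
Qed.

(** F(p), and T below, are taken over a list of indices so that the product can be split and its
    factors moved. *)
Definition opF (s p : K) (l : seq nat) f : P :=
  foldr (fun j g => opX gen s j g - p *: g) f l.

Definition opT (s : K) (l : seq nat) f : P :=
  foldr (fun j g => g + s *: opZ gen j g) f l.

Notation le_m l := (all (fun j => j <= m)%N l).

Lemma lin_opF s p l : lin (opF s p l).
Proof.
elim: l => [|j l IH] c f g //=.
rewrite IH (lin_opX gen) scalerDr scalerBr opprD addrACA.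
by rewrite [p *: (c *: _)]scalerA mulrC -scalerA.
Qed.

Lemma inSp_opF Q s p l f : row_closed Q -> le_m l -> inSp Q f ->
  inSp Q (opF s p l f).
Proof.
move=> HQ + Hf; elim: l => [|j l IH] //= /andP[jm lm].
rewrite addrC -scaleNr; apply: inSp_lin; first exact: IH.
by apply: inSp_opX => //; exact: IH.
Qed.

Lemma inSp_opT Q s l f : row_closed Q -> le_m l -> inSp Q f ->
  inSp Q (opT s l f).
Proof.
move=> HQ + Hf; elim: l => [|j l IH] //= /andP[jm lm].
by apply: inSpD; [|apply: inSpZ; apply: inSp_opZ => //]; exact: IH.
Qed.

Lemma opF_cat s p l1 l2 f : opF s p (l1 ++ l2) f = opF s p l1 (opF s p l2 f).
Proof. exact: foldr_cat. Qed.

Lemma opF_rcons c p j l f : c != 0 -> (j <= m)%N -> le_m l ->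
  opF c^-1 p (j :: l) f = opF c^-1 p l (opX gen c^-1 j f - p *: f).
Proof.
move=> c0 jm; elim: l => [|k l IH] //= /andP[km lm].
rewrite -IH //=; set g := opF _ _ _ _.
have lX a := @lin_opX K m q t gen c^-1 a.
rewrite !(linB _ _ (lX _)) !(linZ _ _ (lX _)) (opX_comm gen fam) //.
rewrite !scalerBr !opprB; set a := opX _ _ _ _; set b := p *: opX _ _ _ _.
by rewrite addrACA [RHS]addrACA; congr (_ + _); rewrite addrC.
Qed.

Lemma opF_opHd c p l k f : c != 0 -> le_m l -> (k <= m)%N ->
  all (fun j => k < j)%N l ->
  opF c^-1 p l (opHd k f) = opHd k (opF c^-1 p l f).
Proof.
move=> c0 + km; elim: l => [|j l IH] //= /andP[jm lm] /andP[kj kl].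
rewrite IH // (linB _ _ (lin_opHd km)) (linZ _ _ (lin_opHd km)); congr (_ - _).
move: (opF _ _ _ _) => g; elim: k km kj {IH kl} => [|k IHk] km kj //=.
rewrite -IHk ?(ltnW km) ?(ltnW kj) // !opHE (linD _ _ (lin_opX gen _ _)).
rewrite (linZ _ _ (lin_opX gen _ _)) (opX_opN_comm gen fam) //; lia.
Qed.

(** Z_m [E u] is a multiple of Pi [E w], hence of H_{m-1} ... H_0 [E w]. In each recursion step the
    inner J_j fixes [E u], its two parts being equal, and the outer one cancels the leading H_j. *)
Lemma opZ_run k u w : (k <= m)%N -> u = Phi w ->
  (forall i, (k <= i)%N -> u i = u ord_max) ->
  exists c, opZ gen k (E u) = c *: opHd k (E w).
Proof.
move=> km uw; rewrite -(subKn km); move: (m - k)%N (leq_subr k m) => d {km k}.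
elim: d => [|d IH] dm run.
  have [c Ec] := opZ_max_EPhi gen fam w.
  by exists (c / sp w ord0); rewrite subn0 uw Ec opPi_E scalerA.
have jm : (m - d.+1 < m)%N by lia.
have [|c] := IH (ltnW dm); first by move=> i di; apply: run; lia.
rewrite /opZ [in X in _ -> X]opK_step // (_ : m - d = (m - d.+1).+1)%N; last lia.
set j := (m - d.+1)%N => Ec; exists c.
have eqj : u (inord j) = u (inord j.+1).
  by rewrite !run // inordK //; lia.
have JE : opJ t j (E u) = E u.
  rewrite opJE (opN_E gen fam) // /swc (sw_id eqj) (kap_eq0 q t jm eqj).
  by rewrite oppr0 !mul0r !scale0r !addr0.
rewrite JE Ec (linZ _ _ (lin_opJ gen jm)) /= (opJH gen) // !scalerA.
by rewrite mulrAC mulVf // mul1r.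
Qed.

Definition le_rho u v := forall e, (rho v e <= rho u e)%N.
Definition lt_rho u e v := le_rho u v /\ (rho v e < rho u e)%N.

Lemma le_rho_closed u : row_closed (le_rho u).
Proof.
split=> [j v jm H e|w H e]; first by rewrite rho_sw.
by apply: leq_trans (H e); rewrite rho_Phi leq_addr.
Qed.

Lemma lt_rho_closed u e : row_closed (lt_rho u e).
Proof.
have [C1 C2] := le_rho_closed u; split=> [j v jm [H1 H2]|w [H1 H2]].
  by split; [exact: C1 | rewrite rho_sw].
by split; [exact: C2 | apply: leq_ltn_trans H2; rewrite rho_Phi leq_addr].
Qed.

(** Induction on the length of the final run of equal parts. The factors commute, so the one at k
    can act first: Y_k cancels p and c^-1 Z_k remains, giving a Hecke word on [E w] with u =
    [Phi w]. In w the run starts at k + 1, is one shorter, and has the same rank and spectral value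
    there; the other factors commute with the word. For a run of one entry, passing to w removes a
    cell of its row. *)
Lemma opF_run c k u : c != 0 -> (k <= m)%N ->
  (forall i, (k <= i)%N -> u i = u ord_max) ->
  inSp (lt_rho u (krank_ord u (inord k)))
    (opF c^-1 (sp u (inord k))^-1 (iota k (m.+1 - k)) (E u)).
Proof.
move=> c0 km; rewrite -(subKn km); move: (m - k)%N (leq_subr k m) => d {km k}.
elim: d u => [|d IH] u dm run.
  rewrite subn0 (_ : m.+1 - m = 1)%N /=; last lia.
  rewrite opXE (opY_E gen fam) // addrAC subrr add0r; apply: inSpZ.
  have [u0|[w uw]] := Phi_cases u; first by rewrite (opZ_max_E0 gen fam) //; exact: inSp0.
  have [|c' ->] := @opZ_run m u w (leqnn m) uw; first by move=> i mi; apply: run; lia.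
  apply: inSpZ; apply: inSp_opHd => //; first exact: lt_rho_closed.
  apply: inSp_E; split=> [e|]; first by rewrite uw rho_Phi leq_addr.
  rewrite uw inord_max rho_Phi (_ : krank_ord _ _ = krank_ord w ord0) ?eqxx ?addn1 //.
  by apply: val_inj; rewrite /= krank_Phi crot_max.
set k := (m - d.+1)%N; have km : (k < m)%N by rewrite /k; lia.
have kE : (m - d)%N = k.+1 by rewrite /k; lia.
have sE : (m.+1 - k = (m.+1 - k.+1).+1)%N by rewrite /k; lia.
have kle : (k <= m)%N := ltnW km.
have lm : le_m (iota k.+1 (m.+1 - k.+1)).
  by apply/allP => j; rewrite mem_iota; lia.
rewrite sE [iota _ _]/= opF_rcons // opXE (opY_E gen fam) //.
rewrite addrAC subrr add0r; move: (lin_opF c^-1 (sp u (inord k))^-1 (iota k.+1 (m.+1 - k.+1))) => lF.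
rewrite (linZ _ _ lF); apply: inSpZ.
have [u0|[w uw]] := Phi_cases u.
  suff -> : opZ gen k (E u) = 0 by rewrite (lin0 lF); exact: inSp0.
  have Z0 d' : (d' <= d.+1)%N -> opZ gen (m - d') (E u) = 0.
    elim: d' => [|d' IHd'] dd; first by rewrite subn0 (opZ_max_E0 gen fam).
    have jm : (m - d'.+1 < m)%N by lia.
    rewrite /opZ opK_step // (_ : (m - d'.+1).+1 = m - d')%N; last lia.
    have eqj : u (inord (m - d'.+1)) = u (inord (m - d'.+1).+1).
      by rewrite !run // inordK //; lia.
    have -> : opJ t (m - d'.+1) (E u) = E u.
      rewrite opJE (opN_E gen fam) // /swc (sw_id eqj) (kap_eq0 q t jm eqj).
      by rewrite oppr0 !mul0r !scale0r !addr0.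
    have := IHd' (ltnW dd); rewrite /opZ => ->.
    by rewrite (lin0 (lin_opJ gen jm)) scaler0.
  exact: Z0.
have [|c' ->] := @opZ_run k u w kle uw; first exact: run.
rewrite (linZ _ _ lF) opF_opHd //; last by apply/allP => j; rewrite mem_iota; lia.
apply: inSpZ; apply: inSp_opHd => //; first exact: lt_rho_closed.
have crE i : (i < m)%N -> crot m.+1 i = inord i.+1 :> 'I_m.+1.
  by move=> im; apply: val_inj; rewrite /= crotE // inordK // ltn_ord eqSS ltn_eqF.
have uE i : (i < m)%N -> u i = w (inord i.+1).
  by move=> im; rewrite uw PhikE crE // eqSS ltn_eqF // addn0.
have spE : sp u (inord k) = sp w (inord k.+1).
  rewrite uw sp_Phik ?leqnn //; last by move=> i; rewrite leqNgt ltn_ord.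
  by rewrite crE inordK ?eqSS ?ltn_eqF ?mul1r //; lia.
have krE : krank_ord u (inord k) = krank_ord w (inord k.+1).
  by apply: val_inj; rewrite /= uw krank_Phi crE inordK //; lia.
rewrite spE krE; apply: (@inSp_mono (lt_rho w (krank_ord w (inord k.+1)))).
  move=> v [H1 H2]; split=> [e|]; first by apply: leq_trans (H1 e) _; rewrite uw rho_Phi leq_addr.
  by apply: leq_trans H2 _; rewrite uw rho_Phi leq_addr.
rewrite -kE; apply: IH; first exact: ltnW.
move=> i ki; have im := ltn_ord i.
have W (i' : 'I_m.+1) : (k < i')%N -> w i' = u ord_max.
  move=> ki'; have im' := ltn_ord i'.
  have E1 : (inord i'.-1 : 'I_m.+1) = i'.-1 :> nat by rewrite inordK; lia.
  rewrite -(run (inord i'.-1)); last by rewrite E1 /=; lia.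
  rewrite uE E1; last by lia.
  by congr (w _); apply: val_inj; rewrite /= inordK //; lia.
by rewrite !W // ?ltn_ord //=; lia.
Qed.

Definition yrow u (e : 'I_m.+1) : K := (q ^+ rho u e * t ^+ e)^-1.

Definition lam u p : K := \prod_(e < m.+1) (yrow u e - p).

Lemma lamE u p : lam u p = \prod_(i < m.+1) ((sp u i)^-1 - p).
Proof.
rewrite /lam /yrow -(krank_reindex _ u (fun a b => (q ^+ a * t ^+ b)^-1 - p)).
by apply: eq_bigr => i _; rewrite spectralE.
Qed.

Notation all_m := (iota 0 m.+1).

Lemma opF_D c p u : c != 0 ->
  opF c^-1 p all_m (D N c u) = lam u p *: D N c u.
Proof.
move=> c0; rewrite lamE.
have -> : \prod_(i < m.+1) ((sp u i)^-1 - p) =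
    \prod_(j <- all_m) ((sp u (inord j))^-1 - p).
  by rewrite -[iota _ _]/(index_iota 0 m.+1) big_mkord; apply: eq_bigr => i _; rewrite inord_val.
have : le_m all_m by apply/allP => j; rewrite mem_iota; lia.
elim: (iota _ _) => [|j l IH] /=; first by rewrite big_nil scale1r.
move=> /andP[jm lm]; rewrite IH // (linZ _ _ (lin_opX gen _ _)) (opX_D gen fam) //.
by rewrite big_cons !scalerA -scalerBl mulrBl; congr ((_ - _) *: _); rewrite mulrC.
Qed.

(** The full product is symmetric: its eigenvalue depends only on row lengths, which a swap
    preserves. *)
Lemma opF_opN c p j f : c != 0 -> (j < m)%N ->
  opF c^-1 p all_m (opN t j f) = opN t j (opF c^-1 p all_m f).
Proof.
move=> c0 jm; have lN := lin_opN gen jm; have lF := lin_opF c^-1 p all_m.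
apply: (lin_ext gen fam c0 (lin_comp lF lN) (lin_comp lN lF)) => u.
rewrite -[LHS]/(opF c^-1 p all_m (opN t j (D N c u))).
rewrite -[RHS]/(opN t j (opF c^-1 p all_m (D N c u))).
have lsw : lam (sw j u) p = lam u p.
  by apply: eq_bigr => e _; rewrite /yrow rho_sw.
rewrite (opN_D gen fam) // lF (linZ _ _ lF) !opF_D // (linZ _ _ lN) (opN_D gen fam) //.
by rewrite lsw scalerDr !scalerA; congr (_ *: _ + _ *: _); rewrite mulrC.
Qed.

(** This provides the zeros in [gauge]. Swaps move the parts of size r to the end, where [opF_run]
    treats the factors from the place of row e on and the others lengthen no row. *)
Lemma opF_row c u e : c != 0 ->
  inSp (lt_rho u e) (opF c^-1 (yrow u e) all_m (E u)).
Proof.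
move=> c0; pose r := rho u e.
suff H : forall v, rho v e = r ->
    inSp (lt_rho v e) (opF c^-1 (q ^+ r * t ^+ e)^-1 all_m (E v)) by exact: H.
apply: (@sort_ind m (pred1 r) (fun v => rho v e = r ->
    inSp (lt_rho v e) (opF c^-1 (q ^+ r * t ^+ e)^-1 all_m (E v)))) => v.
  move=> Hv rv; have [i ei] := rho_surj v e.
  have vi : v i = r by rewrite -rho_krank -ei.
  have run (i' : 'I_m.+1) : (i <= i')%N -> v i' = v ord_max.
    have Hr (i2 : 'I_m.+1) : (i <= i2)%N -> v i2 = r.
      rewrite leq_eqVlt => /orP[/eqP/val_inj <- //|ii].
      by apply/eqP/(Hv i i2 ii); rewrite /= vi.
    by move=> ii; rewrite !Hr // -ltnS ltn_ord.
  have im : (i <= m)%N by rewrite -ltnS ltn_ord.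
  have := @opF_run c i v c0 im run.
  rewrite inord_val -ei spectralE vi (_ : krank v i = e); last by rewrite ei.
  have -> : all_m = iota 0 i ++ iota i (m.+1 - i).
    by rewrite -{2}[(i : nat)]add0n -iotaD subnKC // ltnW.
  rewrite opF_cat; apply: inSp_opF; first exact: lt_rho_closed.
  by apply/allP => j; rewrite mem_iota; lia.
move=> j jm /eqP vj vj1' IH rv.
have vj1 : v (inord j.+1) != r by [].
have ne : v (inord j) != v (inord j.+1) by rewrite vj eq_sym.
have {}IH := IH (etrans (rho_sw _ jm e) rv).
have nz : swc q t N j (sw j v) != 0.
  rewrite /swc swK; apply: mulf_neq0; last by rewrite invr_eq0 (diagN_neq0 gen fam).
  by rewrite mulf_neq0 ?(diagN_neq0 gen fam) // (kap_neq0 gen).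
(* [E v] is recovered from [E (sw j v)] by [opN], which commutes with the full product. *)
have := opN_E gen fam (sw j v) jm; rewrite swK => EN.
have -> : E v = (swc q t N j (sw j v))^-1 *:
    (kap q t j (sw j v) *: E (sw j v) + opN t j (E (sw j v))).
  by rewrite EN scaleNr addNKr scalerA mulVf // scale1r.
have lF := lin_opF c^-1 (q ^+ r * t ^+ e)^-1 all_m.
rewrite (linZ _ _ lF) lF opF_opN //; apply: inSpZ.
apply: (@inSp_mono (lt_rho (sw j v) e)).
  move=> w [H1 H2]; split=> [e'|]; last by rewrite -(rho_sw v jm).
  by rewrite -(rho_sw v jm).
by apply: inSp_lin => //; apply: inSp_opN => //; exact: lt_rho_closed.
Qed.

End Rows.

(** * Matrix entries of F(p) as polynomials in p *)

Section Gauge.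

Variables (K : fieldType) (m : nat) (q t : K).
Hypothesis gen : generic_qt q t.
Implicit Types (u v w : 'X_{1..m.+1}) (x : 'I_m.+1) (i j k d e r : nat).
Implicit Types (f g h : {mpoly K[m.+1]}).

Notation P := {mpoly K[m.+1]}.
Notation pr d := (pihomog mdeg d).
Notation opF := (opF gen).
Notation opT := (opT gen).

(** F has degree at most [r] in p and [a] is its coefficient of p^r, possibly zero. *)
Definition pol r (F : K -> P) (a : P) : Prop :=
  exists2 b : nat -> P, forall p, F p = \sum_(i < r.+1) p ^+ i *: b i & b r = a.

Lemma pol0 r : pol r (fun=> 0) 0.
Proof.
by exists (fun=> 0) => // p; rewrite big1 // => i _; rewrite scaler0.
Qed.

Lemma pol_const f : pol 0 (fun=> f) f.
Proof. by exists (fun=> f) => // p; rewrite big_ord1 scale1r. Qed.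

Lemma pol_ext r F G a b : F =1 G -> a = b -> pol r F a -> pol r G b.
Proof. by move=> E <- [c Hc <-]; exists c => // p; rewrite -E. Qed.

Lemma pol_widen r F a : pol r F a -> pol r.+1 F 0.
Proof.
case=> b Hb _; exists (fun i => if i == r.+1 then 0 else b i); last by rewrite eqxx.
move=> p; rewrite Hb [RHS]big_ord_recr /= eqxx scaler0 addr0.
by apply: eq_bigr => i _; rewrite ltn_eqF.
Qed.

Lemma pol_shift r F a : pol r F a -> pol r.+1 (fun p => p *: F p) a.
Proof.
case=> b Hb Hr; exists (fun i => if i is i'.+1 then b i' else 0) => //.
move=> p; rewrite Hb [RHS]big_ord_recl /= scaler0 add0r scaler_sumr.
by apply: eq_bigr => i _; rewrite scalerA -exprS.
Qed.

Lemma pol_lin r A F a : lin A -> pol r F a -> pol r (fun p => A (F p)) (A a).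
Proof.
move=> lA [b Hb <-]; exists (fun i => A (b i)) => // p.
by rewrite Hb lin_sum //; apply: eq_bigr => i _; rewrite linZ.
Qed.

Lemma pol_comb r c F G a b : pol r F a -> pol r G b ->
  pol r (fun p => c *: F p + G p) (c *: a + b).
Proof.
move=> [a' Ha <-] [b' Hb <-]; exists (fun i => c *: a' i + b' i) => // p.
rewrite Ha Hb scaler_sumr -big_split; apply: eq_bigr => i _ /=.
by rewrite scalerDr !scalerA mulrC.
Qed.

Lemma pr_opF_step s p j l d f :
  pr d (opF s p (j :: l) f) = opY q t j (pr d (opF s p l f))
    - p *: pr d (opF s p l f) + s *: opZ gen j (pr d.+1 (opF s p l f)).
Proof.
rewrite -[opF s p (j :: l) f]/(opX gen s j (opF s p l f) - p *: opF s p l f).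
rewrite opXE linearB linearD !linearZ /= (graded_opY gen) (graded_opZ gen).
by rewrite addrAC.
Qed.

Lemma pr_opT_step s j l d f :
  pr d (opT s (j :: l) f) = pr d (opT s l f) + s *: opZ gen j (pr d.+1 (opT s l f)).
Proof.
rewrite -[opT s (j :: l) f]/(opT s l f + s *: opZ gen j (opT s l f)).
by rewrite linearD linearZ /= (graded_opZ gen).
Qed.

(** Passing from degree d to degree e uses exactly d - e factors [s *: opZ]. Each other factor
    contributes Y_j - p, whose leading term -p stands where the product for [opT] has 1. *)
Lemma opF_pol s l d f e : f \is d.-homog ->
  [/\ (d < e)%N -> (forall p, pr e (opF s p l f) = 0) /\ pr e (opT s l f) = 0,
      (e + size l < d)%N -> (forall p, pr e (opF s p l f) = 0) /\ pr e (opT s l f) = 0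
    & (e <= d <= e + size l)%N ->
      pol (e + size l - d) (fun p => pr e (opF s p l f))
        ((-1) ^+ (e + size l - d) *: pr e (opT s l f))].
Proof.
move=> fd; elim: l e => [|j l IH] e.
  rewrite /= addn0; split=> H.
  - by rewrite (pihomog_ne0 _ fd) // neq_ltn H.
  - by rewrite (pihomog_ne0 _ fd) // neq_ltn H orbT.
  - have -> : e = d by lia.
    by rewrite subnn expr0 scale1r; exact: pol_const.
have lY := @lin_opY K m q t gen j; have lZ := @lin_opZ K m q t gen j.
have Z0 d' : (forall p, pr d' (opF s p l f) = 0) /\ pr d' (opT s l f) = 0 ->
    (forall p, pr d'.+1 (opF s p l f) = 0) /\ pr d'.+1 (opT s l f) = 0 ->
    (forall p, pr d' (opF s p (j :: l) f) = 0) /\ pr d' (opT s (j :: l) f) = 0.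
  move=> [H1 H2] [H3 H4]; split=> [p|].
    by rewrite pr_opF_step H1 H3 (lin0 lY) (lin0 lZ) !scaler0 subr0 addr0.
  by rewrite pr_opT_step H2 H4 (lin0 lZ) scaler0 addr0.
have [A1 A2 A3] := IH e; have [B1 B2 B3] := IH e.+1.
rewrite [size _]/=; split=> H.
- by apply: Z0; [apply: A1 | apply: B1]; lia.
- by apply: Z0; [apply: A2 | apply: B2]; lia.
(* Here every factor must lower the degree, so only the Z branch survives and the entry is constant
   in p. *)
have [E|NE] := eqVneq d (e + size l).+1.
  have [H1 H2] := A2 (eq_leq (esym E)).
  have -> : (e + (size l).+1 - d = 0)%N by lia.

  have {}B3 : pol 0 (fun p => pr e.+1 (opF s p l f)) (pr e.+1 (opT s l f)).
    have := B3; rewrite (_ : e.+1 + size l - d = 0)%N; last lia.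
    by rewrite expr0 scale1r; apply; lia.
  apply: pol_ext (pol_comb s (pol_lin lZ B3) (pol0 0)).
    by move=> p; rewrite pr_opF_step H1 (lin0 lY) scaler0 subr0 add0r addr0.
  by rewrite pr_opT_step H2 add0r addr0 expr0 scale1r.
have {}A3 := A3 (_ : (e <= d <= e + size l)%N); have {}A3 := A3 ltac:(lia).
set r := (e + size l - d)%N in A3.
have -> : (e + (size l).+1 - d = r.+1)%N by rewrite /r; lia.
have {}B3 : pol r.+1 (fun p => pr e.+1 (opF s p l f))
    ((-1) ^+ r.+1 *: pr e.+1 (opT s l f)).
  have [de|ed] := leqP e.+1 d.
    have := B3; rewrite (_ : e.+1 + size l - d = r.+1)%N; last by rewrite /r; lia.
    by apply; lia.
  have [H1 H2] := B1 ed; apply: pol_ext (pol0 r.+1) => [p|]; first by rewrite H1.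
  by rewrite H2 scaler0.
apply: pol_ext (pol_comb s (pol_lin lZ B3)
  (pol_comb (-1) (pol_shift A3) (pol_widen (pol_lin lY A3)))).
  move=> p; rewrite pr_opF_step addrC; congr (_ + _).
  by rewrite scaleN1r addrC.
rewrite pr_opT_step addr0 (linZ _ _ lZ) scaleN1r scalerDr addrC exprS mulN1r.
by rewrite !scaleNr; congr (_ + _); rewrite ?scalerN !scalerA // mulrC.
Qed.

Variable N : 'X_{1..m.+1} -> P.
Hypothesis fam : interp_family q t N.

Notation E := (Etop N).
Notation coE := (cE q t N).
Notation all_m := (iota 0 m.+1).

Lemma cE_pr f v : coE (pr (mdeg v) f) v = coE f v.
Proof. by rewrite /cE pr_pr eqxx. Qed.

Definition hrow p r x : K := \prod_(j < r) ((q ^+ j.+1 * t ^+ x)^-1 - p).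

(** A product over cells, arranged so that adding the last cell of a row multiplies it by the factor
    of that row in [lam]. *)
Definition hprod p u : K := \prod_(x < m.+1) hrow p (rho u x) x.

Lemma mdeg_rho u : mdeg u = \sum_(x < m.+1) rho u x.
Proof. by rewrite mdegE -(krank_reindex _ u (fun a b => a)). Qed.

Lemma yrow_inj u : injective (yrow q t u).
Proof.
by move=> x x' /invr_inj /(gen_eq gen) [_ /val_inj].
Qed.

Lemma le_m_all : all (fun j => j <= m)%N all_m.
Proof. by apply/allP => j; rewrite mem_iota; lia. Qed.

(* As a polynomial in p, the left matrix entry has degree at most n - k for
   k = |u| - |v|, and it vanishes at yrow u x for every common row x, so it is
   determined by its leading coefficient. *)
Lemma gauge c p u v : c != 0 ->
  hprod p u * coE (opF c^-1 p all_m (E u)) v =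
  lam q t u p * hprod p v * coE (opT c^-1 all_m (E u)) v.
Proof.
move=> c0; have lm := le_m_all.
(* Neither F nor T lengthens a row, so otherwise both entries vanish. *)
have [le_uv|] := boolP [forall x, rho v x <= rho u x]%N; last first.
  rewrite negb_forall => /existsP[x nle].
  have Z f : inSp q t N (le_rho u) f -> coE f v = 0.
    by move=> Hf; apply/eqP; apply: contraNT nle => /Hf /(_ x).
  have Eu : inSp q t N (le_rho u) (E u) by apply: (inSp_E gen fam) => y.
  rewrite (Z (opF c^-1 p all_m (E u))) ?(Z (opT c^-1 all_m (E u))) ?mulr0 //.
    by apply: (inSp_opT fam) => //; exact: le_rho_closed.
  by apply: (inSp_opF fam) => //; exact: le_rho_closed.
have {}le_uv x := forallP le_uv x.
have Eh : E u \is (mdeg u).-homog by exact: pihomogP.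
have [_ H2 H3] := opF_pol c^-1 all_m (mdeg v) Eh.
rewrite size_iota in H2 H3.
pose S := [set x | rho v x == rho u x].
have sumD : (mdeg v + \sum_(x < m.+1) (rho u x - rho v x) = mdeg u)%N.
  by rewrite !mdeg_rho -big_split; apply: eq_bigr => x _; rewrite /= subnKC.
have cardS : (m.+1 - #|S| = \sum_(x < m.+1) (x \notin S))%N.
  transitivity #|~: S|; first by rewrite [RHS]cardsCs setCK card_ord.
  rewrite -sum1_card big_mkcond /=; apply: eq_bigr => x _.
  by rewrite in_setC; case: (x \in S).
have sumS : (m.+1 - #|S| <= \sum_(x < m.+1) (rho u x - rho v x))%N.
  rewrite cardS; apply: leq_sum => x _; rewrite inE; have := le_uv x.
  by case: eqP => //=; lia.
have [small|big] := ltnP (mdeg v + m.+1) (mdeg u).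
  have [Z1 Z2] := H2 small.
  by rewrite -cE_pr Z1 -[X in _ = _ * X]cE_pr Z2 (cE0 gen fam) !mulr0.
have [b Hb lead] := H3 ltac:(lia).
set r := (mdeg v + m.+1 - mdeg u)%N in b Hb lead.
pose T0 := coE (opT c^-1 all_m (E u)) v.
pose Q : {poly K} := \poly_(i < r.+1) coE (b i) v.
have QE y : coE (opF c^-1 y all_m (E u)) v = Q.[y].
  rewrite -cE_pr Hb (cE_sum gen fam) horner_poly; apply: eq_bigr => i _.
  by rewrite (cEZ gen fam) mulrC.
have Qr : Q`_r = (-1) ^+ r * T0.
  by rewrite coef_poly ltnSn lead (cEZ gen fam) cE_pr.
rewrite QE -/T0.
have [Q0|nzQ] := eqVneq Q 0.
  move/eqP: Qr; rewrite Q0 coef0 horner0 eq_sym mulf_eq0 signr_eq0 /= => /eqP ->.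
  by rewrite !mulr0.
pose rs := [seq yrow q t u x | x <- enum S].
have rs_root : all (root Q) rs.
  apply/allP => y /mapP[x]; rewrite mem_enum inE => /eqP xS ->.
  rewrite /root -QE; apply/negPn/negP => /(opF_row fam c0)[_].
  by rewrite xS ltnn.
have rs_uniq : uniq rs by rewrite map_inj_uniq ?enum_uniq //; exact: yrow_inj.
have sz_rs : size rs = #|S| by rewrite size_map -cardE.
have lt_rs : (#|S| < size Q)%N.
  by rewrite -sz_rs; apply: max_poly_roots.
have le_Q : (size Q <= r.+1)%N by exact: size_poly.
have S_le : (#|S| <= m.+1)%N by rewrite -[X in (_ <= X)%N](card_ord m.+1) max_card.
(* Counting cells gives r <= #|S|, and a nonzero Q of degree at most r has #|S| distinct roots. *)
have rS : r = #|S| by rewrite /r; lia.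
have szQ : size Q = r.+1 by lia.
have QP : Q = lead_coef Q *: \prod_(y <- rs) ('X - y%:P).
  by apply: all_roots_prod_XsubC; rewrite ?sz_rs ?uniq_rootsE // -rS.
(* As many cells are lost as there are rows that differ, so each of these loses exactly one. *)
have one x : x \notin S -> rho u x = (rho v x).+1.
  move=> xS; have eqS : (\sum_(y < m.+1) (rho u y - rho v y) = \sum_(y < m.+1) (y \notin S))%N.
    by rewrite -cardS; apply/eqP; rewrite eqn_leq sumS andbT; lia.
  have leS y : ((y \notin S : nat) <= rho u y - rho v y)%N.
    by rewrite inE; have := le_uv y; case: eqP => //=; lia.
  have := eqS; rewrite (bigD1 x) //= [RHS](bigD1 x) //= xS => E1.
  have : (\sum_(y < m.+1 | y != x) (y \notin S) <= \sum_(y < m.+1 | y != x) (rho u y - rho v y))%N.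
    by apply: leq_sum => y _; exact: leS.
  move: (leS x) E1; rewrite xS; clear.
  move: (\sum_(y < m.+1 | y != x) (rho u y - rho v y))%N.
  move: (\sum_(y < m.+1 | y != x) (y \notin S))%N.
  move: (rho u x) (rho v x) => A B X Y /=; rewrite add1n => AB1 E1 XY.
  have {}AB1 : (0 < A - B)%N by [].
  lia.
rewrite QP hornerZ horner_prod big_map big_enum /= lead_coefE szQ /= Qr.
have -> : \prod_(x in S) ('X - (yrow q t u x)%:P).[p] =
    (-1) ^+ r * \prod_(x in S) (yrow q t u x - p).
  rewrite rS -prodrN; apply: eq_bigr => x _.
  by rewrite hornerXsubC opprB.
rewrite mulrACA -expr2 sqrr_sign mul1r [T0 * _]mulrC mulrA; congr (_ * T0).
rewrite [X in _ * X = _]big_mkcond /lam /hprod -[LHS]big_split -[RHS]big_split.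
apply: eq_bigr => x _ /=.
case: ifP => [|/negbT /one ux].
  by rewrite inE => /eqP ->; rewrite mulrC.
rewrite mulr1 /hrow ux big_ord_recr /= mulrC; congr (_ * _).
by rewrite /yrow ux.
Qed.

End Gauge.

(** * Diagonal operators and the star-triangle relation *)

Section Blocks.

Variables (K : fieldType) (m : nat) (q t : K).
Hypothesis gen : generic_qt q t.
Implicit Types (u v w : 'X_{1..m.+1}) (x : 'I_m.+1) (i j k l d : nat).
Implicit Types (f g h : {mpoly K[m.+1]}) (a b c : K).

Notation P := {mpoly K[m.+1]}.
Notation po := (qpochc q t).
Notation all_m := (iota 0 m.+1).

Let t0 : t != 0 := gen_t0 gen.

Let q0 : q != 0 := gen_q0 gen.

Lemma rho_mono u (x x' : 'I_m.+1) : (x <= x')%N -> (rho u x <= rho u x')%N.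
Proof.
have [i ->] := rho_surj u x; have [i' ->] := rho_surj u x'.
rewrite !rho_krank /= leqNgt => H; rewrite leqNgt; apply: contra H => ii.
by apply: krank_lt; rewrite /below ii.
Qed.

Lemma sort_rho u : sort geq u = [seq rho u (rev_ord x) | x <- enum 'I_m.+1].
Proof.
have geq_trans : transitive geq by move=> y x z /= xy yz; exact: leq_trans yz xy.
have geq_anti : antisymmetric geq.
  by move=> x y /= /andP[xy yx]; apply/eqP; rewrite eqn_leq xy yx.
apply: (sorted_eq geq_trans geq_anti).
- by apply: sort_sorted => x y; exact: leq_total.
- rewrite sorted_map; apply: (@sub_sorted _ (fun x y : 'I_m.+1 => (x <= y)%N)).
    by move=> x y xy /=; apply: rho_mono; rewrite /=; lia.
  have := iota_sorted 0 m.+1; rewrite -val_enum_ord sorted_map.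
  exact.
rewrite perm_sort.
have -> : (u : seq nat) = [seq u (i : 'I_m.+1) | i : 'I_m.+1 <- enum 'I_m.+1].
  by rewrite -[LHS](map_tnth_enum u).
have -> : [seq u (i : 'I_m.+1) | i : 'I_m.+1 <- enum 'I_m.+1] =
    [seq rho u (rev_ord x) | x <- [seq rev_ord (krank_ord u i) | i : 'I_m.+1 <- enum 'I_m.+1]].
  by rewrite -map_comp; apply: eq_map => i /=; rewrite rev_ordK rho_krank.
apply: perm_map; apply: uniq_perm.
- rewrite map_inj_uniq ?enum_uniq // => i i' /rev_ord_inj.
  exact: krank_ord_inj.
- exact: enum_uniq.
move=> x; rewrite mem_enum; apply/mapP.
have [i Ei] := rho_surj u (rev_ord x); exists i; first by rewrite mem_enum.
by rewrite -Ei rev_ordK.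
Qed.

Lemma qpochcE b u : po b u = \prod_(x < m.+1) qpoch q (b * t ^- (m - x)) (rho u x).
Proof.
rewrite /qpochc [RHS](reindex_inj rev_ord_inj) /=; apply: eq_bigr => x _.
rewrite sort_rho (nth_map ord0) ?size_enum_ord // nth_ord_enum.
by congr (qpoch q (b * t ^- _) _); have := ltn_ord x; lia.
Qed.

Definition good b := forall v : 'X_{1..m.+1}, po b v != 0.

Lemma goodP b :
  good b <-> forall k (x : 'I_m.+1), 1 - b * t ^- (m - x) * q ^+ k != 0.
Proof.
split=> [H k x|H v]; last first.
  rewrite qpochcE; apply/prodf_neq0 => x _; apply/prodf_neq0 => i _; exact: H.
(* The rectangle with all parts k + 1 contains the factor of index k in every row. *)
have := H [multinom k.+1 | i < m.+1].
rewrite qpochcE => /prodf_neq0 /(_ x isT) /prodf_neq0.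
have -> : rho [multinom k.+1 | i < m.+1] x = k.+1 by rewrite /rho mnmE.
by move/(_ ord_max isT).
Qed.

Lemma good_shift b k : good b -> good (q ^+ k * b).
Proof.
move=> /goodP H; apply/goodP => l x.
by have := H (k + l)%N x; rewrite exprD mulrA; congr (1 - _ != 0); ring.
Qed.

(** The value of [hprod] at p = 0, the part independent of b; it cancels between consecutive
    factors. *)
Definition theta u : K :=
  \prod_(x < m.+1) \prod_(j < rho u x) (q ^+ j.+1 * t ^+ x)^-1.

Lemma theta_neq0 u : theta u != 0.
Proof.
apply/prodf_neq0 => x _; apply/prodf_neq0 => j _.
by rewrite invr_eq0 mulf_neq0 // expf_neq0.
Qed.

Lemma texp x : t ^+ x * t ^- m = t ^- (m - x).
Proof.
have xm : (x <= m)%N by rewrite -ltnS ltn_ord.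
have -> : t ^- m = t ^- (m - x) * t ^- x by rewrite -invfM -exprD subnK.
by rewrite mulrCA mulfV ?mulr1 // expf_neq0.
Qed.

Lemma hprodE b u : hprod q t (b * t ^- m) u = theta u * po (q * b) u.
Proof.
rewrite qpochcE /hprod /theta -big_split; apply: eq_bigr => x _ /=.
rewrite /hrow /qpoch -big_split; apply: eq_bigr => j _ /=.
rewrite -texp mulrBr mulr1; congr (_ - _); rewrite exprS.
by field; rewrite q0 !expf_neq0.
Qed.

Lemma qpochS b k : qpoch q b k * (1 - b * q ^+ k) = (1 - b) * qpoch q (q * b) k.
Proof.
rewrite /qpoch; transitivity (\prod_(i < k.+1) (1 - b * q ^+ i)).
  by rewrite big_ord_recr.
rewrite big_ord_recl /= mulr1; congr (_ * _); apply: eq_bigr => i _.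
by rewrite /bump leq0n add1n exprS; congr (1 - _); ring.
Qed.

Definition lam0 b : K := lam q t (0%MM : 'X_{1..m.+1}) (b * t ^- m).

(** Row by row, (b)_k (1 - b q^k) = (1 - b) (qb)_k. The choice p = b t^-m turns the row labelled x
    into the parameter b t^-(m - x) of [qpochcE]. *)
Lemma lamE_po b u :
  lam q t u (b * t ^- m) * po b u = lam0 b * q ^- mdeg u * po (q * b) u.
Proof.
rewrite !qpochcE /lam0 /lam mdeg_rho -prodrXr -prodfV -!big_split.
apply: eq_bigr => x _ /=; rewrite /yrow.
have -> : rho (0%MM : 'X_{1..m.+1}) x = 0%N by rewrite /rho mnm0E.
set r := rho u x; set b' := b * t ^- (m - x).
have Eb : q * b * t ^- (m - x) = q * b' by rewrite mulrA.
have F k : (q ^+ k * t ^+ x)^-1 - b * t ^- m =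
    (q ^+ k * t ^+ x)^-1 * (1 - b' * q ^+ k).
  rewrite /b' -texp; field; by rewrite !expf_neq0.
have -> : (q ^+ r * t ^+ x)^-1 - b * t ^- m = (q ^+ r * t ^+ x)^-1 * (1 - b' * q ^+ r).
  exact: F.
rewrite (F 0%N) expr0 mulr1 mul1r Eb invfM.
have := qpochS b' r; set A := qpoch _ _ _; set B := qpoch _ _ _ => E.
rewrite -[LHS]mulrA [_ * A]mulrC E; ring.
Qed.

Lemma lam0_neq0 b : good b -> lam0 b != 0.
Proof.
move=> /goodP H; apply/prodf_neq0 => x _; rewrite /yrow.
have -> : rho (0%MM : 'X_{1..m.+1}) x = 0%N by rewrite /rho mnm0E.
have := H 0%N x; rewrite -texp => nz.
have -> : (q ^+ 0 * t ^+ x)^-1 - b * t ^- m =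
    (t ^+ x)^-1 * (1 - b * (t ^+ x * t ^- m) * q ^+ 0).
  by rewrite !expr0; field; rewrite !expf_neq0.
by rewrite mulf_neq0 // invr_eq0 expf_neq0.
Qed.

Variable N : 'X_{1..m.+1} -> P.
Hypothesis fam : interp_family q t N.

Notation E := (Etop N).
Notation coE := (cE q t N).
Notation hop := (hop q t N).
Notation T s := (opT gen s all_m).

Lemma lin_opT s (l : seq nat) : lin (opT gen s l : P -> P).
Proof.
elim: l => [|j l IH] c f g //=.
by rewrite IH (lin_opZ gen) !scalerDr !scalerA [s * c]mulrC addrACA.
Qed.

Lemma opT_opZ s (l : seq nat) j f : all (fun k => k <= m)%N l -> (j <= m)%N ->
  opT gen s l (opZ gen j f) = opZ gen j (opT gen s l f).
Proof.
move=> + jm; elim: l => [|k l IH] //= /andP[km lm].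
rewrite IH // (linD _ _ (lin_opZ gen j)) (linZ _ _ (lin_opZ gen j)).
by rewrite (opZ_comm gen fam).
Qed.

Lemma opT_comm s s' (l : seq nat) f : all (fun k => k <= m)%N l ->
  T s (opT gen s' l f) = opT gen s' l (T s f).
Proof.
elim: l => [|j l IH] // /andP[jm lm].
have lT := lin_opT s all_m.
rewrite -[LHS]/(T s (opT gen s' l f + s' *: opZ gen j (opT gen s' l f))).
rewrite -[RHS]/(opT gen s' l (T s f) + s' *: opZ gen j (opT gen s' l (T s f))).
by rewrite (linD _ _ lT) (linZ _ _ lT) opT_opZ ?(le_m_all m) // IH.
Qed.

Lemma dil_opT c s (l : seq nat) f : c != 0 ->
  dilate c (opT gen s l f) = opT gen (s / c) l (dilate c f).
Proof.
move=> c0; elim: l => [|j l IH] //=.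
rewrite (linD _ _ (lin_dil c)) (linZ _ _ (lin_dil c)) (dil_opZ gen) //.
by rewrite IH scalerA.
Qed.

(** T_s T_{qs} ... T_{q^(k-1) s}: what a product of k operators [opL] leaves once the dilations have
    been moved to the right. *)
Fixpoint opTs s k f : P := if k is k'.+1 then T s (opTs (q * s) k' f) else f.

Lemma opTs_add s k l f : opTs s (k + l) f = opTs s k (opTs (q ^+ k * s) l f).
Proof.
elim: k s => [|k IH] s; first by rewrite mul1r.
by rewrite addSn -[LHS]/(T s (opTs (q * s) (k + l) f)) IH mulrA -exprSr.
Qed.

Lemma opT_opTs s s' k f : T s (opTs s' k f) = opTs s' k (T s f).
Proof.
elim: k s' => [|k IH] s' //.
rewrite -[LHS]/(T s (T s' (opTs (q * s') k f))) (opT_comm _ _ _ (le_m_all m)).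
by rewrite IH.
Qed.

Lemma opTs_comm s k s' l f : opTs s k (opTs s' l f) = opTs s' l (opTs s k f).
Proof.
elim: k s => [|k IH] s //.
rewrite -[LHS]/(T s (opTs (q * s) k (opTs s' l f))) IH opT_opTs.
by [].
Qed.

Lemma dil_opTs s k f : dilate q^-1 (opTs s k f) = opTs (q * s) k (dilate q^-1 f).
Proof.
elim: k s => [|k IH] s //.
rewrite -[LHS]/(dilate q^-1 (T s (opTs (q * s) k f))).
by rewrite dil_opT ?invr_eq0 // invrK IH mulrC.
Qed.

Lemma dil_opTs_iter s k l f :
  dilate (q ^- l) (opTs s k f) = opTs (q ^+ l * s) k (dilate (q ^- l) f).
Proof.
elim: l => [|l IH]; first by rewrite invr1 !dil_1 mul1r.
by rewrite exprS invfM -!dil_dil IH dil_opTs mulrA.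
Qed.

Lemma hop_hop (phi psi : 'X_{1..m.+1} -> K) f :
  (forall u, phi u * psi u = 1) -> hop phi (hop psi f) = f.
Proof.
move=> H; apply: (cE_ext gen fam) => v.
by rewrite !(cE_hop gen fam) mulrA H mul1r.
Qed.

(** Scaled so that the eigenvalue at the empty composition is 1. *)
Definition opL s b f : P := (lam0 b)^-1 *: opF gen s (b * t ^- m) all_m f.

Lemma lin_opL s b : lin (opL s b).
Proof. apply: lin_scale; exact: lin_opF. Qed.

(** This is [gauge] with [lam] and [hprod] replaced by [lamE_po] and [hprodE]: on the input side
    (qb)_u cancels and 1/(b)_u is left, while q^(-|u|) is the dilation by [q^-1] of the homogeneous
    [E u]. *)
Lemma opLE c b f : c != 0 -> good b ->
  opL c^-1 b f = hop (fun u => theta u * po (q * b) u)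
    (T c^-1 (dilate q^-1 (hop (fun u => (theta u * po b u)^-1) f))).
Proof.
move=> c0 gb.
have gqb : good (q * b) by rewrite -[q]expr1; exact: good_shift.
have lR := lin_comp (lin_hop gen fam (fun u => theta u * po (q * b) u))
  (lin_comp (lin_opT c^-1 all_m) (lin_comp (lin_dil q^-1)
    (lin_hop gen fam (fun u => (theta u * po b u)^-1)))).
apply: (linE_ext gen fam (lin_opL c^-1 b) lR) => u; rewrite /comp.
rewrite (hop_E gen fam) (linZ _ _ (lin_dil _)) dil_E scalerA.
rewrite (linZ _ _ (lin_opT _ _)) (linZ _ _ (lin_hop gen fam _)).
apply: (cE_ext gen fam) => v.
rewrite /opL [LHS](cEZ gen fam) [RHS](cEZ gen fam) (cE_hop gen fam).
have G := gauge gen fam (b * t ^- m) u v c0.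
rewrite !hprodE in G; have L := lamE_po b u.
have l0 := lam0_neq0 gb; have th := theta_neq0 u.
have p1 := gb u; have p2 := gqb u; have qn : q ^+ mdeg u != 0 by rewrite expf_neq0.
move: G L; set x1 := coE _ _; set x2 := coE _ _; set A := theta v * _ => G L.
rewrite exprVn.
have {}L : lam q t u (b * t ^- m) = lam0 b * q ^- mdeg u * po (q * b) u / po b u.
  by rewrite -L mulfK.
have -> : x1 = (theta u * po (q * b) u)^-1 * (lam q t u (b * t ^- m) * A * x2).
  by rewrite -G mulKf // mulf_neq0.
by rewrite L; field; rewrite l0 p1 qn p2 th.
Qed.

Lemma opL_D c b u : c != 0 -> good b ->
  opL c^-1 b (D N c u) = (q ^- mdeg u * po (q * b) u / po b u) *: D N c u.
Proof.
move=> c0 gb; rewrite /opL (opF_D gen fam) // scalerA; congr (_ *: _).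
have -> : lam q t u (b * t ^- m) = lam0 b * q ^- mdeg u * po (q * b) u / po b u.
  by rewrite -lamE_po mulfK.
by rewrite -!mulrA mulKf // lam0_neq0.
Qed.

Fixpoint opLs s b k f : P :=
  if k is k'.+1 then opL s (q ^+ k' * b) (opLs s b k' f) else f.

Lemma lin_opLs s b k : lin (opLs s b k).
Proof.
elim: k => [|k IH]; first exact: lin_id.
exact: (lin_comp (lin_opL s (q ^+ k * b)) IH).
Qed.

(** The output diagonal of each factor is inverse to the input diagonal of the next, so only the two
    outermost remain. *)
Lemma opLsE c b k f : c != 0 -> good b ->
  opLs c^-1 b k f = hop (fun u => theta u * po (q ^+ k * b) u)
    (opTs c^-1 k (dilate (q ^- k) (hop (fun u => (theta u * po b u)^-1) f))).
Proof.
move=> c0 gb; elim: k => [|k IH].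
  rewrite /= invr1 dil_1 mul1r hop_hop // => u.
  by rewrite mulfV // mulf_neq0 ?theta_neq0 // gb.
have gk := good_shift k gb.
rewrite -[LHS]/(opL c^-1 (q ^+ k * b) (opLs c^-1 b k f)) opLE // IH hop_hop.
  by rewrite dil_opTs dil_dil -invfM -exprS mulrA -exprS.
by move=> u; rewrite mulVf // mulf_neq0 ?theta_neq0 // gk.
Qed.

(* D_a / D_b in terms of D_a = (a)_u a^(- |u|). *)
Definition yratio a b u : K := (b / a) ^+ mdeg u * po a u / po b u.

Lemma opLs_D c b k u : c != 0 -> b != 0 -> good b ->
  opLs c^-1 b k (D N c u) = yratio (q ^+ k * b) b u *: D N c u.
Proof.
move=> c0 b0 gb; elim: k => [|k IH].
  by rewrite /= /yratio mul1r divff // expr1n mul1r divff ?scale1r // gb.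
rewrite -[LHS]/(opL c^-1 (q ^+ k * b) (opLs c^-1 b k (D N c u))) IH.
rewrite (linZ _ _ (lin_opL _ _)) opL_D //; last exact: good_shift.
rewrite scalerA; congr (_ *: _); rewrite /yratio mulrA -exprS.
have p1 := good_shift k gb u; have p2 := gb u.
have X k' : (b / (q ^+ k' * b)) ^+ mdeg u = (q ^+ mdeg u) ^- k'.
  by rewrite invfM mulrCA divff // mulr1 exprVn exprAC.
rewrite !X; have : q ^+ mdeg u != 0 by rewrite expf_neq0.
move: (q ^+ mdeg u) => Q Q0; have Qk : Q ^+ k != 0 by rewrite expf_neq0.
by rewrite [Q ^+ k.+1]exprS; field; rewrite Q0 Qk p1 p2.
Qed.

(** After [opLsE] both sides have the same outer diagonals and the same dilation by q^-k. The T's on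
    either side have parameters q^i b^-1 for -l <= i < k - l, in different orders, and they
    commute. *)
Lemma star_triangle b k l f : b != 0 -> good b -> (l <= k)%N ->
  opLs b^-1 (q ^+ l * b) (k - l) (opLs (q ^+ k * b)^-1 b l f)
  = opLs (q ^+ l * b)^-1 b k f.
Proof.
move=> b0 gb lk; have gl := good_shift l gb.
have qb k' : q ^+ k' * b != 0 by rewrite mulf_neq0 // expf_neq0.
rewrite !opLsE // hop_hop; last first.
  by move=> u; rewrite mulVf // mulf_neq0 ?theta_neq0 // gl.
rewrite mulrA -exprD subnK // dil_opTs_iter dil_dil -invfM -exprD subnK //.
have -> : q ^+ (k - l) * (q ^+ k * b)^-1 = (q ^+ l * b)^-1.
  rewrite -{2}(subnK lk) exprD; field.
  by rewrite b0 !expf_neq0.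
set F := dilate _ _; rewrite opTs_comm -[X in _ = hop _ (opTs _ X _)](subnKC lk).
rewrite opTs_add; congr (hop _ (opTs _ _ (opTs _ _ _))).
by field; rewrite b0 expf_neq0.
Qed.

End Blocks.

(** * Rational functions on an admissible set *)

Section RationalFunctions.

Variables (K : fieldType) (S : K -> Prop).
Implicit Types (f g : K -> K).

(** [S] is the set where the identity is claimed: denominators must be nonzero on it, so agreement
    at infinitely many points of [S] extends to all of [S]. *)
Definition ratfun f := exists P Q : {poly K},
  forall x, S x -> Q.[x] != 0 /\ f x = P.[x] / Q.[x].

Lemma ratfun_cst c : ratfun (fun=> c).
Proof. by exists c%:P, 1 => x _; rewrite !hornerE divr1 oner_neq0. Qed.

Lemma ratfun_id : ratfun id.
Proof. by exists 'X, 1 => x _; rewrite !hornerE divr1 oner_neq0. Qed.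

Lemma ratfunD f g : ratfun f -> ratfun g -> ratfun (fun x => f x + g x).
Proof.
move=> [P1 [Q1 H1]] [P2 [Q2 H2]]; exists (P1 * Q2 + P2 * Q1), (Q1 * Q2) => x Sx.
have [n1 ->] := H1 x Sx; have [n2 ->] := H2 x Sx.
by rewrite !hornerE mulf_neq0 // addf_div.
Qed.

Lemma ratfunM f g : ratfun f -> ratfun g -> ratfun (fun x => f x * g x).
Proof.
move=> [P1 [Q1 H1]] [P2 [Q2 H2]]; exists (P1 * P2), (Q1 * Q2) => x Sx.
have [n1 ->] := H1 x Sx; have [n2 ->] := H2 x Sx.
by rewrite !hornerM mulf_neq0 // mulf_div.
Qed.

Lemma ratfunV f : (forall x, S x -> f x != 0) -> ratfun f -> ratfun (fun x => (f x)^-1).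
Proof.
move=> nz [P [Q H]]; exists Q, P => x Sx; have [n1 E] := H x Sx.
have := nz x Sx; rewrite E mulf_eq0 negb_or => /andP[-> _].
by rewrite invf_div.
Qed.

Lemma ratfun_prod (I : Type) (r : seq I) (F : I -> K -> K) :
  (forall i, ratfun (F i)) -> ratfun (fun x => \prod_(i <- r) F i x).
Proof.
move=> H; elim: r => [|i r [P [Q IH]]].
  by have [P [Q E]] := ratfun_cst 1; exists P, Q => x Sx; rewrite big_nil; exact: E.
have [P' [Q' E]] := ratfunM (H i) (ex_intro _ P (ex_intro _ Q IH)).
by exists P', Q' => x Sx; rewrite big_cons; exact: E.
Qed.

Lemma ratfun_sum (I : Type) (r : seq I) (F : I -> K -> K) :
  (forall i, ratfun (F i)) -> ratfun (fun x => \sum_(i <- r) F i x).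
Proof.
move=> H; elim: r => [|i r [P [Q IH]]].
  by have [P [Q E]] := ratfun_cst 0; exists P, Q => x Sx; rewrite big_nil; exact: E.
have [P' [Q' E]] := ratfunD (H i) (ex_intro _ P (ex_intro _ Q IH)).
by exists P', Q' => x Sx; rewrite big_cons; exact: E.
Qed.

Lemma ratfunX f k : ratfun f -> ratfun (fun x => f x ^+ k).
Proof.
move=> Hf; have [P [Q H]] := ratfun_prod (index_enum 'I_k) (fun=> Hf).
by exists P, Q => x Sx; have := H x Sx; rewrite prodr_const card_ord.
Qed.

Lemma ratfun_horner p f : ratfun f -> ratfun (fun x => p.[f x]).
Proof.
move=> Hf; have [P [Q H]] := ratfun_sum (index_enum 'I_(size p))
  (fun i : 'I_(size p) => ratfunM (ratfun_cst p`_i) (ratfunX i Hf)).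
by exists P, Q => x Sx; have := H x Sx; rewrite [p.[_]]horner_coef.
Qed.

Lemma ratfun_eq f g (s : nat -> K) : ratfun f -> ratfun g -> injective s ->
  (forall k, S (s k)) -> (forall k, f (s k) = g (s k)) ->
  forall x, S x -> f x = g x.
Proof.
move=> [P1 [Q1 H1]] [P2 [Q2 H2]] sI Ss fg x Sx.
have /poly_eq0_inj P0 := sI; have {P0} : P1 * Q2 - P2 * Q1 = 0.
  apply: P0 => k; have [n1 E1] := H1 _ (Ss k); have [n2 E2] := H2 _ (Ss k).
  have := fg k; rewrite E1 E2 => /eqP; rewrite eqr_div // => /eqP E.
  by rewrite !hornerE E subrr.
move=> /(congr1 (fun p => p.[x])) /eqP; rewrite !hornerE subr_eq0 => E.
have [n1 ->] := H1 _ Sx; have [n2 ->] := H2 _ Sx.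
by apply/eqP; rewrite eqr_div.
Qed.

Lemma ratfun_qpochc n q t f (v : 'X_{1..n}) :
  ratfun f -> ratfun (fun x => qpochc q t (f x) v).
Proof.
move=> Hf; apply: ratfun_prod => i; apply: ratfun_prod => j.
apply: ratfunD; first exact: ratfun_cst.
have [P [Q H]] := ratfunM (ratfun_cst (-1)) (ratfunM (ratfunM Hf (ratfun_cst (t ^- i)))
  (ratfun_cst (q ^+ j))).
by exists P, Q => x Sx; have := H x Sx; rewrite mulN1r.
Qed.

Lemma ratfun_yratio m q t f g (v : 'X_{1..m.+1}) :
  (forall x, S x -> f x != 0) -> (forall x, S x -> qpochc q t (g x) v != 0) ->
  ratfun f -> ratfun g -> ratfun (fun x => yratio q t (f x) (g x) v).
Proof.
move=> f0 g0 Hf Hg; apply: ratfunM; last first.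
  by apply: ratfunV => //; exact: ratfun_qpochc.
apply: ratfunM; last exact: ratfun_qpochc.
by apply: ratfunX; apply: ratfunM => //; exact: ratfunV.
Qed.

End RationalFunctions.

(** * Connection coefficients and rational continuation *)

Section Coefficients.

Variables (K : fieldType) (m : nat) (q t : K).
Hypothesis gen : generic_qt q t.
Implicit Types (u v w : 'X_{1..m.+1}) (j k l d : nat).
Implicit Types (f g h : {mpoly K[m.+1]}) (a b c : K).

Notation sp := (spectral q t).
Notation P := {mpoly K[m.+1]}.
Notation pr d := (pihomog mdeg d).

Let q0 : q != 0 := gen_q0 gen.

Let t0 : t != 0 := gen_t0 gen.

Variable N : 'X_{1..m.+1} -> P.
Hypothesis fam : interp_family q t N.

Notation E := (Etop N).
Notation coN := (cN q t N).
Notation good := (good m q t).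
Notation yratio := (yratio q t).

Lemma cN_sum (I : Type) (r : seq I) (x : I -> K) (F : I -> P) w :
  coN (\sum_(i <- r) x i *: F i) w = \sum_(i <- r) x i * coN (F i) w.
Proof.
elim: r => [|i r IH]; last by rewrite !big_cons cN_lin IH.
by rewrite !big_nil (cN_small gen fam) // msize0.
Qed.

(** A connection coefficient as a polynomial in z = a / b: the component of degree k of [N u] scales
    by z^k. *)
Definition ccz u v : {poly K} := \poly_(k < (mdeg u).+1) coN (pr k (N u)) v.

Lemma cczE z u v : coN (dilate z (N u)) v = (ccz u v).[z].
Proof.
have Nu : (msize (N u) <= (mdeg u).+1)%N by case: fam.
rewrite {1}(pihomog_partitionE Nu) (lin_sum _ _ _ (lin_dil z)) horner_poly.
under eq_bigr => k _ do rewrite dil_pr.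
by rewrite cN_sum; apply: eq_bigr => k _; rewrite mulrC.
Qed.

Lemma ccz_small z u v : (mdeg u < mdeg v)%N -> (ccz u v).[z] = 0.
Proof.
move=> uv; rewrite -cczE (cN_small gen fam) //.
apply: leq_trans (msize_dil _ _) _; apply: leq_trans uv.
by case: fam.
Qed.

Lemma D_expand a b d u : b != 0 -> (mdeg u < d)%N ->
  D N a u = \sum_(v <- upto m.+1 d) (ccz u v).[a / b] *: D N b v.
Proof.
move=> b0 ud; have Nu : (msize (N u) <= (mdeg u).+1)%N by case: fam.
have sz : (msize (dilate (a / b) (N u)) <= d)%N.
  by apply: leq_trans (msize_dil _ _) _; apply: leq_trans ud.
rewrite /D -{1}(divfK b0 a) mulrC -dil_dil -{1}(interp_id gen fam sz) interpE.
rewrite (lin_sum _ _ _ (lin_dil b)); apply: eq_bigr => v _.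
by rewrite (linZ _ _ (lin_dil b)) cczE.
Qed.

Definition cD c f w : K := coN (dilate c^-1 f) w.

Lemma cD_sum c (I : Type) (r : seq I) (x : I -> K) (F : I -> P) w :
  cD c (\sum_(i <- r) x i *: F i) w = \sum_(i <- r) x i * cD c (F i) w.
Proof.
rewrite /cD (lin_sum _ _ _ (lin_dil _)) -cN_sum; congr (coN _ w).
by apply: eq_bigr => i _; rewrite (linZ _ _ (lin_dil _)).
Qed.

Lemma cD_D c b v w : cD c (D N b v) w = (ccz v w).[b / c].
Proof. by rewrite /cD /D dil_dil mulrC cczE. Qed.

Lemma cD_diag c v w : c != 0 -> cD c (D N c v) w = (w == v)%:R.
Proof. by move=> c0; rewrite /cD /D dil_dil mulVf // dil_1 (cN_N gen fam). Qed.

Definition cc_sum a b c d u w : K := yratio c b u *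
  \sum_(v <- upto m.+1 d) (ccz u v).[a / b] * yratio a c v * (ccz v w).[b / c].

(** Apply [star_triangle] to M_u(ax) and read off the coefficient of M_w(cx). On the left each
    factor acts as a scalar in the basis for a, then for b; on the right the one factor is scalar in
    the basis for c. *)
Lemma cc_lattice b k l d u w : b != 0 -> good b -> (l <= k)%N -> (mdeg u < d)%N ->
  cc_sum (q ^+ k * b) b (q ^+ l * b) d u w =
  (ccz u w).[(q ^+ k * b) / (q ^+ l * b)] * yratio (q ^+ k * b) b w.
Proof.
move=> b0 gb lk ud; set a := q ^+ k * b; set c := q ^+ l * b.
have a0 : a != 0 by rewrite mulf_neq0 // expf_neq0.
have c0 : c != 0 by rewrite mulf_neq0 // expf_neq0.
have gc : good c by exact: good_shift.
have := congr1 (fun f => cD c f w) (star_triangle gen fam (D N a u) b0 gb lk).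
rewrite -/a -/c (opLs_D gen fam) // -/c {1}(D_expand a b0 ud) {1}(D_expand a c0 ud).
have lL s b' j := @lin_opLs K m q t gen s b' j.
rewrite (linZ _ _ (lL _ _ _)) !(lin_sum _ _ _ (lL _ _ _)).
have E1 : \sum_(v <- upto m.+1 d) opLs gen b^-1 c (k - l) ((ccz u v).[a / b] *: D N b v)
   = \sum_(v <- upto m.+1 d) ((ccz u v).[a / b] * yratio a c v) *: D N b v.
  apply: eq_bigr => v _; rewrite (linZ _ _ (lL _ _ _)) (opLs_D gen fam) // scalerA.
  by rewrite /c mulrA -exprD subnK.
have E2 : \sum_(v <- upto m.+1 d) opLs gen c^-1 b k ((ccz u v).[a / c] *: D N c v)
   = \sum_(v <- upto m.+1 d) ((ccz u v).[a / c] * yratio a b v) *: D N c v.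
  by apply: eq_bigr => v _; rewrite (linZ _ _ (lL _ _ _)) (opLs_D gen fam) // scalerA.
rewrite E1 E2 cD_sum.
have -> f : cD c (yratio c b u *: f) w = yratio c b u * cD c f w.
  have := cD_sum c [:: tt] (fun=> yratio c b u) (fun=> f) w.
  by rewrite !big_cons !big_nil !addr0.
rewrite cD_sum => H; rewrite /cc_sum.
under eq_bigr => v _ do rewrite -(cD_D c b v w).
rewrite {}H; under eq_bigr => v _ do rewrite cD_diag //.
have [wd|dw] := ltnP (mdeg w) d.
  rewrite (bigD1_seq w) ?mem_upto ?uniq_upto //= eqxx mulr1 big1 ?addr0 // => v.
  by rewrite eq_sym => /negbTE ->; rewrite mulr0.
rewrite ccz_small ?mul0r; last exact: leq_trans ud dw.
rewrite big_seq big1 // => v; rewrite mem_upto => vd.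
by case: (w =P v) vd => [<-|_ _]; rewrite ?mulr0 // ltnNge dw.
Qed.

Lemma qshift_inj b l : b != 0 -> injective (fun k => q ^+ (k + l) * b).
Proof. by move=> b0 k k' /(mulIf b0) /(gen_q_inj gen) /addIn. Qed.

Lemma cc_identity a b c d u w : a != 0 -> b != 0 -> c != 0 ->
  good b -> good c -> (mdeg u < d)%N ->
  cc_sum a b c d u w = (ccz u w).[a / c] * yratio a b w.
Proof.
move=> a0 b0 c0 gb gc ud.
have div S (f g : K -> K) : (forall x, S x -> g x != 0) -> ratfun S f -> ratfun S g ->
    ratfun S (fun x => f x / g x).
  by move=> g0 Hf Hg; apply: ratfunM => //; exact: ratfunV.
(* First a is freed with c = q^l b fixed; the sample points q^(k+l) b respect l <= k in the lattice
   case. *)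
have step l a' : a' != 0 -> cc_sum a' b (q ^+ l * b) d u w =
    (ccz u w).[a' / (q ^+ l * b)] * yratio a' b w.
  have ql0 : q ^+ l * b != 0 by rewrite mulf_neq0 // expf_neq0.
  have gl := good_shift gen l gb.
  move: a'; apply: (@ratfun_eq _ (fun x => x != 0) _ _ (fun k => q ^+ (k + l) * b)).
  - apply: ratfunM; first exact: ratfun_cst.
    apply: ratfun_sum => v; apply: ratfunM; last exact: ratfun_cst.
    apply: ratfunM.
      by apply: ratfun_horner; apply: div (ratfun_id _) (ratfun_cst _ _).
    by apply: ratfun_yratio => //; [exact: ratfun_id | exact: ratfun_cst].
  - apply: ratfunM.
      by apply: ratfun_horner; apply: div (ratfun_id _) (ratfun_cst _ _).
    by apply: ratfun_yratio => //; [exact: ratfun_id | exact: ratfun_cst].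
  - exact: qshift_inj.
  - by move=> k; rewrite mulf_neq0 // expf_neq0.
  - by move=> k; rewrite cc_lattice // leq_addl.
(* Then c is freed with a fixed; the samples q^k b are admissible by [good_shift]. *)
have Sc : c != 0 /\ good c by [].
move: c Sc {c0 gc}.
apply: (@ratfun_eq _ (fun c => c != 0 /\ good c) _ _ (fun k => q ^+ (k + 0) * b)).
- apply: ratfunM.
    by apply: ratfun_yratio => [x []|||] //; [exact: ratfun_id | exact: ratfun_cst].
  apply: ratfun_sum => v; apply: ratfunM.
    apply: ratfunM; first exact: ratfun_cst.
    by apply: ratfun_yratio => [|x []||] //; [exact: ratfun_cst | exact: ratfun_id].
  by apply: ratfun_horner; apply: div (ratfun_cst _ _) (ratfun_id _) => x [].
- apply: ratfunM; last exact: ratfun_cst.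
  by apply: ratfun_horner; apply: div (ratfun_cst _ _) (ratfun_id _) => x [].
- exact: qshift_inj.
- move=> k; split; last exact: good_shift.
  by rewrite mulf_neq0 // expf_neq0.
- by move=> k; apply: step.
Qed.

Lemma opHd_sp0 k f : (k <= m)%N ->
  (opHd t k f).@[sp 0%MM] = t ^+ k * f.@[sp 0%MM].
Proof.
elim: k => [|k IH] km; first by rewrite mul1r.
rewrite -[opHd t k.+1 f]/(opH t k (opHd t k f)) opHE mevalD mevalZ.
rewrite (opN_sp gen) // kap_eq0 ?mnm0E // mul0r addr0 IH ?(ltnW km) //.
by rewrite exprS mulrA.
Qed.

(** Makes the denominators of [skewE] invertible. At <0> every [opN] gives 0, so a swap of unequal
    parts relates the two values by nonvanishing [kap]; a positive last part is removed by [E_Phi],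
    since there the last coordinate is 1 and each [opH] acts as t. *)
Lemma E_sp0_neq0 u : (E u).@[sp 0%MM] != 0.
Proof.
have [d] := ubnP (mdeg u); elim: d u => // d IHd u.
apply: (@sort_ind m (fun k => 0 < k)%N
  (fun u => (mdeg u < d.+1)%N -> (E u).@[sp 0%MM] != 0)) => {}u.
  move=> mono; rewrite ltnS; have [um|[w ->]] := Phi_cases u.
    have -> : u = 0%MM.
      apply/mnmP => i; rewrite mnm0E; apply/eqP; rewrite -leqn0 leqNgt.
      apply/negP => ui; have := ltn_ord i; rewrite ltnS leq_eqVlt => /orP[/eqP im|im].
        by move: ui; rewrite (_ : i = ord_max) ?um //; exact: val_inj.
      by have := mono i ord_max im ui; rewrite um.
    have := msize_top fam 0%MM; rewrite mdeg0 leqn0 msize_poly_eq0 subr_eq0 => /eqP <- _.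
    exact: (diagN_neq0 gen fam).
  rewrite mdeg_Phi => wd; have [c c0 H] := E_Phi gen fam w.
  have := congr1 (fun f => f.@[sp 0%MM]) H.
  rewrite mevalM mevalXU mevalZ sp_max0 ?mnm0E // mul1r (opPi_E gen fam) mevalZ.
  rewrite opHd_sp0 // => H0; apply/eqP => H1; move/eqP: H0; rewrite H1 mulr0.
  rewrite !mulf_eq0 invr_eq0 (negbTE (sp_neq0 gen _ _)) expf_eq0 (negbTE t0) andbF.
  by rewrite (negbTE (IHd w wd)).
move=> j jm uj /negbTE uj1 IH ud.
have {}IH : (E (sw j u)).@[sp 0%MM] != 0 by apply: IH; rewrite mdeg_sw.
have ne : sw j u (inord j) != sw j u (inord j.+1).
  by rewrite !swE swp_l swp_r; apply: contraFneq uj1 => ->.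
have := congr1 (fun f => f.@[sp 0%MM]) (opN_E gen fam (sw j u) jm).
rewrite (opN_sp gen) // kap_eq0 ?mnm0E // mul0r swK mevalD !mevalZ => H0.
apply/eqP => H1; move/eqP: H0; rewrite H1 mulr0 addr0 eq_sym mulNr oppr_eq0 mulf_eq0.
by rewrite (negbTE IH) (negbTE (kap_neq0 gen jm ne)).
Qed.

Lemma E_sp0_dil a v : (E v).@[fun i => sp 0%MM i / a] = a ^- mdeg v * (E v).@[sp 0%MM].
Proof.
have := congr1 (fun f => f.@[sp 0%MM]) (dil_E N a^-1 v).
rewrite mevalZ exprVn dil_eval => <-; apply: meval_eq => i; exact: mulrC.
Qed.

Lemma cc_unique a b u w d (C : 'X_{1..m.+1} -> K) : b != 0 ->
  (forall v, (d <= mdeg v)%N -> C v = 0) ->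
  D N a u = \sum_(v : 'X_{1..m.+1 < d}) C v *: D N b v ->
  C w = (ccz u w).[a / b].
Proof.
move=> b0 C0 H; rewrite -cD_D H (big_upto _ _ (fun v => C v *: D N b v)) cD_sum.
under eq_bigr => v _ do rewrite cD_diag //.
have [wd|dw] := ltnP (mdeg w) d.
  rewrite (bigD1_seq w) ?mem_upto ?uniq_upto //= eqxx mulr1 big1 ?addr0 // => v.
  by rewrite eq_sym => /negbTE ->; rewrite mulr0.
rewrite C0 // big_seq big1 // => v; rewrite mem_upto => vd.
by case: (w =P v) vd => [<-|_ _]; rewrite ?mulr0 // ltnNge dw.
Qed.

End Coefficients.

(** * The normalised polynomials and the final identity *)

Lemma normM_family (K : fieldType) (m : nat) (q t : K)
    (M : 'X_{1..m.+1} -> {mpoly K[m.+1]}) : generic_qt q t ->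
  (forall v, is_interpolation_macdonald q t v (M v)) ->
  interp_family q t (normM q t M).
Proof.
move=> gen HM; have nz u : q ^+ nbin u * t ^+ nleg u / cprime q t u != 0.
  rewrite !mulf_neq0 ?invr_eq0 ?expf_neq0 ?(gen_q0 gen) ?(gen_t0 gen) //.
  apply/prodf_neq0 => i _; rewrite prodf_seq_neq0; apply/allP => j _ /=.
  rewrite subr_eq0; apply/eqP => E.
  by have [] := @gen_eq _ q t gen 0 0 _ _ (etrans (mulr1 _) E).
split=> [u|u v vu ne|u].
- by rewrite /normM; apply: leq_trans (msizeZ_le _ _) _; case: (HM u) => ->.
- by rewrite /normM mevalZ; case: (HM u) => _ -> //; rewrite mulr0.
- rewrite /normM scaler_eq0 (negbTE (nz _ u)) /=; case: (HM u) => _ _ E.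
  apply/eqP => E0; move: E; rewrite E0 mcoeff0 => /esym/eqP.
  by rewrite invr_eq0 expf_eq0 (negbTE (gen_q0 gen)) andbF.
Qed.

Lemma skewE_star_triangle (K : fieldType) (m : nat) (q t : K)
    (M : 'X_{1..m.+1} -> {mpoly K[m.+1]})
    (C : K -> K -> 'X_{1..m.+1} -> 'X_{1..m.+1} -> K)
    (a b c : K) (u w : 'X_{1..m.+1}) (d : nat) :
  generic_qt q t ->
  (forall v, is_interpolation_macdonald q t v (M v)) ->
  (forall x y : K, x != 0 -> y != 0 -> is_connection q t M x y (C x y)) ->
  a != 0 -> b != 0 -> c != 0 -> good m q t b -> good m q t c ->
  (mdeg u < d)%N ->
  \sum_(v : 'X_{1..m.+1 < d})
     qpochc q t a v / qpochc q t c v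
     * skewE q t M C a b u v * skewE q t M C b c v w
  = qpochc q t a w * qpochc q t b u / (qpochc q t b w * qpochc q t c u)
    * skewE q t M C a c u w.
Proof.
move=> gen HM HC a0 b0 c0 gb gc ud.
set N := normM q t M; have fam : interp_family q t N by exact: normM_family.
have CE x y v v' : x != 0 -> y != 0 -> C x y v v' = (ccz q t N v v').[x / y].
  move=> x0 y0; have [d' [C0 H]] := HC x y x0 y0 v.
  exact: (cc_unique gen fam v' y0 C0 H).
pose e v := (Etop N v).@[spectral q t 0%MM].
have e0 v : e v != 0 by exact: E_sp0_neq0.
have SE x y v v' : x != 0 -> y != 0 -> skewE q t M C x y v v' =
    x ^- mdeg v' * e v' / (y ^- mdeg v * e v) * (ccz q t N v v').[x / y].
  by move=> x0 y0; rewrite /skewE CE // -!E_sp0_dil.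
have := cc_identity gen fam w a0 b0 c0 gb gc ud.
rewrite (big_upto _ _ (fun v => qpochc q t a v / qpochc q t c v
     * skewE q t M C a b u v * skewE q t M C b c v w)) /cc_sum.
set S := \sum_(v <- _) _ => H.
(* The values of E_v at <0> cancel between the two skew factors, and their powers of a and c supply
   the (c / a)^|v| of [yratio]. *)
have -> : \sum_(v <- upto m.+1 d) qpochc q t a v / qpochc q t c v
     * skewE q t M C a b u v * skewE q t M C b c v w =
   e w / e u * b ^+ mdeg u * b ^- mdeg w * S.
  rewrite mulr_sumr; apply: eq_bigr => v _; rewrite !SE // /yratio expr_div_n.
  have := e0 v; have := e0 u; have := expf_neq0 (mdeg v) a0; have := expf_neq0 (mdeg v) b0.
  have := expf_neq0 (mdeg u) b0; have := expf_neq0 (mdeg v) c0; have := expf_neq0 (mdeg w) b0.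
  have := expf_neq0 (mdeg w) c0; have := gc v.
  move: (qpochc q t c v) (c ^+ mdeg w) (b ^+ mdeg w) (c ^+ mdeg v) (b ^+ mdeg u)
    (b ^+ mdeg v) (a ^+ mdeg v) (e u) (e v) (qpochc q t a v) (e w)
    (ccz q t N u v).[_] (ccz q t N v w).[_].
  clear => x1 x2 x3 x4 x5 x6 x7 x8 x9 y1 y2 y3 y4 n1 n2 n3 n4 n5 n6 n7 n8 n9.
  by field; rewrite n1 n3 n4 n5 n7 n8 n9.
rewrite SE //; move: H; rewrite /yratio !expr_div_n.
have := e0 u; have := expf_neq0 (mdeg w) a0; have := expf_neq0 (mdeg w) b0.
have := expf_neq0 (mdeg u) b0; have := expf_neq0 (mdeg u) c0.
have := gb u; have := gb w; have := gc u; have := gc w.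
move=> n1 n2 n3 n4 n5 n6 n7 n8 n9 H.
have -> : S = (b ^+ mdeg u / c ^+ mdeg u * qpochc q t c u / qpochc q t b u)^-1 *
   ((ccz q t N u w).[a / c] * (b ^+ mdeg w / a ^+ mdeg w * qpochc q t a w / qpochc q t b w)).
  by rewrite -H mulKf // !mulf_neq0 ?invr_eq0.
move: n1 n2 n3 n4 n5 n6 n7 n8 n9; move: (qpochc q t c w) (qpochc q t c u) (qpochc q t b w)
  (qpochc q t b u) (c ^+ mdeg u) (b ^+ mdeg u) (b ^+ mdeg w) (a ^+ mdeg w) (e u) (e w)
  (qpochc q t a w) (ccz q t N u w).[_].
clear => x1 x2 x3 x4 x5 x6 x7 x8 x9 y1 y2 y3 n1 n2 n3 n4 n5 n6 n7 n8 n9.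
by field; rewrite n2 n3 n4 n5 n6 n7 n8 n9.
Qed.

Theorem theorem6p5 (R : realType) (n : nat) (q t : R[i])
    (M : 'X_{1..n} -> {mpoly R[i][n]})
    (C : R[i] -> R[i] -> 'X_{1..n} -> 'X_{1..n} -> R[i])
    (a b c : R[i]) (u w : 'X_{1..n}) (d : nat) :
  (0 < n)%N ->
  `|q| < 1 ->
  generic_qt q t ->
  (forall v, is_interpolation_macdonald q t v (M v)) ->
  (forall x y : R[i], x != 0 -> y != 0 ->
     is_connection q t M x y (C x y)) ->
  a != 0 -> b != 0 -> c != 0 ->
  (forall v : 'X_{1..n}, qpochc q t b v != 0) ->
  (forall v : 'X_{1..n}, qpochc q t c v != 0) ->
  (mdeg u < d)%N ->
  \sum_(v : 'X_{1..n < d})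
     qpochc q t a v / qpochc q t c v
     * skewE q t M C a b u v * skewE q t M C b c v w
  = qpochc q t a w * qpochc q t b u / (qpochc q t b w * qpochc q t c u)
    * skewE q t M C a c u w.
Proof.
case: n M C u w => // m M C u w _ _; exact: skewE_star_triangle.
Qed.
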